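(* Let $d\in\{2,3\}$, $L,M,N$ positive integers, $K:=dM+LN$. Let $\mathbf{A}\in\mathbb{R}^{dM\times dM}$, $\mathbf{C}\in\mathbb{R}^{LN\times LN}$ be symmetric positive definite, $\mathbf{B}\in\mathbb{R}^{dM\times LN}$ such that $\begin{pmatrix}\mathbf{A}&\mathbf{B}\\ \mathbf{B}^\top&\mathbf{C}\end{pmatrix}$ is positive definite, $\mathbf{D}=\operatorname{diag}(D_1\mathbf{I}_{L\times L},\dots,D_N\mathbf{I}_{L\times L})$ with $D_i>0$, $\mathbf{l}\in\mathbb{R}^{dM}$, and let $\mathbf{S}_i:\mathbb{R}^L\times\mathbb{R}^L\to\mathbb{R}^L$ ($i=1,\dots,N$) be semismooth. Define $\mathbf{F}:\mathbb{R}^{dM}\times\mathbb{R}^{LN}\times\mathbb{R}^{LN}\to\mathbb{R}^{K+LN}$ by $\mathbf{F}(\mathbf{a},\mathbf{b},\mathbf{c})=(\mathbf{A}\mathbf{a}+\mathbf{B}\mathbf{b}+\mathbf{l},\ \mathbf{B}^\top\mathbf{a}+\mathbf{C}\mathbf{b}+\mathbf{D}\mathbf{c},\ \mathbf{S}_1(\mathbf{b}_1,\mathbf{c}_1),\dots,\mathbf{S}_N(\mathbf{b}_N,\mathbf{c}_N))$, with $\mathbf{b}_i=(b_{L(i-1)+1},\dots,b_{Li})^\top$ and $\mathbf{c}_i$ analogously. Assume $\mathbf{x}^*=(\mathbf{a}^*,\mathbf{b}^*,\mathbf{c}^* )$ is a solution of $\mathbf{F}(\mathbf{x}^* )=\mathbf{0}$.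 Every $\mathbf{H}\in\partial\mathbf{F}(\mathbf{x}^* )$ has the form $\begin{pmatrix}\mathbf{A}&\mathbf{B}&\mathbf{0}\\ \mathbf{B}^\top&\mathbf{C}&\mathbf{D}\\ \mathbf{0}&\mathbf{X}&\mathbf{Y}\end{pmatrix}$ with $\mathbf{X}=\operatorname{diag}(\mathbf{X}_1,\dots,\mathbf{X}_N)$, $\mathbf{Y}=\operatorname{diag}(\mathbf{Y}_1,\dots,\mathbf{Y}_N)$, $\mathbf{X}_i,\mathbf{Y}_i\in\mathbb{R}^{L\times L}$; suppose that for every such $\mathbf{H}$ the pair $(\mathbf{X}_i,\mathbf{Y}_i)$ is eigencomplementary for all $i\in\{1,\dots,N\}$. Then the semismooth Newton method — starting from $\mathbf{x}^{(0)}$, choose any $\mathbf{H}_k\in\partial\mathbf{F}(\mathbf{x}^{(k)})$, solve $\mathbf{H}_k\Delta\mathbf{x}^{(k)}=-\mathbf{F}(\mathbf{x}^{(k)})$ and set $\mathbf{x}^{(k+1)}=\mathbf{x}^{(k)}+\Delta\mathbf{x}^{(k)}$ — is well-defined for all starting points in a neighborhood of $\mathbf{x}^*$ and the iterates converge superlinearly to $\mathbf{x}^*$. Moreover, if the functions $\mathbf{S}_i$ are $\alpha$-order semismooth with $\alpha\in(0,1]$, then the convergence is of order $1+\alpha$.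
   Context: Semismoothness and $\alpha$-order semismoothness are in the sense of Qi and Sun (1993): $G$ is semismooth at $x$ if it is locally Lipschitz near $x$ and $\lim_{V\in\partial G(x+th'),\,h'\to h,\,t\downarrow0}Vh'$ exists for all $h$; $\alpha$-order semismooth if moreover $Vh-G'(x;h)=O(|h|^{1+\alpha})$ for $V\in\partial G(x+h)$, $h\to0$. $\partial\mathbf{F}(\mathbf{x})$ is the Clarke subdifferential: the convex hull of all limits $\lim_n\nabla\mathbf{F}(\mathbf{x}_n)$ with $\mathbf{x}_n\to\mathbf{x}$ and $\mathbf{F}$ differentiable at each $\mathbf{x}_n$. A pair $(\mathbf{F},\mathbf{G})$ of real symmetric $L\times L$ matrices is called eigencomplementary if $\mathbf{F}$ is negative semi-definite, $\mathbf{G}$ is positive semi-definite, they have a common basis of eigenvectors of $\mathbb{R}^L$, and, if both are singular, additionally $\bigoplus_{\xi\in\sigma(\mathbf{F}),\,\xi<0}\operatorname{Eig}_{\mathbf{F}}(\xi)=\operatorname{Eig}_{\mathbf{G}}(0)$ ($\sigma$ = spectrum, $\operatorname{Eig}$ = eigenspace). ''Well-defined in a neighborhood'' means there is a neighborhood $U$ of $\mathbf{x}^*$ such that for every $\mathbf{x}^{(0)}\in U$ and every choice of $\mathbf{H}_k$, all $\mathbf{H}_k$ are invertible and the iterates converge to $\mathbf{x}^*$; superlinear means $|\mathbf{x}^{(k+1)}-\mathbf{x}^*|=o(|\mathbf{x}^{(k)}-\mathbf{x}^*|)$, order $1+\alpha$ means $|\mathbf{x}^{(k+1)}-\mathbf{x}^*|=O(|\mathbf{x}^{(k)}-\mathbf{x}^*|^{1+\alpha})$.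 *)

(* Defs.v *)
From HB Require Import structures.
From mathcomp Require Import all_boot all_order all_algebra.
From mathcomp Require Import all_classical all_reals all_analysis.
Set Implicit Arguments. Unset Strict Implicit. Unset Printing Implicit Defensive.
Import Order.TTheory GRing.Theory Num.Theory.
Import numFieldNormedType.Exports.
Local Open Scope classical_set_scope.
Local Open Scope ring_scope.

Lemma idx_proof (L N : nat) (i : 'I_N) (r : 'I_L) : (L * i + r < L * N)%N.
Proof.
have hi := ltn_ord i; have hr := ltn_ord r.
apply: (@leq_trans (L * i.+1)); first by rewrite mulnS addnC ltn_add2r.
by rewrite leq_mul2l hi orbT.
Qed.
Definition idx (L N : nat) (i : 'I_N) (r : 'I_L) : 'I_(L * N) :=
  Ordinal (idx_proof i r).

Lemma blk_proof (L N : nat) (k : 'I_(L * N)) : (k %/ L < N)%N.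
Proof.
have := ltn_ord k; move: (nat_of_ord k) => m; clear k.
case: L => [|L] hk; first by rewrite mul0n in hk.
by rewrite ltn_divLR // mulnC.
Qed.
Definition blk (L N : nat) (k : 'I_(L * N)) : 'I_N := Ordinal (blk_proof k).

Lemma loc_proof (L N : nat) (k : 'I_(L * N)) : (k %% L < L)%N.
Proof.
have := ltn_ord k; move: (nat_of_ord k) => m; clear k.
case: L => [|L] hk; first by rewrite mul0n in hk.
by rewrite ltn_mod.
Qed.
Definition loc (L N : nat) (k : 'I_(L * N)) : 'I_L := Ordinal (loc_proof k).

Definition subvec (R : Type) (L N : nat) (b : 'cV[R]_(L * N)) (i : 'I_N) : 'cV[R]_L :=
  \col_r b (idx i r) 0.

Definition jac (R : realType) (n m : nat) (G : 'cV[R]_n -> 'cV[R]_m) (x : 'cV[R]_n)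
  : 'M[R]_(m, n) :=
  \matrix_(i, j) ('d G x (delta_mx j 0)) i 0.

Definition Bsubdiff (R : realType) (n m : nat) (G : 'cV[R]_n -> 'cV[R]_m)
  (x : 'cV[R]_n) : set 'M[R]_(m, n) :=
  [set H | exists u : nat -> 'cV[R]_n,
      [/\ u @ \oo --> x, (forall k, differentiable G (u k)) &
          (fun k => jac G (u k)) @ \oo --> H]].

Definition clarke (R : realType) (n m : nat) (G : 'cV[R]_n -> 'cV[R]_m)
  (x : 'cV[R]_n) : set 'M[R]_(m, n) :=
  [set H | exists (p : nat) (w : 'I_p -> R) (Hs : 'I_p -> 'M[R]_(m, n)),
      [/\ (forall j, 0 <= w j), \sum_j w j = 1,
          (forall j, Bsubdiff G x (Hs j)) & H = \sum_j w j *: Hs j]].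

Definition loc_lipschitz (R : realType) (n m : nat) (G : 'cV[R]_n -> 'cV[R]_m)
  (x : 'cV[R]_n) : Prop :=
  exists r : R, exists k : R, 0 < r /\
    forall y z, `|y - x| < r -> `|z - x| < r -> `|G y - G z| <= k * `|y - z|.

(* semismooth at x (Qi-Sun 1993): locally Lipschitz near x and
   lim_{V in dG(x+t h'), h' -> h, t -> 0+} V h'  exists for every h *)
Definition semismooth_at (R : realType) (n m : nat) (G : 'cV[R]_n -> 'cV[R]_m)
  (x : 'cV[R]_n) : Prop :=
  loc_lipschitz G x /\
  forall h : 'cV[R]_n, exists l : 'cV[R]_m, forall eps : R, 0 < eps ->
    exists delta : R, 0 < delta /\
      forall (t : R) (h' : 'cV[R]_n) (V : 'M[R]_(m, n)),
        0 < t -> t < delta -> `|h' - h| < delta ->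
        clarke G (x + t *: h') V -> `|V *m h' - l| < eps.

Definition dirderiv (R : realType) (n m : nat) (G : 'cV[R]_n -> 'cV[R]_m)
  (x h : 'cV[R]_n) (d : 'cV[R]_m) : Prop :=
  (fun t : R => t^-1 *: (G (x + t *: h) - G x)) @ 0^'+ --> d.

Definition semismooth_order_at (R : realType) (n m : nat) (alpha : R)
  (G : 'cV[R]_n -> 'cV[R]_m) (x : 'cV[R]_n) : Prop :=
  semismooth_at G x /\
  exists c : R, exists delta : R, 0 < delta /\
    forall (h : 'cV[R]_n) (V : 'M[R]_(m, n)) (d : 'cV[R]_m),
      `|h| < delta -> clarke G (x + h) V -> dirderiv G x h d ->
      `|V *m h - d| <= c * `|h| `^ (1 + alpha).

Definition sym_mx (R : realType) (L : nat) (X : 'M[R]_L) : Prop := X^T = X.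
Definition nsd (R : realType) (L : nat) (X : 'M[R]_L) : Prop :=
  forall v : 'cV[R]_L, (v^T *m X *m v) 0 0 <= 0.
Definition psd (R : realType) (L : nat) (X : 'M[R]_L) : Prop :=
  forall v : 'cV[R]_L, 0 <= (v^T *m X *m v) 0 0.
Definition singular (R : realType) (L : nat) (X : 'M[R]_L) : Prop :=
  X \notin unitmx.
Definition eigsp (R : realType) (L : nat) (X : 'M[R]_L) (xi : R) : set 'cV[R]_L :=
  [set v | X *m v = xi *: v].
Definition neg_eigsum (R : realType) (L : nat) (X : 'M[R]_L) : set 'cV[R]_L :=
  [set v | exists (p : nat) (xi : 'I_p -> R) (w : 'I_p -> 'cV[R]_L),
      [/\ (forall j, xi j < 0), (forall j, eigsp X (xi j) (w j)) & v = \sum_j w j]].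

Definition eigencomplementary (R : realType) (L : nat) (X Y : 'M[R]_L) : Prop :=
  [/\ sym_mx X /\ sym_mx Y, nsd X, psd Y,
      (exists P : 'M[R]_L, P \in unitmx /\
        forall j : 'I_L, exists xi : R, exists mu : R,
          X *m col j P = xi *: col j P /\ Y *m col j P = mu *: col j P)
    & (singular X /\ singular Y) -> neg_eigsum X = eigsp Y 0].

Definition posdef (R : realType) (n : nat) (A : 'M[R]_n) : Prop :=
  A^T = A /\ forall v : 'cV[R]_n, v != 0 -> 0 < (v^T *m A *m v) 0 0.

Definition Fsys (R : realType) (dM L N : nat)
  (A : 'M[R]_dM) (B : 'M[R]_(dM, L * N)) (C : 'M[R]_(L * N))
  (Dv : 'I_N -> R) (l : 'cV[R]_dM)
  (S : 'I_N -> 'cV[R]_(L + L) -> 'cV[R]_L)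
  (x : 'cV[R]_(dM + L * N + L * N)) : 'cV[R]_(dM + L * N + L * N) :=
  let ab := usubmx x in
  let c := dsubmx x in
  let a := usubmx ab in
  let b := dsubmx ab in
  let D : 'M[R]_(L * N) := diag_mx (\row_k Dv (blk k)) in
  col_mx (col_mx (A *m a + B *m b + l) (B^T *m a + C *m b + D *m c))
         (\col_k (S (blk k) (col_mx (subvec b (blk k)) (subvec c (blk k)))) (loc k) 0).

Definition Xblk (R : Type) (dM L N : nat) (H : 'M[R]_(dM + L * N + L * N)) (i : 'I_N)
  : 'M[R]_L :=
  \matrix_(r, s) H (rshift (dM + L * N) (idx i r)) (lshift (L * N) (rshift dM (idx i s))).
Definition Yblk (R : Type) (dM L N : nat) (H : 'M[R]_(dM + L * N + L * N)) (i : 'I_N)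
  : 'M[R]_L :=
  \matrix_(r, s) H (rshift (dM + L * N) (idx i r)) (rshift (dM + L * N) (idx i s)).

(* a run of the semismooth Newton method:  H_k in dF(x_k),
   x_{k+1} = x_k - H_k^{-1} F(x_k)  (invmx is total; invertibility of H_k is
   asserted separately in the conclusion) *)
Definition newton_run (R : realType) (n : nat) (F : 'cV[R]_n -> 'cV[R]_n)
  (x : nat -> 'cV[R]_n) (H : nat -> 'M[R]_n) : Prop :=
  forall k, clarke F (x k) (H k) /\ x k.+1 = x k - invmx (H k) *m F (x k).

(* Main.v *)
(**
  A semismooth Newton step contracts because its matrices are boundedly
  invertible near the solution and approximate the increments of F to first
  order.

  Approximation: for a Lipschitz map the increment G(z + h) - G(z) is controlled
  by the derivatives of G at points of differentiability near the segment
  [z, z + h], because by Rademacher's theorem almost all lines parallel to h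
  meet the exceptional points in a null set. These derivatives lie in the Clarke
  subdifferential, so the directional limits in the definition of semismoothness
  give V h - (G(z + h) - G(z)) = o(|h|), uniformly in the direction by
  compactness of the sphere.

  Invertibility: the convex hull of the compact set of limiting Jacobians is
  compact (Caratheodory) and the subdifferential is upper semicontinuous, so it
  suffices that every H in the subdifferential at the solution is injective. If
  H(a, b, c) = 0 then the quadratic form of the positive definite matrix at
  (a, b) equals -(sum of D_i b_i.c_i), while X_i b_i + Y_i c_i = 0 and
  eigencomplementarity give b_i.c_i >= 0.
*)
Require Import Defs.
From HB Require Import structures.
From mathcomp Require Import all_boot all_order all_algebra.
From mathcomp Require Import all_classical all_reals all_analysis.
From mathcomp Require Import measurable_realfun ring lra.
Import Order.TTheory GRing.Theory Num.Theory.
Import numFieldNormedType.Exports.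
Set Implicit Arguments. Unset Strict Implicit. Unset Printing Implicit Defensive.
Local Open Scope classical_set_scope.
Local Open Scope ring_scope.

(** * Lipschitz functions of one real variable *)

(** [clarke] is built only from points of differentiability, and a given segment may miss them all.
    Increments are therefore estimated on parallel segments arbitrarily close by. This is why
    Rademacher's theorem is needed along lines; it is derived from the one-dimensional case, where
    the derivative comes from a Radon-Nikodym density, and from the translation invariance of a
    product measure. Semismoothness at z, however, speaks of rays issuing from z, and a shifted
    segment is not such a ray. A point y + s h with y close to z is read as z + s (h + eta), where
    eta = (y - z) / s. This eta is small only while s stays away from 0, which dictates the
    treatment of the initial piece. For the sign of b_i . c_i: in a common eigenbasis, X b + Y c = 0
    makes each pair of coordinates of (b, c) proportional to (mu, -xi), with xi <= 0 <= mu, unless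
    xi = mu = 0. The condition on the eigenspaces of singular pairs excludes exactly that case. *)

Lemma lipschitz_continuous (R : realType) (phi : R -> R) (K : R) :
  (forall x y, `|phi x - phi y| <= K * `|x - y|) -> continuous phi.
Proof.
move=> hlip x; apply/cvgrPdist_le => /= e e0.
have K0 : 0 <= K by have := hlip 1 0; rewrite subr0 normr1 mulr1;
  exact: le_trans.
have K1 : 0 < K + 1 by rewrite ltr_wpDl.
near=> t; apply: le_trans (hlip _ _) _.
apply: (@le_trans _ _ ((K + 1) * `|x - t|)).
  by rewrite ler_wpM2r// lerDl.
rewrite mulrC -ler_pdivlMr//.
near: t; apply: (@cvgr_dist_le _ _ _ _ _ id x) => //. exact: divr_gt0.
Unshelve. all: by end_near. Qed.

Section lip_cumulative.
Context {R : realType} (phi : R -> R) (K : R).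
Hypothesis hlip : forall x y, `|phi x - phi y| <= K * `|x - y|.

Lemma lip_shear_nondecreasing : nondecreasing (fun x : R => phi x + K * x).
Proof.
move=> x y xy; have := hlip x y; rewrite ler_norml => /andP[_].
rewrite distrC ger0_norm ?subr_ge0//; lra.
Qed.

Lemma lip_shear_right_continuous :
  right_continuous (fun x : R => phi x + K * x).
Proof.
apply: right_continuousW => x; apply: cvgD; first exact: (lipschitz_continuous
  hlip).
by apply: cvgM; [exact: cvg_cst|exact: cvg_id].
Qed.

(** The shear by [K * x] makes [phi] monotone, so that it has a Stieltjes measure. The derivative of
    [phi] will be the density of this measure minus [K]. *)
Definition lip_cumulative : cumulative R R :=
  HB.pack (fun x : R => phi x + K * x) (isCumulative.Build R _ R _
    lip_shear_nondecreasing lip_shear_right_continuous).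
End lip_cumulative.

Lemma lebesgue_stieltjes_itvoc (R : realType) (f : cumulative R R) (a b :
  R) : a <= b ->
  lebesgue_stieltjes_measure f `]a, b]%classic = (f b - f a)%:E.
Proof.
move=> ab.
rewrite /lebesgue_stieltjes_measure /measure_extension measurable_mu_extE/=.
  by rewrite wlength_itv_bnd.
exact: is_ocitv.
Qed.

Section domination.
Context {R : realType} (phi : R -> R) (K : R).
Hypothesis K0 : 0 < K.
Hypothesis hlip : forall x y, `|phi x - phi y| <= K * `|x - y|.
Lemma lipschitz_opp x y : `|(- phi x) - (- phi y)| <= K * `|x - y|.
Proof. by rewrite -opprD normrN; exact: hlip. Qed.

(* The Stieltjes measures of [phi + K id] and [- phi + K id] add up to [2 K]
   times the Lebesgue measure. *)
Lemma lip_cumulative_dominated (A : set (measurableTypeR R)) :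
  measurable A -> lebesgue_measure A = 0%E ->
  lebesgue_stieltjes_measure (lip_cumulative hlip) A = 0%E.
Proof.
move=> mA A0.
have K2 : 0 <= (2 * K)^-1 by rewrite invr_ge0 mulr_ge0// ltW.
pose mu := mscale (NngNum K2) (measure_add (lebesgue_stieltjes_measure
  (lip_cumulative hlip))
   (lebesgue_stieltjes_measure (lip_cumulative lipschitz_opp))).
have muE X : mu X = ((2 * K)^-1%:E * (lebesgue_stieltjes_measure
  (lip_cumulative hlip) X + lebesgue_stieltjes_measure (lip_cumulative
  lipschitz_opp) X))%E.
  by rewrite -measure_addE.
have hmu X : ocitv X -> lebesgue_measure X = mu X.
  move=> [[a b] _ /= <-]; case: (leP a b) => ab; last first.
    by rewrite set_itv_ge ?muE ?measure0 ?adde0 ?mule0// bnd_simp -leNgt ltW.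
  rewrite muE /lebesgue_measure !lebesgue_stieltjes_itvoc//= -EFinD -EFinM;
    congr (_%:E).
  by field; rewrite gt_eqF.
have H := @lebesgue_measure_unique R mu hmu A mA.
have := etrans (esym (muE A)) (etrans (esym H) A0) => /eqP.
rewrite mule_eq0 eqe invr_eq0 mulf_eq0 pnatr_eq0/= gt_eqF//=.
by rewrite padde_eq0 // => /andP[/eqP].
Qed.

End domination.

(** Radon-Nikodym, applied to the Stieltjes measure after restricting it to []a, b]], where it is
    finite. *)
Lemma lip_density {R : realType} (phi : R -> R) (K : R) (K0 : 0 < K)
  (hlip : forall x y, `|phi x - phi y| <= K * `|x - y|) (a b : R) : a < b ->
  exists f : R -> R, (forall t, 0 <= f t) /\ (@lebesgue_measure R).-integrable
    setT (EFin \o f) /\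
   forall x, a <= x -> x <= b ->
     (phi x + K * x) - (phi a + K * a) =
       \int[@lebesgue_measure R]_(t in `]a, x]) f t.
Proof.
move=> ab.
set g := lip_cumulative hlip.
have mD : measurable (`]a, b]%classic : set (measurableTypeR R))
  by exact: measurable_itv.
have gD : (lebesgue_stieltjes_measure g `]a, b]%classic < +oo)%E.
  by rewrite lebesgue_stieltjes_itvoc ?ltW// ltry.
pose nu : {finite_measure set (measurableTypeR R) -> \bar R} := mfrestr mD gD.
have nudom : nu `<< (@lebesgue_measure R).
  apply/null_content_dominatesP => A mA A0.
  rewrite /nu/= /mfrestr /mrestr.
  apply: (@lip_cumulative_dominated _ _ _ K0); first exact: measurableI.
  apply/eqP; rewrite -measure_le0 -A0 le_measure// ?inE//; exact: measurableI.
have [f [f0 ffin fint fE]] := radon_nikodym_sigma_finite nudom.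
exists (fine \o f); split; first by move=> t; exact: fine_ge0.
split.
  by rewrite (_ : EFin \o (fine \o f) = f)//; apply/funext => x /=;
    rewrite fineK.
move=> x ax xb.
have H := fE `]a, x]%classic (measurable_itv _).
have nuE : nu `]a, x]%classic = (g x - g a)%:E.
  rewrite /nu/= /mfrestr /mrestr setIidl ?lebesgue_stieltjes_itvoc//.
  by apply: subset_itvl; rewrite bnd_simp.
rewrite /Rintegral; under eq_integral do rewrite /= fineK//.
by rewrite -H nuE.
Qed.

(** The derivative without a quotient: [t = 0] needs no exclusion, and [dirslope] and [fdiff] below
    take the same form. *)
Definition slope_at (R : realType) (phi : R -> R) (s d : R) :=
  forall e, 0 < e -> exists2 r, 0 < r &
    forall t, `|t| < r -> `|phi (s + t) - phi s - t * d| <= e * `|t|.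

Lemma derivable_slope (R : realType) (phi : R -> R) (s : R) :
  derivable phi s 1 -> slope_at phi s (derive1 phi s).
Proof.
move=> /derivableP [] dphi; rewrite derive1E => _ e e0.
move/cvg_ex: dphi => [l hl].
have -> : 'D_1 phi s = l by apply/cvg_lim.
move/cvgrPdist_le : hl => /(_ e e0).
rewrite /at_right near_withinE => /nbhs_ballP[r /= r0 hr].
exists r => // t tr; have [->|t0] := eqVneq t 0.
  by rewrite addr0 subrr mul0r subr0 !normr0 mulr0.
have := hr t; rewrite /ball/= sub0r normrN => /(_ tr t0).
rewrite distrC [t *: 1]mulr1 [s + t]addrC => h.
have -> : phi (t + s) - phi s - t * l = t * (t^-1 * (phi (t + s) - phi s) - l).
  by rewrite mulrBr mulVKf.
by rewrite normrM mulrC ler_wpM2r.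
Qed.

Lemma slope_unique (R : realType) (phi : R -> R) (s d d' : R) :
  slope_at phi s d -> slope_at phi s d' -> d = d'.
Proof.
move=> h h'; apply/eqP; rewrite -subr_eq0 -normr_le0;
  apply/ler_addgt0Pr => e e0.
rewrite add0r.
have e2 : 0 < e / 2 by rewrite divr_gt0.
have [r r0 hr] := h _ e2; have [r' r0' hr'] := h' _ e2.
pose t := Num.min r r' / 2.
have m0 : 0 < Num.min r r' by rewrite lt_min r0.
have t0 : 0 < t by rewrite divr_gt0.
have tm : `|t| < Num.min r r'.
  by rewrite gtr0_norm// /t ltr_pdivrMr// ltr_pMr// ltr1n.
move: tm; rewrite lt_min => /andP[/hr h1 /hr' h2].
have : `|t * (d - d')| <= e * `|t|.
  have -> : t * (d - d') = (phi (s + t) - phi s - t * d') - (phi (s + t) - phi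
    s - t * d) by ring.
  apply: le_trans (ler_normB _ _) _.
  rewrite [e]splitr mulrDl; exact: lerD.
by rewrite normrM mulrC ler_pM2r ?normr_gt0 ?gt_eqF.
Qed.

(** By Lebesgue differentiation, the indefinite integral of the density has derivative [f] almost
    everywhere; undoing the shear subtracts [K]. *)
Lemma lip_slope_density {R : realType} (phi : R -> R) (K : R) (K0 : 0 < K)
  (hlip : forall x y, `|phi x - phi y| <= K * `|x - y|) (a b : R) : a < b ->
  exists f : R -> R, [/\ (forall t, 0 <= f t), (@lebesgue_measure
    R).-integrable setT (EFin \o f) ,
    phi b + K * b - (phi a + K * a) =
      \int[@lebesgue_measure R]_(t in `]a, b]) f t &
    {ae (@lebesgue_measure R), forall s, a < s < b ->
      slope_at phi s (f s - K)}].
Proof.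
move=> ab; have [f [f0 [fi fE]]] := lip_density K0 hlip ab.
exists f; split => //; first exact: fE (ltW ab) (lexx _).
have locf : locally_integrable setT f by apply: open_integrable_locally => //;
  exact: openT.
have fi' y : (@lebesgue_measure R).-integrable [set` Interval (BRight a)
  (BRight y)] (EFin \o f).
  exact: integrableS fi.
have := FTC1 fi' locf.
apply: filterS; first exact: (ae_filter_ringOfSetsType (@lebesgue_measure R)).
move=> s /= + /andP[as_ sb].
move=> /(_ as_) [dF <-].
have := derivable_slope dF.
set F := fun x => _ => hs e e0.
have [r r0 hr] := hs e e0.
(* The radius also keeps [s + t] inside []a, b[], where the integral formula [fE] is available. *)
exists (Num.min r (Num.min (s - a) (b - s))) => [|t].
  by rewrite !lt_min r0 !subr_gt0 as_.
rewrite !lt_min => /and3P[tr ta tb].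
move: ta tb; rewrite !ltr_norml => /andP[ta _] /andP[_ tb].
have := hr t tr; rewrite /F /= -!fE; try lra.
suff -> : phi (s + t) + K * (s + t) - (phi a + K * a) -
   (phi s + K * s - (phi a + K * a)) - t * derive1 F s =
   phi (s + t) - phi s - t * (derive1 F s - K) by [].
ring.
Qed.

(** Rademacher's theorem on the line: the null sets belonging to the intervals []- (n + 1), n + 1[]
    are merged. The constant is enlarged because the density was obtained for a positive one. *)
Lemma lip_ae_slope {R : realType} (phi : R -> R) (K : R)
  (hlip : forall x y, `|phi x - phi y| <= K * `|x - y|) :
  {ae (@lebesgue_measure R), forall s, exists d, slope_at phi s d}.
Proof.
have K0 : 0 < `|K| + 1 by rewrite ltr_wpDl.
have hl x y : `|phi x - phi y| <= (`|K| + 1) * `|x - y|.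
  by apply: le_trans (hlip _ _) _; rewrite ler_wpM2r// ler_wpDr// ler_norm.
have H : {ae (@lebesgue_measure R), forall s, forall n : nat,
     - (n%:R + 1) < s < n%:R + 1 -> exists d, slope_at phi s d}.
  apply: ae_foralln => n.
  have nn : - (n%:R + 1) < n%:R + 1 :> R by have := ler0n R n; lra.
  have [f [_ _ _]] := lip_slope_density K0 hl nn.
  apply: filterS; first exact: (ae_filter_ringOfSetsType (@lebesgue_measure R)).
  by move=> s hs /hs h; eexists; exact: h.
apply: filterS H; first exact: (ae_filter_ringOfSetsType (@lebesgue_measure R)).
move=> s /(_ (Num.trunc `|s|)); apply.
have := truncnS_gt `|s|. rewrite -natr1 => h. rewrite -ltr_norml.
exact: h.
Qed.

(** A mean value inequality that ignores a null set of points. The Cantor function shows that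
    continuity would not do; here the increment is the integral of its density, which is compared
    with a constant almost everywhere. *)
Lemma lip_slope_le {R : realType} (phi : R -> R) (K : R)
  (hlip : forall x y, `|phi x - phi y| <= K * `|x - y|) (a b c : R) : a <= b ->
  {ae (@lebesgue_measure R), forall s, a < s < b ->
    exists d, d <= c /\ slope_at phi s d} ->
  phi b - phi a <= c * (b - a).
Proof.
rewrite le_eqVlt => /predU1P[->|ab hs]; first by rewrite !subrr mulr0.
(* Adding [|c|] makes [c + K'] nonnegative, so that integrals of nonnegative functions are
   compared. *)
pose K' := `|K| + `|c| + 1.
have K0 : 0 < K' by rewrite ltr_wpDl.
have cK0 : 0 <= c + K' by rewrite /K'; have := ler_norm (- c); rewrite normrN;
  have := normr_ge0 K; lra.
have hl x y : `|phi x - phi y| <= K' * `|x - y|.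
  by apply: le_trans (hlip _ _) _; rewrite ler_wpM2r// /K' -addrA ler_wpDr//
    ?ler_norm// addr_ge0.
have [f [f0 fi fE fs]] := lip_slope_density K0 hl ab.
suff : \int[@lebesgue_measure R]_(t in `]a, b]) f t <= (c + K') * (b - a).
  rewrite -fE; lra.
rewrite -Rintegral_itv_bndo_bndc; last exact: integrableS fi.
have mab : measurable (`]a, b[%classic : set (measurableTypeR R))
  by exact: measurable_itv.
have muab : lebesgue_measure (`]a, b[%classic : set (measurableTypeR R)) = (b -
  a)%:E.
  by rewrite lebesgue_measure_itv/= lte_fin ab.
have fi' : (@lebesgue_measure R).-integrable `]a, b[ (EFin \o f)
  by exact: integrableS fi.
have -> : (c + K') * (b - a) =
    \int[@lebesgue_measure R]_(t in `]a, b[) (c + K').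
  by rewrite Rintegral_cst//; congr (_ * _);
    rewrite (_ : _ `]a, b[%classic = (b - a)%:E).
have ci : (@lebesgue_measure R).-integrable `]a, b[ (EFin \o (fun=> c + K')).
  by apply: measurable_bounded_integrable => //=; rewrite ?muab ?ltry//;
    exact: bounded_cst.
have fl (x y : \bar R) : x \is a fin_num -> y \is a fin_num -> (x <= y)%E ->
  fine x <= fine y.
  by move=> *; exact: fine_le.
rewrite /Rintegral. apply: fl; [exact: integrable_fin_num|exact:
  integrable_fin_num|].
apply: ae_ge0_le_integral => //.
- by move=> x _; rewrite lee_fin.
- by case/integrableP : fi'.
apply: filterS2 hs fs; first exact: (ae_filter_ringOfSetsType
  (@lebesgue_measure R)).
move=> s h1 h2; rewrite /= in_itv/= => h.
have [d [dc sd]] := h1 h.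
by rewrite lee_fin; have := slope_unique (h2 h) sd; lra.
Qed.

(** * Null sets on lines *)

Lemma lebesgue_shift (R : realType) (c : R) (A : set (measurableTypeR R)) :
  measurable A ->
  lebesgue_measure ((fun x : measurableTypeR R =>
    x + c) @^-1` A) = lebesgue_measure A.
Proof.
move=> mA.
have mf : measurable_fun setT (fun x : measurableTypeR R =>
  x + c : measurableTypeR R).
  by apply: measurable_funD => //; exact: measurable_cst.
pose f : {mfun measurableTypeR R >-> measurableTypeR R} :=
  HB.pack (fun x : measurableTypeR R => x + c : measurableTypeR R)
    (isMeasurableFun.Build _ _ _ _ _ mf).
have H X : ocitv X -> lebesgue_measure X = pushforward (@lebesgue_measure R) f
  X.
  move=> [[a b] _ /= <-]. rewrite /pushforward.
  rewrite (_ : f @^-1` _ = `]a - c, b - c]%classic); last first.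
    by apply/seteqP; split => x /=; rewrite !in_itv/= ltrBlDr lerBrDr.
  rewrite !lebesgue_measure_itv/= !lte_fin ltrD2r; case: ifPn => // _.
  by rewrite -!EFinB; congr (_%:E); ring.
by rewrite (lebesgue_measure_unique H mA).
Qed.

(* A stand-in for Lebesgue measure on column vectors: a measure space with
   Borel coordinates [ls_pt] on which translation by [v] lifts to [ls_shift v]. *)
Record lebspace (R : realType) (n : nat) := Lebspace {
 ls_d : measure_display;
 ls_T : measurableType ls_d;
 ls_mu : {sigma_finite_measure set ls_T -> \bar R};
 ls_pt : ls_T -> 'cV[R]_n;
 ls_shift : 'cV[R]_n -> ls_T -> ls_T;
 ls_pt_measurable : forall i, measurable_fun setT (fun t => ls_pt t i 0);
 ls_ptD : forall v t, ls_pt (ls_shift v t) = ls_pt t + v;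
 ls_shift_measurable : forall v, measurable_fun setT (fun st :
   measurableTypeR R * ls_T => ls_shift (st.1 *: v) st.2);
 ls_shift_invariant : forall v A, measurable A ->
   ls_mu (ls_shift v @^-1` A) = ls_mu A;
 ls_box_gt0 : forall lo hi : 'cV[R]_n, (forall i, lo i 0 < hi i 0) ->
    (0 < ls_mu [set t | forall i, (lo i 0 < ls_pt t i 0 < hi i 0)%R])%E }.

Lemma lebspace0 (R : realType) : lebspace R 0.
Proof.
refine (@Lebspace R 0 _ _ (@dirac _ unit tt R) (fun=> 0) (fun _ t =>
  t) _ _ _ _ _).
- by case.
- by move=> v t; rewrite (flatmx0 v) addr0.
- move=> v; exact: measurable_snd.
- by [].
- move=> lo hi _. by rewrite /= diracE mem_set/= ?lte_fin// => -[].
Defined.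

Lemma sigma_finite_prod d1 d2 (T1 : measurableType d1) (T2 :
  measurableType d2) (R : realType)
  (m1 : {sigma_finite_measure set T1 -> \bar R}) (m2 :
    {sigma_finite_measure set T2 -> \bar R}) :
  sigma_finite setT (m1 \x m2)%E.
Proof.
have /sigma_finiteP[F [TF ndF hF]] := sigma_finiteT m1.
have /sigma_finiteP[G [TG ndG hG]] := sigma_finiteT m2.
exists (fun n => F n `*` G n) => [|n]; last first.
  have [[mF fF] [mG fG]] := (hF n, hG n).
  split; first exact: measurableX.
  by rewrite product_measure1E// lte_mul_pinfty// ge0_fin_numE.
apply/esym/seteqP; split => // -[x y] _.
have [i _ Fx] : (\bigcup_i F i) x by rewrite -TF.
have [j _ Gy] : (\bigcup_i G i) y by rewrite -TG.
exists (maxn i j) => //; split => /=.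
  by apply: (subsetPset _ _ (ndF _ _ (leq_maxl i j))).
by apply: (subsetPset _ _ (ndG _ _ (leq_maxr i j))).
Qed.

(** A Lebesgue factor is added as coordinate [ord0]. Translation invariance follows from the
    uniqueness of the product measure: on rectangles it reduces to invariance of both factors. *)
Lemma lebspaceS (R : realType) (n : nat) : lebspace R n -> lebspace R n.+1.
Proof.
case=> d T mu pt sh hm hE hs hi hb.
pose lam : {sigma_finite_measure set (measurableTypeR R) ->
  \bar R} := @lebesgue_measure R.
pose mu' : {sigma_finite_measure set (measurableTypeR R * T)%type -> \bar R} :=
  HB.pack (lam \x mu)%E (Measure_isSigmaFinite.Build _ _ _ (lam \x mu)%E
    (sigma_finite_prod lam mu)).
pose pt' (x : measurableTypeR R * T) : 'cV[R]_n.+1 :=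
  \col_i (if unlift ord0 i is Some j then pt x.2 j 0 else x.1).
pose tl (v : 'cV[R]_n.+1) : 'cV[R]_n := \col_i v (lift ord0 i) 0.
pose sh' (v : 'cV[R]_n.+1) (x : measurableTypeR R * T) :
  measurableTypeR R * T :=
  (x.1 + v ord0 0, sh (tl v) x.2).
have msh v : measurable_fun setT (sh v).
  have := measurable_fun_pair2 (1 : measurableTypeR R) (hs v).
  by apply: eq_measurable_fun => t _ /=; rewrite scale1r.
have madd c : measurable_fun setT (fun x : measurableTypeR R =>
  x + c : measurableTypeR R).
  by apply: measurable_funD => //; exact: measurable_cst.
have msh' v : measurable_fun setT (sh' v).
  apply: measurable_fun_pair.
    exact: (measurableT_comp (madd _) measurable_fst).
  exact: (measurableT_comp (msh _) measurable_snd).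
refine (@Lebspace R n.+1 _ _ mu' pt' sh' _ _ _ _ _).
- move=> i; case: (unliftP ord0 i) => [j|] ->.
    have := measurableT_comp (hm j) (@measurable_snd _ _ (measurableTypeR R) T).
    by apply: eq_measurable_fun => t _ /=; rewrite mxE liftK.
  have := @measurable_fst _ _ (measurableTypeR R) T.
  by apply: eq_measurable_fun => t _ /=; rewrite mxE unlift_none.
- move=> v t; apply/colP => i; rewrite !mxE; case: unliftP => [j|] -> //=.
  by rewrite hE !mxE.
- move=> v; apply: measurable_fun_pair => /=.
    apply: measurable_funD.
      exact: (measurableT_comp measurable_fst measurable_snd).
    apply: (eq_measurable_fun (fun st : measurableTypeR R * (measurableTypeR R
      * T) => st.1 * v ord0 0)).
      by move=> st _; rewrite mxE.
    by apply: measurable_funM => //; exact: measurable_cst.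
  have : measurable_fun setT (fun st : measurableTypeR R * (measurableTypeR R *
    T) => (st.1, st.2.2)).
    apply: measurable_fun_pair => //.
    exact: (measurableT_comp measurable_snd measurable_snd).
  move=> /(measurableT_comp (hs (tl v))).
  apply: eq_measurable_fun => st _ /=; congr sh; apply/colP => i;
    by rewrite !mxE.
- move=> v A mA.
  pose f : {mfun (measurableTypeR R * T)%type >-> (measurableTypeR R * T)%type}
    :=
    HB.pack (sh' v) (isMeasurableFun.Build _ _ _ _ _ (msh' v)).
  have -> : mu' (sh' v @^-1` A) = pushforward mu' f A by [].
  apply/esym; apply: (@product_measure_unique _ _ _ _ _ lam mu (pushforward mu'
    f)) => // A1 A2 mA1 mA2.
  change ((lam \x mu)%E (((fun x : measurableTypeR R =>
    x + v ord0 0) @^-1` A1) `*` (sh (tl v) @^-1` A2)) = (lam A1 * mu A2)%E).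
  rewrite product_measure1E; last first.
    by rewrite -[X in measurable X]setTI; exact: msh.
    by rewrite -[X in measurable X]setTI; exact: madd.
  by rewrite hi//; congr (_ * _)%E; exact: lebesgue_shift.
- move=> lo hi' lh.
  pose I : set (measurableTypeR R) := `]lo ord0 0, hi' ord0 0[%classic.
  pose J : set T := [set t | forall i, tl lo i 0 < pt t i 0 < tl hi' i 0].
  rewrite (_ : [set t | _] = I `*` J).
    change (0%R < (lam \x mu) (I `*` J))%E.
    rewrite product_measure1E//; last 2 first.
      exact: measurable_itv.
      rewrite (_ : J = \bigcap_(i in [set: 'I_n]) ((fun t =>
        pt t i 0) @^-1` `]tl lo i 0, tl hi' i 0[%classic)).
        apply: fin_bigcap_measurable => //.
        move=> i _; rewrite -[X in measurable X]setTI; apply: hm => //;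
          exact: measurable_itv.
      by apply/seteqP; split => [t h i _|t h i]; have := h i;
        rewrite /= in_itv/= => h'; [exact: h'|exact: h'].
    apply: mule_gt0; last by apply: hb => i; rewrite !mxE.
    have I0 : lam I = (hi' ord0 0 - lo ord0 0)%:E.
      by apply: etrans (lebesgue_measure_itv _) _; rewrite /= lte_fin lh.
    have I1 : (0%R < lam I)%E by rewrite I0 lte_fin subr_gt0.
    exact: I1.
  apply/seteqP; split => [[x t] /= h|[x t] /= [h1 h2] i].
    split => [|i]; first by have := h ord0; rewrite mxE unlift_none /I /=
      in_itv.
    by have := h (lift ord0 i); rewrite /tl !mxE liftK.
  rewrite mxE; case: unliftP => [j|] ->; first by have := h2 j; rewrite !mxE.
  by move: h1; rewrite /I /= in_itv.
Defined.

Lemma lebspace_exists (R : realType) (n : nat) : inhabited (lebspace R n).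
Proof. elim: n => [|n [ls]]; [exact: inhabits (lebspace0 R)|exact: inhabits
  (lebspaceS ls)]. Qed.

(** * Borel sets of column vectors and their traces on lines *)

Definition borel (R : realType) (n : nat) : set (set 'cV[R]_n) :=
  <<s [set U | open U] >>.

Lemma ball_cVE (R : realType) (n : nat) (x y : 'cV[R]_n) (e : R) : 0 < e ->
  ball x e y <-> forall i, `|x i 0 - y i 0| < e.
Proof.
move=> e0; split => [[_ h] i|h]; first exact: h.
by split => // i j; rewrite ord1; exact: h.
Qed.

(** Balls of the max norm are boxes, whose preimages under [ls_pt] are measurable because its
    coordinates are. A countable union of them therefore settles all open sets. *)
Lemma open_rat_balls (R : realType) (n : nat) (U : set 'cV[R]_n) : open U ->
  U = \bigcup_(p : 'cV[rat]_n * nat) (if `[< ball (map_mx ratr p.1 :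
    'cV[R]_n) p.2.+1%:R^-1 `<=` U >] then
     ball (map_mx ratr p.1 : 'cV[R]_n) p.2.+1%:R^-1 else set0).
Proof.
move=> oU; apply/seteqP; split => [x Ux|x [p _]];
  last by case: asboolP => // h; exact: h.
have [e /= e0 eU] : nbhs_ball x U by apply/nbhs_ballP; exact: oU.
have e2 : 0 < e / 2 by rewrite divr_gt0.
pose k := Num.trunc (e / 2)^-1.
have k0 : (0 : R) < k.+1%:R^-1 by rewrite invr_gt0.
have ke : k.+1%:R^-1 < e / 2 :> R.
  by rewrite -[ltRHS]invrK ltf_pV2 ?posrE ?invr_gt0// truncnS_gt.
have [q hq] : exists q : 'cV[rat]_n, forall i, `|ratr (q i 0) - x i 0| <
  k.+1%:R^-1.
  have /choice[f hf] : forall i : 'I_n, exists r : rat,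
    `|ratr r - x i 0| < k.+1%:R^-1.
    move=> i; have : x i 0 - k.+1%:R^-1 < x i 0 + k.+1%:R^-1
      by rewrite ltrD2l gtrN.
    move=> /rat_in_itvoo[r]; rewrite in_itv/= => h; exists r.
    by move: h; rewrite ltr_norml; move: (k.+1%:R^-1) => d /andP[h1 h2];
      apply/andP; split; lra.
  by exists (\col_i f i) => i; rewrite mxE.
exists (q, k) => //=; case: asboolP => [h|[]].
  by apply/ball_cVE => // i; rewrite mxE.
move=> y /ball_cVE-/(_ k0) hy; apply: eU; apply/ball_cVE => // i.
have := hy i; have := hq i; rewrite mxE => h1 h2.
rewrite (_ : _ - _ = (ratr (q i 0) - y i 0) - (ratr (q i 0) - x i 0));
  last by ring.
apply: le_lt_trans (ler_normB _ _) _; rewrite [e]splitr; apply: ltrD;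
  exact: lt_trans ke.
Qed.

Lemma measurable_preimage_pt (R : realType) (n : nat) (ls : lebspace R n) N :
  borel N ->
  measurable (@ls_pt R n ls @^-1` N).
Proof.
move=> bN; apply: (bN [set N | measurable (@ls_pt R n ls @^-1` N)]); split.
  split => [|A /= mA|F mF] /=.
  - by rewrite preimage_set0.
  - by rewrite setTD preimage_setC; exact: measurableC.
  - by rewrite preimage_bigcup; apply: bigcupT_measurable.
move=> U /open_rat_balls -> /=; rewrite preimage_bigcup.
apply: countable_bigcupT_measurable => // -[q k] /=.
case: ifP => _; last by rewrite preimage_set0.
have k0 : (0 : R) < k.+1%:R^-1 by rewrite invr_gt0.
rewrite (_ : _ @^-1` _ = \bigcap_(i in [set: 'I_n]) ((fun t =>
  @ls_pt R n ls t i 0) @^-1` `]ratr (q i 0) - k.+1%:R^-1,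
  ratr (q i 0) + k.+1%:R^-1[%classic)).
  apply: fin_bigcap_measurable => //.
  move=> i _; rewrite -[X in measurable X]setTI;
    apply: ls_pt_measurable => //; exact: measurable_itv.
apply/seteqP; split => [t /= /ball_cVE-/(_ k0) h i _|t h];
  last apply/ball_cVE => // i.
  by have := h i; rewrite mxE/= in_itv/= ltr_norml;
    move: (k.+1%:R^-1) => e /andP[h1 h2]; apply/andP; split; lra.
by have := h i Logic.I; rewrite mxE/= in_itv/= ltr_norml;
  move: (k.+1%:R^-1) => e /andP[h1 h2]; apply/andP; split; lra.
Qed.

Section lines.
Context (R : realType) (n : nat) (ls : lebspace R n).
Let lam : {sigma_finite_measure set (measurableTypeR R) ->
  \bar R} := @lebesgue_measure R.
Let mu := @ls_mu R n ls.
Let pt := @ls_pt R n ls.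

(* Fubini on [R * ls_T] for the set of the [(s, t)] with [N (ls_pt t + s *: v)]. *)
Lemma null_linesP (N : set 'cV[R]_n) (v : 'cV[R]_n) : borel N ->
  mu (pt @^-1` N) = 0%E <-> {ae mu, forall t, lam [set s | N (pt t + s *: v)] =
    0%E}.
Proof.
move=> bN.
pose E := (fun st : measurableTypeR R * @ls_T R n ls =>
  ls_shift (st.1 *: v) st.2) @^-1` (pt @^-1` N).
have mN : measurable (pt @^-1` N) by exact: measurable_preimage_pt.
have mE : measurable E by rewrite -[X in measurable X]setTI;
  apply: ls_shift_measurable.
have FE := indic_fubini_tonelli lam mu mE.
rewrite indic_fubini_tonelli_FE// indic_fubini_tonelli_GE// in FE.
have L1 : (\int[lam]_x (mu \o xsection E) x = \int[lam]_x (cst (mu (pt @^-1`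
  N)) x))%E.
  apply: eq_integral => s _ /=; rewrite xsectionE.
  rewrite -[RHS](@ls_shift_invariant R n ls (s *: v))//.
rewrite L1 integral_cst// in FE.
have lamT : lam setT = +oo%E.
  by rewrite -set_itvNyy; apply: etrans (lebesgue_measure_itv _) _.
have {}FE : (mu (pt @^-1` N) * +oo)%E = (\int[mu]_x (lam \o ysection E) x)%E.
  by rewrite -FE; congr (_ * _)%E; exact/esym/lamT.
have yE t : ysection E t = [set s | N (pt t + s *: v)].
  by rewrite ysectionE; apply/seteqP; split => s; rewrite /E /= /pt ls_ptD.
have mf := measurable_fun_ysection lam mE.
have := ae_eq_integral_abs mu measurableT mf.
under eq_integral do rewrite /= gee0_abs//.
rewrite -FE => -[h1 h2]; split => h.
  have : ae_eq mu setT (lam \o ysection E) (cst 0%E) by apply: h1;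
    rewrite h mul0e.
  apply: filterS.
  by move=> t /(_ Logic.I) /=; rewrite yE.
have : (mu (pt @^-1` N) * +oo)%E = 0%E.
  apply: h2; apply: filterS h.
  by move=> t /=; rewrite yE.
by move/eqP; rewrite mule_eq0 orbF => /eqP.
Qed.

(** Two uses of [null_linesP] exchange directions: null on every line along [v k] implies null for
    [mu], which implies null on almost every line along [h]. A box around [a] has positive measure,
    so one of these good lines starts within [e] of [a]. *)
Lemma null_lines_choose (N : nat -> set 'cV[R]_n) (v : nat -> 'cV[R]_n) :
  (forall k, borel (N k)) ->
  (forall k x, lam [set s | N k (x + s *: v k)] = 0%E) ->
  forall (a h : 'cV[R]_n) (e : R), 0 < e -> exists y : 'cV[R]_n, (forall i,
    `|y i 0 - a i 0| < e) /\
    {ae lam, forall s, forall k, ~ N k (y + s *: h)}.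
Proof.
move=> bN N0 a h e e0.
have H : {ae mu, forall t, forall k, lam [set s | N k (pt t + s *: h)] = 0%E}.
  apply: ae_foralln => k; apply/null_linesP => //;
    apply/(null_linesP (v k)) => //.
  exact: nearW.
have [t [ht ha]] : exists t, (forall k, lam [set s | N k (pt t + s *: h)] =
  0%E) /\
    (forall i, `|pt t i 0 - a i 0| < e).
  apply: contrapT => hn.
  have := @ls_box_gt0 R n ls (\col_i (a i 0 - e)) (\col_i (a i 0 + e)).
  rewrite -/mu -/pt => hb.
  have {}hb : (0%R < mu [set t | (forall i, (a i 0 - e < pt t i 0 < a i 0 +
    e)%R)])%E.
    have hlo i : (\col_i (a i 0 - e) : 'cV[R]_n) i 0 < (\col_i (a i 0 + e) :
      'cV[R]_n) i 0.
      by rewrite !mxE; lra.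
    apply: lt_le_trans (hb hlo) _.
    rewrite (_ : [set t | _] = [set t | (forall i,
      (a i 0 - e < pt t i 0 < a i 0 + e)%R)])//.
    by apply/seteqP; split => t /= hh i; have := hh i; rewrite !mxE.
  have mB : measurable [set t | (forall i, (a i 0 - e < pt t i 0 < a i 0 +
    e)%R)].
    rewrite (_ : [set t | _] = \bigcap_(i in [set: 'I_n]) ((fun t =>
      pt t i 0) @^-1` `]a i 0 - e, a i 0 + e[%classic)).
      apply: fin_bigcap_measurable => //.
      move=> i _; rewrite -[X in measurable X]setTI;
        apply: ls_pt_measurable => //; exact: measurable_itv.
    by apply/seteqP; split => [t hh i _|t hh i]; have := hh i;
      rewrite /= in_itv/= => h'; exact: h'.
  move: H => [Z [mZ Z0 ZH]].
  suff : (mu [set t | forall i, (a i 0 - e < pt t i 0 < a i 0 + e)%R] <= mu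
    Z)%E.
    by rewrite Z0 leNgt hb.
  apply: le_measure; rewrite ?inE//.
  move=> t /= ht; apply: ZH => /= hk; apply: hn; exists t; split => // i.
  by have := ht i; rewrite ltr_distl.
exists (pt t); split => //.
apply: ae_foralln => k.
exists [set s | N k (pt t + s *: h)]; split => //;
  last by move=> s /= /contrapT.
pose f (s : measurableTypeR R) := ls_shift (s *: h) t.
have mf : measurable_fun setT f.
  exact: (measurable_fun_pair1 t (@ls_shift_measurable R n ls h)).
rewrite (_ : [set s | _] = f @^-1` (pt @^-1` N k)).
  rewrite -[X in measurable X]setTI; apply: mf => //;
    exact: measurable_preimage_pt.
by apply/seteqP; split => s; rewrite /= /f /pt ls_ptD.
exact: ht.
Qed.

End lines.

(** * Differentiability of Lipschitz maps *)

Lemma mx_norm_leP (R : realType) (m n : nat) (A : 'M[R]_(m,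
  n)) (e : R) : 0 <= e ->
  `|A| <= e <-> forall i j, `|A i j| <= e.
Proof.
move=> e0; rewrite (_ : `|A| = mx_norm A)// mx_normrE; split=> [h i j|h].
  by apply: le_trans h; apply: (le_bigmax_cond _ (fun ij =>
    `|A ij.1 ij.2|) (j := (i, j))).
by apply/bigmax_leP; split => // -[i j] _ /=.
Qed.

Lemma mx_norm_coord (R : realType) (m n : nat) (A : 'M[R]_(m,
  n)) i j : `|A i j| <= `|A|.
Proof. exact: (mx_norm_leP A (normr_ge0 A)).1. Qed.

Lemma cV_norm_leP (R : realType) (n : nat) (x : 'cV[R]_n) (e : R) : 0 <= e ->
  `|x| <= e <-> forall i, `|x i 0| <= e.
Proof.
move=> e0; rewrite mx_norm_leP//; split => [h i|h i j];
  [exact: h|rewrite ord1; exact: h].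
Qed.

Lemma fin_lower_bound_gt0 (R : realType) (T : finType) (r : T ->
  R) : (forall i, 0 < r i) ->
  exists2 d, 0 < d & forall i, d <= r i.
Proof.
move=> r0; exists (\big[Num.min/1]_i r i); first by apply: lt_bigmin.
by move=> i; apply: bigmin_le_cond.
Qed.

Definition fdiff (R : realType) (n m : nat) (G : 'cV[R]_n ->
  'cV[R]_m) (y : 'cV[R]_n) (J : 'M[R]_(m, n)) :=
  forall e, 0 < e -> exists2 r, 0 < r &
    forall h, `|h| < r -> `|G (y + h) - G y - J *m h| <= e * `|h|.

Lemma borel_sigma (R : realType) (n : nat) : sigma_algebra setT (@borel R n).
Proof. exact: smallest_sigma_algebra. Qed.

Lemma borelC (R : realType) (n : nat) (A : set 'cV[R]_n) : borel A ->
  borel (~` A).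
Proof. by have [_ bC _] := @borel_sigma R n; move=> /bC; rewrite setTD. Qed.

Lemma borel_bigcup (R : realType) (n : nat) (A : nat ->
  set 'cV[R]_n) : (forall k, borel (A k)) -> borel (\bigcup_k A k).
Proof. by have [_ _ bU] := @borel_sigma R n; exact: bU. Qed.

Lemma borel_closed (R : realType) (n : nat) (A : set 'cV[R]_n) : closed A ->
  borel A.
Proof.
move=> cA; have : borel (~` A) by apply: sub_gen_smallest; exact: closed_openC.
by move=> /borelC; rewrite setCK.
Qed.

Lemma borel_bigcap (R : realType) (n : nat) (A : nat ->
  set 'cV[R]_n) : (forall k, borel (A k)) -> borel (\bigcap_k A k).
Proof.
move=> bA; rewrite -[X in borel X]setCK setC_bigcap; apply: borelC;
  apply: borel_bigcup => k; exact: borelC.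
Qed.

Lemma ex_inv_nat (R : realType) (e : R) : 0 < e ->
  exists k : nat, k.+1%:R^-1 < e.
Proof.
move=> e0; exists (Num.trunc e^-1).
by rewrite -[ltRHS]invrK ltf_pV2 ?posrE ?invr_gt0// truncnS_gt.
Qed.

Lemma inv_nat_gt0 (R : realType) (k : nat) : 0 < k.+1%:R^-1 :> R.
Proof. by rewrite invr_gt0. Qed.

Lemma cV_lip_continuous (R : realType) (n : nat) (g : 'cV[R]_n -> R) (K : R) :
  (forall x y, `|g x - g y| <= K * `|x - y|) -> continuous g.
Proof.
move=> glip x; apply/(@cvgrPdist_le _ R^o _ (nbhs x)) => /= e e0.
have K1 : 0 < `|K| + 1 by rewrite ltr_wpDl.
near=> t; apply: le_trans (glip _ _) _.
apply: (@le_trans _ _ ((`|K| + 1) * `|x - t|)).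
  by rewrite ler_wpM2r// ler_wpDr// ler_norm.
rewrite mulrC -ler_pdivlMr//.
near: t; apply: (@cvgr_dist_le _ _ _ _ _ id x) => //; exact: divr_gt0.
Unshelve. all: by end_near. Qed.

Lemma lip_closed_le (R : realType) (n : nat) (g : 'cV[R]_n -> R) (K c : R) :
  (forall x y, `|g x - g y| <= K * `|x - y|) -> closed [set y | g y <= c].
Proof.
move=> /cV_lip_continuous gc.
apply: (@closed_comp _ _ g [set z | z <= c]); last exact: closed_le.
by move=> y _; exact: gc.
Qed.

(** * Differentiability of a scalar Lipschitz function outside the exceptional sets *)

Section scalar.
Context (R : realType) (n : nat) (g : 'cV[R]_n -> R) (K : R).
Hypothesis glip : forall x y, `|g x - g y| <= K * `|x - y|.

Lemma line_lipschitz x v s t : `|g (x + s *: v) - g (x + t *: v)| <= (K * `|v|)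
  * `|s - t|.
Proof.
apply: le_trans (glip _ _) _.
rewrite (_ : _ - _ = (s - t) *: v); last by apply/colP => i; rewrite !mxE; ring.
by rewrite normrZ -mulrA [`|v| * _]mulrC.
Qed.

(** The Cauchy condition on the difference quotients at [s] and [t], multiplied by [s * t]. In this
    form it makes sense at zero, and it is closed in [y]; the scales [j] and [k] are discrete to
    keep [no_slope_set] Borel. *)
Definition cauchy_slope_set v (j k : nat) : set 'cV[R]_n :=
  [set y | forall s t, `|s| < k.+1%:R^-1 -> `|t| < k.+1%:R^-1 ->
   `|t * (g (y + s *: v) - g y) - s * (g (y + t *: v) - g y)| <= j.+1%:R^-1 *
     `|s| * `|t|].

(* Points at which the difference quotients along [v] are not Cauchy. *)
Definition no_slope_set v : set 'cV[R]_n := \bigcup_j \bigcap_k ~`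
  cauchy_slope_set v j k.

Lemma increment_lipschitz (u x y : 'cV[R]_n) : `|(g (x + u) - g x) - (g (y + u)
  - g y)| <= 2 * K * `|x - y|.
Proof.
rewrite (_ : _ - _ = (g (x + u) - g (y + u)) - (g x - g y)); last by ring.
apply: le_trans (ler_normB _ _) _.
have := glip (x + u) (y + u); have := glip x y.
rewrite (_ : x + u - (y + u) = x - y); last by rewrite opprD addrACA subrr
  addr0.
lra.
Qed.

Lemma cauchy_slope_set_closed v j k : closed (cauchy_slope_set v j k).
Proof.
rewrite (_ : cauchy_slope_set v j k = \bigcap_(st in [set st :
  R * R | `|st.1| < k.+1%:R^-1 /\ `|st.2| < k.+1%:R^-1 ])
   [set y | `|st.2 * (g (y + st.1 *: v) - g y) - st.1 * (g (y + st.2 *: v) - g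
     y)| <= j.+1%:R^-1 * `|st.1| * `|st.2|]); last first.
  by apply/seteqP; split => [y h [s t] /= [hs ht]|y h s t hs ht];
    [exact: h|exact: (h (s, t))].
apply: closed_bigI => -[s t] _ /=.
apply: (@lip_closed_le _ _ _ ((`|t| + `|s|) * (2 * K))) => x y.
apply: le_trans (ler_dist_dist _ _) _.
rewrite (_ : _ - _ = t * ((g (x + s *: v) - g x) - (g (y + s *: v) - g y)) -
  s * ((g (x + t *: v) - g x) - (g (y + t *: v) - g y))); last by ring.
apply: le_trans (ler_normB _ _) _; rewrite !normrM -mulrA mulrDl.
by apply: lerD; apply: ler_wpM2l => //; exact: increment_lipschitz.
Qed.

Lemma no_slope_set_borel v : borel (no_slope_set v).
Proof.
apply: borel_bigcup => j; apply: borel_bigcap => k; apply: borelC;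
  apply: borel_closed; exact: cauchy_slope_set_closed.
Qed.

Definition dirslope (y v : 'cV[R]_n) (d : R) := forall e, 0 < e ->
  exists2 r, 0 < r &
    forall t, `|t| < r -> `|g (y + t *: v) - g y - t * d| <= e * `|t|.

Lemma slope_line x v s d : slope_at (fun s => g (x + s *: v)) s d ->
  dirslope (x + s *: v) v d.
Proof.
move=> h e e0; have [r r0 hr] := h e e0; exists r => // t tr.
by have := hr t tr; rewrite scalerDl addrA.
Qed.

Lemma dirslope_slope y v d : dirslope y v d -> slope_at (fun s =>
  g (y + s *: v)) 0 d.
Proof.
move=> h e e0; have [r r0 hr] := h e e0; exists r => // t tr.
by have := hr t tr; rewrite add0r scale0r addr0.
Qed.

Lemma dirslope_unique y v d d' : dirslope y v d -> dirslope y v d' -> d = d'.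
Proof. by move=> /dirslope_slope h /dirslope_slope h';
  exact: slope_unique h h'. Qed.

Lemma dirslopeZ y v d q : dirslope y v d -> dirslope y (q *: v) (q * d).
Proof.
move=> h e e0; have q0 : 0 < `|q| + 1 by rewrite ltr_wpDl.
have [r r0 hr] := h (e / (`|q| + 1)) (divr_gt0 e0 q0).
exists (r / (`|q| + 1)) => [|t]; first exact: divr_gt0.
rewrite ltr_pdivlMr// => tr.
have tq : `|t * q| <= `|t| * (`|q| + 1) by rewrite normrM ler_wpM2l// lerDl.
have := hr (t * q) (le_lt_trans tq tr).
rewrite scalerA mulrA => /le_trans; apply.
rewrite -mulrA ler_pM2l// mulrC ler_pdivrMr//.
Qed.

Lemma dirslope_slope_set y v d : dirslope y v d -> ~ no_slope_set v y.
Proof.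
move=> h [j _ hj].
have e2 : 0 < j.+1%:R^-1 / 2 :> R by rewrite divr_gt0.
have [r r0 hr] := h _ e2.
have [k kr] := ex_inv_nat r0.
apply: (hj k Logic.I) => s t sk tk.
have hs := hr s (lt_trans sk kr); have ht := hr t (lt_trans tk kr).
rewrite (_ : _ - _ = t * (g (y + s *: v) - g y - s * d) - s * (g (y + t *: v) -
  g y - t * d)); last by ring.
apply: le_trans (ler_normB _ _) _; rewrite !normrM.
apply: (@le_trans _ _ (`|t| * (j.+1%:R^-1 / 2 * `|s|) + `|s| * (j.+1%:R^-1 / 2
  * `|t|))).
  by apply: lerD; apply: ler_wpM2l.
move: (j.+1%:R^-1) (`|s|) (`|t|) => a b c. lra.
Qed.

Lemma slope_set_dirslope y v : ~ no_slope_set v y -> exists d, dirslope y v d.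
Proof.
move=> nB.
have H e : 0 < e -> exists2 r, 0 < r & forall s t, `|s| < r -> `|t| < r ->
    `|t * (g (y + s *: v) - g y) - s * (g (y + t *: v) - g y)| <= e * `|s| *
      `|t|.
  move=> e0; have [j je] := ex_inv_nat e0.
  have [k hk] : exists k, cauchy_slope_set v j k y.
    apply: contrapT => hn; apply: nB; exists j => // k _ /= hk; apply: hn;
      by exists k.
  exists k.+1%:R^-1; first exact: inv_nat_gt0.
  move=> s t sk tk; apply: le_trans (hk s t sk tk) _.
  by rewrite -!mulrA ler_wpM2r ?mulr_ge0// ltW.
pose q t := t^-1 * (g (y + t *: v) - g y).
have Hq e : 0 < e -> exists2 r, 0 < r & forall s t, 0 < `|s| < r ->
  0 < `|t| < r -> `|q s - q t| <= e.
  move=> e0; have [r r0 hr] := H e e0; exists r =>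
    // s t /andP[s0 sr] /andP[t0 tr].
  have := hr s t sr tr; move: s0 t0; rewrite !normr_gt0 => s0 t0.
  rewrite /q (_ : _ * _ - _ * _ = (s * t) * (s^-1 * (g (y + s *: v) - g y) -
    t^-1 * (g (y + t *: v) - g y))); last by field; rewrite ?s0 ?t0.
  by rewrite [leLHS]normrM -[leRHS]mulrA -[X in _ <= e * X]normrM [e * _]mulrC
    ler_pM2l// normr_gt0 mulf_neq0.
(* A limit from the right suffices: [Hq] compares quotients at arguments of either sign. *)
have : cvg (q t @[t --> 0^'+]).
  apply/cauchy_cvgP/cauchy_exP => e e0.
  have [r r0 hr] := Hq _ (divr_gt0 e0 (ltr0Sn _ 1)).
  exists (q (r / 2)); change (\forall t \near 0^'+, ball (q (r / 2)) e (q t));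
    near=> t => /=.
  rewrite /ball/= (@le_lt_trans _ _ (e / 2))//;
    last by rewrite ltr_pdivrMr// ltr_pMr// ltr1n.
  apply: hr; rewrite gtr0_norm ?divr_gt0//.
    by rewrite ltr_pdivrMr// ltr_pMr// ltr1n.
  by apply/andP; split; near: t; [exact: nbhs_right_gt|exact: nbhs_right_lt].
move=> /cvg_ex[d qd]; exists d => e e0.
have e2 := divr_gt0 e0 (ltr0Sn R 1).
have [r r0 hr] := Hq _ e2.
exists r => // s sr; have [->|s0] := eqVneq s 0.
  by rewrite scale0r addr0 subrr mul0r subr0 normr0 mulr0.
have [t [tr td]] : exists t, 0 < `|t| < r /\ `|d - q t| <= e / 2.
  move/cvgrPdist_le : qd => /(_ _ e2) qd.
  have := filter_ex (filterI qd (filterI (nbhs_right_gt (0:R))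
    (nbhs_right_lt r0))).
  move=> [t [h1 [h2 h3]]]; exists t; rewrite gtr0_norm//; split => //.
  by apply/andP.
have h1 : `|q s - q t| <= e / 2 by apply: hr tr; rewrite normr_gt0 s0.
have -> : g (y + s *: v) - g y - s * d = s * ((q s - q t) - (d - q t)).
  by rewrite /q; move: (t^-1 * _) => z; field.
rewrite normrM mulrC ler_wpM2r//.
apply: le_trans (ler_normB _ _) _; rewrite [leRHS]splitr; exact: lerD.
Unshelve. all: by end_near. Qed.

(* If [y] and [y + t *: u] both lie in this set, expanding [g (y + t *: (u + v))]
   through [y + t *: u] gives [`|p3 - p1 - p2| <= 3 * e]; hence, when
   [3 * e < `|p3 - p1 - p2|], it meets every line directed by [u] in an
   [r]-separated, hence null, set. *)
Definition nonadditive_set (u v : 'cV[R]_n) (p1 p2 p3 e r : R) :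
  set 'cV[R]_n := [set y | forall t, `|t| < r ->
  [/\ `|g (y + t *: u) - g y - t * p1| <= e * `|t|,
    `|g (y + t *: v) - g y - t * p2| <= e * `|t| &
      `|g (y + t *: (u + v)) - g y - t * p3| <= e * `|t|]].

Lemma nonadditive_set_closed u v p1 p2 p3 e r : closed (nonadditive_set u v p1
  p2 p3 e r).
Proof.
have H w p t : closed [set y | `|g (y + t *: w) - g y - t * p| <= e * `|t|].
  apply: (@lip_closed_le _ _ _ (2 * K)) => x y.
  apply: le_trans (ler_dist_dist _ _) _.
  rewrite (_ : _ - _ = (g (x + t *: w) - g x) - (g (y + t *: w) - g y));
    last by ring.
  exact: increment_lipschitz.
rewrite (_ : nonadditive_set _ _ _ _ _ _ _ = \bigcap_(t in [set t :
  R | `|t| < r])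
  ([set y | `|g (y + t *: u) - g y - t * p1| <= e * `|t|] `&` ([set y | `|g (y
    + t *: v) - g y - t * p2| <= e * `|t|] `&`
   [set y | `|g (y + t *: (u + v)) - g y - t * p3| <= e * `|t|]))).
  by apply: closed_bigI => t _; apply: closedI; [|apply: closedI]; exact: H.
apply/seteqP; split => [y h t tr|y h t tr]; first by have [h1 h2 h3] := h t tr.
by have [h1 [h2 h3]] := h t tr.
Qed.

Lemma nonadditive_set_separated u v p1 p2 p3 e r x s s' :
  3 * e < `|p3 - p1 - p2| ->
  nonadditive_set u v p1 p2 p3 e r (x + s *: u) ->
    nonadditive_set u v p1 p2 p3 e r (x + s' *: u) -> `|s' - s| < r -> s' = s.
Proof.
move=> hp h h' hr; apply/eqP; rewrite -subr_eq0; apply: contraTT hp => t0;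
  rewrite -leNgt.
have [h1 _ h3] := h _ hr; have [_ h2 _] := h' _ hr.
move: h1 h2 h3; set t := s' - s in t0 *.
have st : s + t = s' by rewrite /t; ring.
have -> : x + s *: u + t *: u = x + s' *: u by rewrite -addrA -scalerDl st.
have -> : x + s *: u + t *: (u + v) = x + s' *: u + t *: v.
  by rewrite scalerDr addrA -[x + _ + t *: u]addrA -scalerDl st.
move=> h1 h2 h3.
rewrite -(@ler_pM2l _ `|t|) ?normr_gt0// -normrM.
set a := g (x + s' *: u) - g (x + s *: u) - t * p1 in h1.
set b := _ - t * p2 in h2.
set c := _ - t * p3 in h3.
have -> : t * (p3 - p1 - p2) = a + b - c by rewrite /a /b /c; ring.
apply: le_trans (ler_normB _ _) _.
have := ler_normD a b.
have -> : `|t| * (3 * e) = 3 * (e * `|t|) by ring.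
lra.
Qed.

(** Each cell [[k r, (k + 1) r[] with [k] an integer contains at most one point of [A], so [A] is
    countable. *)
Lemma separated_null (A : set R) (r : R) : 0 < r ->
  (forall s s', A s -> A s' -> `|s' - s| < r -> s' = s) ->
    lebesgue_measure (A : set (measurableTypeR R)) = 0%E.
Proof.
move=> r0 hA; apply: countable_lebesgue_measure0.
apply/countable_injP.
pose f (s : R) : nat := pickle (Num.floor (s / r)).
exists f => s s' /set_mem As /set_mem As' /(pcan_inj pickleK) fs.
apply/esym; apply: hA => //.
have := floor_itv (s / r); have := floor_itv (s' / r).
rewrite -fs => /andP[h1 h2] /andP[h3 h4].
have : `|(s' / r) - (s / r)| < 1.
  rewrite intrD in h2 h4. rewrite ltr_norml; apply/andP; split; lra.
by rewrite -mulrBl normrM normfV [X in _ / X]gtr0_norm// ltr_pdivrMr// mul1r.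
Qed.

(* The points of non-differentiability are covered by countably many Borel sets,
   each null on all lines in some direction (Nekvinda-Zajicek). *)
Definition exceptional_index : countType := ('cV[rat]_n + (('cV[rat]_n *
  'cV[rat]_n) * (rat * rat * rat) * (nat * nat)))%type.
Definition ratr_col (u : 'cV[rat]_n) : 'cV[R]_n := map_mx ratr u.
Definition exceptional_dir (i : exceptional_index) :
  'cV[R]_n := match i with inl v => ratr_col v | inr p => ratr_col p.1.1.1 end.
Definition exceptional_set (i : exceptional_index) :
  set 'cV[R]_n := match i with inl v => no_slope_set (ratr_col v)
 | inr ((u, v), (p1, p2, p3), (j, k)) => if 3 * j.+1%:R^-1 < `|ratr p3 - ratr
   p1 - ratr p2| :> R then
    nonadditive_set (ratr_col u) (ratr_col v) (ratr p1) (ratr p2)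
      (ratr p3) j.+1%:R^-1 k.+1%:R^-1 else set0 end.

Lemma exceptional_borel i : borel (exceptional_set i).
Proof.
case: i => [v|[[[u v] [[p1 p2] p3]] [j k]]] /=; first exact: no_slope_set_borel.
by case: ifP => _; apply: borel_closed; [exact: nonadditive_set_closed|exact:
  closed0].
Qed.

Lemma exceptional_null i x : lebesgue_measure ([set s | exceptional_set i (x +
  s *: exceptional_dir i)] : set (measurableTypeR R)) = 0%E.
Proof.
case: i => [v|[[[u v] [[p1 p2] p3]] [j k]]] /=; last first.
  case: ifP => h; last by rewrite (_ : [set s | _] = set0) ?measure0//;
    apply/seteqP; split.
  apply: (@separated_null _ k.+1%:R^-1); first exact: inv_nat_gt0.
  by move=> s s'; exact: nonadditive_set_separated.
apply: (negligible_outer_measure _).1.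
have := lip_ae_slope (line_lipschitz x (ratr_col v)).
apply: negligibleS => s /= Bs hs.
have [d hd] := hs; exact: (dirslope_slope_set (slope_line hd)).
Qed.

Lemma dirslope_near y w d p e : 0 < e -> dirslope y w d -> `|p - d| < e / 2 ->
  exists2 r, 0 < r & forall t, `|t| < r -> `|g (y + t *: w) - g y - t * p| <= e
    * `|t|.
Proof.
move=> e0 h pd; have [r r0 hr] := h _ (divr_gt0 e0 (ltr0Sn R 1)).
exists r => // t tr; have := hr t tr.
rewrite (_ : g (y + t *: w) - g y - t * p = (g (y + t *: w) - g y - t * d) - t
  * (p - d)); last by ring.
move=> h1; apply: le_trans (ler_normB _ _) _; rewrite [e]splitr mulrDl lerD//
  normrM mulrC ler_wpM2r//; exact: ltW.
Qed.

Lemma rat_approx (d e : R) : 0 < e -> exists p : rat, `|ratr p - d| < e.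
Proof.
move=> e0; have : d - e < d + e by lra.
by move=> /rat_in_itvoo[p]; rewrite in_itv/= => h; exists p; rewrite ltr_distl.
Qed.

Section point.
Variable y : 'cV[R]_n.
Hypothesis nonexc : forall i, ~ exceptional_set i y.

Lemma nonexceptional_dirslope (v : 'cV[rat]_n) : exists d,
  dirslope y (ratr_col v) d.
Proof. by apply: slope_set_dirslope; exact: (@nonexc (inl v)). Qed.

(** If additivity failed, rational approximations of the three slopes and a small enough scale would
    place [y] in one of the countably many [nonadditive_set]. *)
Lemma nonexceptional_additive (u v : 'cV[rat]_n) d1 d2 d3 :
  dirslope y (ratr_col u) d1 -> dirslope y (ratr_col v) d2 ->
  dirslope y (ratr_col (u + v)) d3 -> d3 = d1 + d2.
Proof.
rewrite /ratr_col map_mxD => h1 h2 h3; apply/eqP;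
  rewrite -subr_eq0 opprD addrA -normr_eq0.
apply: contrapT => /negP hn.
have n0 : 0 < `|d3 - d1 - d2| by rewrite lt_neqAle eq_sym hn normr_ge0.
(* With [e] the inverse of [j + 1], the defect of the real slopes exceeds [6 * e]. Rational slopes
   within [e / 2] of them lose at most [3 * e / 2], so their defect still exceeds [3 * e]. *)
have [j hj] := ex_inv_nat (divr_gt0 n0 (ltr0Sn R 5)).
have j0 := inv_nat_gt0 R j.
have j2 := divr_gt0 j0 (ltr0Sn R 1).
have [p1 hp1] := rat_approx d1 j2; have [p2 hp2] := rat_approx d2 j2;
  have [p3 hp3] := rat_approx d3 j2.
have [r1 r10 hr1] := dirslope_near j0 h1 hp1.
have [r2 r20 hr2] := dirslope_near j0 h2 hp2.
have [r3 r30 hr3] := dirslope_near j0 h3 hp3.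
have rm : 0 < Num.min r1 (Num.min r2 r3) by rewrite !lt_min r10 r20.
have [k hk] := ex_inv_nat rm.
apply: (@nonexc (inr ((u, v), (p1, p2, p3), (j, k)))) => /=.
rewrite ifT.
  move=> t tk; have := lt_trans tk hk; rewrite !lt_min => /and3P[t1 t2 t3].
  by split; [exact: hr1|exact: hr2|exact: hr3].
move: hp1 hp2 hp3 hj j0 {hr1 hr2 hr3}; rewrite !ltr_norml.
move: (ratr p1) (ratr p2) (ratr p3) (j.+1%:R^-1) =>
  q1 q2 q3 e /andP[a1 b1] /andP[a2 b2] /andP[a3 b3] he e0.
rewrite ltr_pdivlMr// in he.
move: he; rewrite ltr_normr => /orP[he|he]; rewrite ltr_normr; apply/orP;
  [left|right]; lra.
Qed.

(** The slopes [D] are linear over the rationals. Uniformity in the direction comes from a finite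
    grid: [h] divided by its norm is close to a grid vector, finitely many slopes have a common
    radius, and the Lipschitz bound covers the gap. *)
Lemma nonexceptional_gradient : exists Jf : 'I_n -> R, forall e, 0 < e ->
  exists2 r, 0 < r &
   forall h : 'cV[R]_n, `|h| < r -> `|g (y + h) - g y - \sum_j Jf j * h j 0| <=
     e * `|h|.
Proof.
have [D hD] := choice nonexceptional_dirslope.
have Dadd u v : D (u + v) = D u + D v by apply: nonexceptional_additive (hD _).
have D0 : D 0 = 0 by have := Dadd 0 0; rewrite addr0; lra.
have DZ q u : D (q *: u) = ratr q * D u.
  apply: dirslope_unique (hD _) _; rewrite /ratr_col map_mxZ; exact: dirslopeZ.
exists (fun j => D (delta_mx j 0)).
have Dlin (u : 'cV[rat]_n) : D u = \sum_j D (delta_mx j 0) * ratr (u j 0).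
  rewrite {1}[u]matrix_sum_delta (big_morph D Dadd D0); apply: eq_bigr => i _.
  by rewrite big_ord1 DZ mulrC.
move=> e e0.
set J := fun j => D (delta_mx j 0).
pose S := \sum_j `|J j|.
have S0 : 0 <= S by apply: sumr_ge0.
(* Rounding the direction costs [|K|] times the mesh in [g] and [S] times the mesh in the linear
   part. A mesh below [e / (2 * K1)] leaves [e / 2] for the slopes themselves. *)
pose K1 := `|K| + S + 1.
have K10 : 0 < K1 by rewrite ltr_wpDl// addr_ge0.
have [M hM] := ex_inv_nat (divr_gt0 e0 (mulr_gt0 (ltr0Sn R 1) K10)).
set m := M.+1%:R^-1 in hM.
have m0 : 0 < m by exact: inv_nat_gt0.
(* [T] indexes the grid of mesh [m] in the cube with coordinates in [[-1, 1]]: each coordinate takes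
   [2 * (M + 1) + 1] values. *)
pose T : finType := {ffun 'I_n -> 'I_(M.+1 + M.+1).+1}.
pose w (f : T) : 'cV[rat]_n := \col_j (((f j)%:R - M.+1%:R) / M.+1%:R).
have e2 := divr_gt0 e0 (ltr0Sn R 1).
have /choice[r hr] : forall f : T, exists r, 0 < r /\ forall t, `|t| < r ->
  `|g (y + t *: ratr_col (w f)) - g y - t * D (w f)| <= e / 2 * `|t|.
  by move=> f; have [r r0 hr] := hD (w f) _ e2; exists r.
have [d d0 hd] := fin_lower_bound_gt0 (fun f => (hr f).1).
exists d => // h hd'.
have [->|h0] := eqVneq h 0.
  rewrite addr0 subrr big1 ?subrr ?normr0 ?mulr0// => i _; by rewrite mxE mulr0.
have t0 : 0 < `|h| by rewrite normr_gt0.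
set t := `|h| in hd' t0 *.
have [f hf] : exists f : T, forall j, `|h j 0 / t - ratr (w f j 0)| <= m.
  have hj j : exists k : 'I_(M.+1 + M.+1).+1, `|h j 0 / t - (k%:R - M.+1%:R) /
    M.+1%:R| <= m.
    have : `|h j 0 / t| <= 1.
      by rewrite normrM normfV [X in _ / X]gtr0_norm// ler_pdivrMr// mul1r
        mx_norm_coord.
    set z := h j 0 / t; rewrite ler_norml => /andP[z1 z2].
    pose k := Num.trunc ((z + 1) * M.+1%:R).
    have zz : 0 <= (z + 1) * M.+1%:R by rewrite mulr_ge0//; lra.
    have /andP[k1 k2] := truncn_itv zz.
    rewrite -/k in k1 k2.
    have kM : (k < (M.+1 + M.+1).+1)%N.
      rewrite ltnS -(ler_nat R) (le_trans k1)// natrD.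
      by rewrite (_ : M.+1%:R + M.+1%:R = 2 * M.+1%:R :> R) ?ler_wpM2r//;
        [lra|ring].
    exists (Ordinal kM) => /=.
    have M0 : (0 : R) < M.+1%:R by [].
    rewrite (_ : z - _ = ((z + 1) * M.+1%:R - k%:R) / M.+1%:R); last by field;
      rewrite gt_eqF.
    rewrite normrM normfV [X in _ / X]gtr0_norm// ler_pdivrMr// mulVf ?gt_eqF//.
    rewrite ger0_norm ?subr_ge0// lerBlDr ltW//.
    by rewrite [ltRHS]addrC natr1.
  have [F hF] := choice hj.
  exists [ffun j => F j] => j.
  by rewrite mxE ffunE fmorph_div/= rmorphB/= !ratr_nat; exact: hF.
have [_ hrf] := hr f.
have tn : `|t| = t by rewrite gtr0_norm.
have h1 := hrf t; rewrite tn in h1; have {}h1 := h1 (lt_le_trans hd' (hd f)).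
have h2 : `|g (y + h) - g (y + t *: ratr_col (w f))| <= `|K| * (t * m).
  apply: le_trans (glip _ _) _.
  apply: (@le_trans _ _ (`|K| * `|y + h - (y + t *: ratr_col (w f))|)).
    by rewrite ler_wpM2r// ler_norm.
  rewrite ler_wpM2l//; apply/cV_norm_leP; first by rewrite mulr_ge0// ltW.
  move=> i; have := hf i; move: (w f) => u hu; rewrite !mxE.
  rewrite (_ : _ - _ = t * (h i 0 / t - ratr (u i 0))); last by field;
    rewrite gt_eqF.
  by rewrite normrM tn ler_wpM2l// ltW.
have h3 : `|t * D (w f) - \sum_j J j * h j 0| <= S * (t * m).
  rewrite Dlin mulr_sumr -sumrB; apply: le_trans (ler_norm_sum _ _ _) _.
  rewrite mulr_suml; apply: ler_sum => j _.
  rewrite (_ : _ - _ = J j * (t * (ratr (w f j 0) - h j 0 / t))); last first.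
    by rewrite /J; field; rewrite gt_eqF.
  rewrite normrM; apply: ler_wpM2l => //; rewrite normrM tn; apply: ler_wpM2l;
    first exact: ltW.
  by rewrite distrC.
rewrite (_ : _ - _ = (g (y + h) - g (y + t *: ratr_col (w f))) + (g (y + t *:
  ratr_col (w f)) - g y - t * D (w f)) + (t * D (w f) - \sum_j J j * h j 0));
  last by ring.
apply: le_trans (ler_normD _ _) _.
apply: le_trans (lerD (ler_normD _ _) (lexx _)) _.
apply: le_trans (lerD (lerD h2 h1) h3) _.
have : t * m * K1 <= e / 2 * t.
  rewrite -mulrA mulrC ler_wpM2r ?ltW//.
  by move: hM; rewrite ltr_pdivlMr ?mulr_gt0// => hM; lra.
rewrite /K1 => hh; have : 0 <= t * m by rewrite mulr_ge0 ?ltW. lra.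
Qed.

End point.

End scalar.

(** * Differentiability along lines and mean values for globally Lipschitz maps *)

Section vector_valued.
Context (R : realType) (n m : nat) (G : 'cV[R]_n -> 'cV[R]_m) (K : R).
Hypothesis Glip : forall x y, `|G x - G y| <= K * `|x - y|.

Lemma coord_lipschitz i x y : `|G x i 0 - G y i 0| <= K * `|x - y|.
Proof. by apply: le_trans (Glip x y); have := mx_norm_coord (G x - G y) i 0;
  rewrite !mxE. Qed.

Lemma fdiff_coord y (Jf : 'I_m -> 'I_n -> R) :
  (forall i e, 0 < e -> exists2 r, 0 < r &
   forall h : 'cV[R]_n, `|h| < r -> `|G (y + h) i 0 - G y i 0 - \sum_j Jf i j *
     h j 0| <= e * `|h|) ->
  fdiff G y (\matrix_(i, j) Jf i j).
Proof.
move=> H e e0.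
have /choice[r hr] : forall i : 'I_m, exists r, 0 < r /\ forall h : 'cV[R]_n,
  `|h| < r ->
    `|G (y + h) i 0 - G y i 0 - \sum_j Jf i j * h j 0| <= e * `|h|.
  by move=> i; have [r r0 hr] := H i e e0; exists r.
have [d d0 hd] := fin_lower_bound_gt0 (fun i => (hr i).1).
exists d => // h hh; apply/cV_norm_leP; first by rewrite mulr_ge0// ltW.
move=> i; rewrite !mxE; under eq_bigr do rewrite mxE.
exact: (hr i).2 _ (lt_le_trans hh (hd i)).
Qed.

Lemma lip_fdiff_lines (a h : 'cV[R]_n) e : 0 < e ->
  exists y : 'cV[R]_n, (forall i, `|y i 0 - a i 0| < e) /\
  {ae (@lebesgue_measure R), forall s, exists J, fdiff G (y + s *: h) J}.
Proof.
move=> e0.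
have [ls] := lebspace_exists R n.
pose I : countType := ('I_m * exceptional_index n)%type.
pose g i x := G x i 0.
(* The exceptional sets of all coordinates in a single sequence; numbers that encode no index get
   the empty set. *)
pose N k : set 'cV[R]_n := if (unpickle k : option I) is Some p then
  exceptional_set (g p.1) p.2 else set0.
pose v k : 'cV[R]_n := if (unpickle k : option I) is Some p then
  exceptional_dir R p.2 else 0.
have bN k : borel (N k).
  rewrite /N; case: unpickle => [p|]; last by apply: borel_closed;
    exact: closed0.
  exact: (exceptional_borel (coord_lipschitz p.1)).
have N0 k x : lebesgue_measure ([set s | N k (x + s *: v k)] :
  set (measurableTypeR R)) = 0%E.
  rewrite /N /v; case: unpickle => [p|]; first exact: (exceptional_null
    (coord_lipschitz p.1)).
  by rewrite (_ : [set s | _] = set0) ?measure0//; apply/seteqP; split.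
have [y [ya hy]] := null_lines_choose ls bN N0 a h e0.
exists y; split => //.
apply: filterS hy; first exact: (ae_filter_ringOfSetsType (@lebesgue_measure
  R)).
move=> s hs.
have H i : exists Jf : 'I_n -> R, forall e, 0 < e -> exists2 r, 0 < r &
   forall k : 'cV[R]_n, `|k| < r -> `|g i (y + s *: h + k) - g i (y + s *: h) -
     \sum_j Jf j * k j 0| <= e * `|k|.
  apply: (nonexceptional_gradient (coord_lipschitz i)) => x;
    have := hs (pickle ((i, x) : I)).
  by rewrite /N pickleK.
have [Jf hJ] := choice H.
exists (\matrix_(i, j) Jf i j); exact: fdiff_coord.
Qed.

Lemma fdiff_slope y h s J i : fdiff G (y + s *: h) J ->
  slope_at (fun s => G (y + s *: h) i 0) s ((J *m h) i 0).
Proof.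
move=> hJ e e0; have h0 : 0 < `|h| + 1 by rewrite ltr_wpDl.
have [r r0 hr] := hJ _ (divr_gt0 e0 h0).
exists (r / (`|h| + 1)) => [|t]; first exact: divr_gt0.
rewrite ltr_pdivlMr// => tr.
have th : `|t *: h| <= `|t| * (`|h| + 1) by rewrite normrZ ler_wpM2l// lerDl.
have := hr (t *: h) (le_lt_trans th tr).
rewrite (_ : y + s *: h + t *: h = y + (s + t) *: h) => [H|];
  last by rewrite scalerDl addrA.
have := mx_norm_coord (G (y + (s + t) *: h) - G (y + s *: h) - J *m (t *: h)) i
  0.
rewrite -scalemxAr; rewrite -scalemxAr in H.
rewrite [X in `|X|](_ : _ = G (y + (s + t) *: h) i 0 - G (y + s *: h) i 0 - t *
  (J *m h) i 0); last first.
  by move: (J *m h) => w; rewrite !mxE.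
move=> /le_trans; apply; apply: le_trans H _.
by rewrite -mulrA ler_pM2l// mulrC ler_pdivrMr.
Qed.

(* Almost every line parallel to [h] close to [a] meets the points of
   non-differentiability in a null set only. *)
Lemma lip_mean_value (a h : 'cV[R]_n) i c rho : 0 < rho ->
  (forall y s J, 0 < s < 1 -> `|y - a| < rho -> fdiff G (y + s *: h) J ->
    (J *m h) i 0 <= c) ->
  G (a + h) i 0 - G a i 0 <= c.
Proof.
move=> r0 H; apply/ler_addgt0Pr => e e0.
have K1 : 0 < 2 * (`|K| + 1) by rewrite mulr_gt0// ltr_wpDl.
have d0 : 0 < Num.min (rho / 2) (e / (2 * (`|K| + 1)))
  by rewrite lt_min !divr_gt0.
have [y [ya hy]] := lip_fdiff_lines a h d0.
have yd : `|y - a| <= Num.min (rho / 2) (e / (2 * (`|K| + 1))).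
  by apply/cV_norm_leP; [exact: ltW|move=> j; rewrite !mxE ltW].
move: yd; rewrite le_min => /andP[y1 y2].
have y3 : `|y - a| < rho by apply: le_lt_trans y1 _;
  rewrite ltr_pdivrMr// ltr_pMr// ltr1n.
have L : G (y + 1 *: h) i 0 - G (y + 0 *: h) i 0 <= c * (1 - 0).
  apply: (lip_slope_le (line_lipschitz (coord_lipschitz i) y h) ler01).
  apply: filterS hy; first exact: (ae_filter_ringOfSetsType (@lebesgue_measure
    R)).
  move=> s [J hJ] hs; exists ((J *m h) i 0); split; first exact: H hJ.
  exact: fdiff_slope.
move: L; rewrite scale1r scale0r addr0 subr0 mulr1.
have := coord_lipschitz i (a + h) (y + h); have := coord_lipschitz i a y.
rewrite (_ : a + h - (y + h) = a - y); last by rewrite opprD addrACA subrr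
  addr0.
rewrite distrC => h1 h2 h3.
have h4 : K * `|a - y| <= e / 2.
  rewrite distrC; apply: (@le_trans _ _ ((`|K| + 1) * `|y - a|)).
    by rewrite ler_wpM2r// ler_wpDr// ler_norm.
  by move: y2; rewrite ler_pdivlMr// => y2; lra.
move: h1 h2; rewrite !ler_norml => /andP[_ h1] /andP[_ h2]. lra.
Qed.

End vector_valued.

(** * Mean value inequality for locally Lipschitz maps *)

Lemma fdiff_near (R : realType) (n m : nat) (G G' : 'cV[R]_n ->
  'cV[R]_m) p J r : 0 < r ->
  (forall y, `|y - p| < r -> G y = G' y) -> fdiff G p J -> fdiff G' p J.
Proof.
move=> r0 eG h e e0; have [d d0 hd] := h e e0.
exists (Num.min d r) => [|k]; first by rewrite lt_min d0.
rewrite lt_min => /andP[kd kr]; rewrite -!eG ?subrr ?normr0//; first exact: hd.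
by rewrite addrC addKr.
Qed.

(** Coordinatewise retraction onto the closed max-norm ball around [z]. Composing with it turns a
    map Lipschitz near [z] into a globally Lipschitz one. *)
Definition clamp (R : realType) (n : nat) (z : 'cV[R]_n) (r : R) (x :
  'cV[R]_n) : 'cV[R]_n :=
  \col_i Num.max (z i 0 - r) (Num.min (z i 0 + r) (x i 0)).

Lemma clamp_id (R : realType) (n : nat) (z x : 'cV[R]_n) r :
  `|x - z| <= r -> clamp z r x = x.
Proof.
move=> h; have r0 : 0 <= r by apply: le_trans h.
move/(cV_norm_leP _ r0) : h => h; apply/colP => i; rewrite mxE.
have := h i; rewrite !mxE ler_norml => /andP[h1 h2].
rewrite min_r; last by lra. by rewrite max_r//; lra.
Qed.

Lemma clamp_in (R : realType) (n : nat) (z x : 'cV[R]_n) r : 0 <= r ->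
  `|clamp z r x - z| <= r.
Proof.
move=> r0; apply/cV_norm_leP => // i; rewrite !mxE ler_norml.
case: (leP (z i 0 + r) (x i 0)) => h1; case: (leP (z i 0 - r)) => h2;
  apply/andP; split; lra.
Qed.

Lemma max_min_lipschitz (R : realType) (a b s t : R) :
  `|Num.max a (Num.min b s) - Num.max a (Num.min b t)| <= `|s - t|.
Proof.
wlog st : s t / s <= t => [H|].
  by case: (leP s t) => [|/ltW]; [exact: H|rewrite distrC (distrC s); exact: H].
rewrite [leRHS]ler0_norm ?subr_le0// ler_norml.
rewrite !minEle !maxEle.
case: (lerP b s) => h1; case: (lerP b t) => h2;
repeat (case: ifPn; rewrite -?ltNge => ?); apply/andP; split; lra.
Qed.

Lemma clamp_lipschitz (R : realType) (n : nat) (z x y : 'cV[R]_n) r :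
  `|clamp z r x - clamp z r y| <= `|x - y|.
Proof.
apply/cV_norm_leP => // i; rewrite !mxE.
have := mx_norm_coord (x - y) i 0; rewrite !mxE; apply: le_trans.
exact: max_min_lipschitz.
Qed.

(** [lip_mean_value] applied to [G] after clamping to radius [r / 2]. The moved segments stay
    strictly inside that ball, so the clamped map has the same derivatives on them as [G]. *)
Lemma mean_value (R : realType) (n m : nat) (G : 'cV[R]_n ->
  'cV[R]_m) (K r : R) (z a h : 'cV[R]_n) i c rho :
  (forall x y, `|x - z| < r -> `|y - z| < r -> `|G x - G y| <= K * `|x - y|) ->
  0 < rho ->
  (forall y s, 0 <= s <= 1 -> `|y - a| < rho -> `|y + s *: h - z| < r / 2) ->
  (forall y s J, 0 < s < 1 -> `|y - a| < rho -> fdiff G (y + s *: h) J ->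
    (J *m h) i 0 <= c) ->
  G (a + h) i 0 - G a i 0 <= c.
Proof.
move=> Glip rho0 hin H.
have aa : `|a - a| < rho by rewrite subrr normr0.
have r0 : 0 < r / 2 by apply: le_lt_trans (hin a 0 _ aa); rewrite ?lexx ?ler01.
have rr : r / 2 < r by move: r0; lra.
pose G' := G \o clamp z (r / 2).
have G'lip x y : `|G' x - G' y| <= `|K| * `|x - y|.
  have ci w : `|clamp z (r / 2) w - z| < r by apply: le_lt_trans rr;
    apply: clamp_in; exact: ltW.
  apply: le_trans (Glip _ _ (ci x) (ci y)) _.
  apply: (@le_trans _ _ (`|K| * `|clamp z (r / 2) x - clamp z (r / 2) y|)).
    by rewrite ler_wpM2r// ler_norm.
  by rewrite ler_wpM2l// clamp_lipschitz.
have GE x : `|x - z| < r / 2 -> G' x = G x by move=> hx;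
  rewrite /G'/= clamp_id// ltW.
have := @lip_mean_value R n m G' `|K| G'lip a h i c rho rho0.
rewrite !GE; last 2 first.
- by have := hin a 0; rewrite scale0r addr0; apply=> //; rewrite lexx ler01.
- by have := hin a 1; rewrite scale1r; apply=> //; rewrite lexx ler01.
apply=> y s J s01 ya hJ; apply: (H y s J) => //.
have hy : `|y + s *: h - z| < r / 2 by apply: hin => //;
  case/andP: s01 => /ltW-> /ltW->.
have d0 : 0 < r / 2 - `|y + s *: h - z| by rewrite subr_gt0.
apply: (fdiff_near d0 _ hJ).
move=> w hw; apply: GE.
rewrite (_ : w - z = (w - (y + s *: h)) + (y + s *: h - z));
  last by rewrite addrA subrK.
by apply: le_lt_trans (ler_normD _ _) _; move: hw; rewrite ltrBrDr.
Qed.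

(** * Semismooth maps *)

Lemma mulmx_norm_le (R : realType) (m n p : nat) (A : 'M[R]_(m,
  n)) (B : 'M[R]_(n, p)) :
  `|A *m B| <= n%:R * `|A| * `|B|.
Proof.
apply/mx_norm_leP => [|i j]; first by rewrite !mulr_ge0.
rewrite mxE; apply: le_trans (ler_norm_sum _ _ _) _.
apply: (@le_trans _ _ (\sum_(k < n) `|A| * `|B|)); last first.
  by rewrite sumr_const card_ord -mulrA mulr_natl.
by apply: ler_sum => k _; rewrite normrM ler_pM// mx_norm_coord.
Qed.

Lemma linear_mx_bound (R : realType) (m n : nat) (V : normedModType R) (f :
  {linear 'M[R]_(m, n) -> V}) A :
  `|f A| <= (\sum_i \sum_j `|f (delta_mx i j)|) * `|A|.
Proof.
rewrite {1}[A]matrix_sum_delta linear_sum; apply: le_trans (ler_norm_sum _ _ _)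
  _.
rewrite mulr_suml; apply: ler_sum => i _; rewrite linear_sum;
  apply: le_trans (ler_norm_sum _ _ _) _.
rewrite mulr_suml; apply: ler_sum => j _; rewrite linearZ normrZ mulrC
  ler_wpM2l//; exact: mx_norm_coord.
Qed.

Lemma linear_mx_continuous (R : realType) (m n : nat) (V :
  normedModType R) (f : {linear 'M[R]_(m, n) -> V}) :
  continuous f.
Proof.
move=> x; apply/(@cvgrPdist_le _ _ _ (nbhs x)) => /= e e0.
pose k := \sum_i \sum_j `|f (delta_mx i j)| + 1.
have k0 : 0 < k by rewrite ltr_wpDl//; apply: sumr_ge0 => i _; exact: sumr_ge0.
near=> y; rewrite -linearB; apply: le_trans (linear_mx_bound _ _) _.
apply: (@le_trans _ _ (k * `|x - y|)).
  by rewrite ler_wpM2r// lerDl.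
rewrite mulrC -ler_pdivlMr//.
near: y; apply: (@cvgr_dist_le _ _ _ _ _ id x) => //; exact: divr_gt0.
Unshelve. all: by end_near. Qed.

Lemma mx_compact (R : realType) (m n : nat) (A : set 'M[R]_(m, n)) M :
  (forall x, A x -> `|x| <= M) -> closed A -> compact A.
Proof.
move=> AM cA.
pose B : set 'rV[R]_(m * n) := [set v | A (vec_mx v)].
have cB : compact B.
  apply: bounded_closed_compact.
    exists M; split; first by rewrite num_real.
    move=> M' MM' v /AM /= h; apply: le_trans (ltW MM').
    apply/mx_norm_leP => [|i j]; first by apply: le_trans h.
    have [a [b ->]] : exists a, exists b, v i j = (vec_mx v) a b.
      case/mxvec_indexP: j => a b; exists a, b; by rewrite mxE ord1.
    apply: le_trans h; exact: mx_norm_coord.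
  apply: (@closed_comp _ _ (vec_mx : 'rV[R]_(m * n) ->
    'M[R]_(m, n)) A) => // x _; exact: linear_mx_continuous.
rewrite (_ : A = vec_mx @` B); last first.
  apply/seteqP; split => [x Ax|x [v Bv <-]//]; exists (mxvec x);
    last by rewrite mxvecK.
  by rewrite /B/= mxvecK.
apply: continuous_compact => //; apply: continuous_subspaceT;
  exact: linear_mx_continuous.
Qed.

Lemma jacE (R : realType) (n m : nat) (G : 'cV[R]_n ->
  'cV[R]_m) x h : 'd G x h = jac G x *m h.
Proof.
rewrite {1}[h]matrix_sum_delta linear_sum; apply/colP => i.
rewrite summxE mxE; apply: eq_bigr => j _.
by rewrite big_ord1 linearZ !mxE mulrC.
Qed.

Lemma littleo_epsP (R : realType) (V W : normedModType R) (G df : V ->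
  W) (x : V) :
  G \o shift x = cst (G x) + df +o_ 0 id <->
  forall e, 0 < e -> exists2 r, 0 < r & forall h, `|h| < r ->
    `|G (x + h) - G x - df h| <= e * `|h|.
Proof.
rewrite eqaddoP; split => h e e0.
  have := h e e0 => /nbhs_ballP[r /= r0 hr]; exists r => // k kr.
  have := hr k; rewrite -ball_normE/= sub0r normrN => /(_ kr).
  rewrite [_ k](_ : _ = G (k + x) - (G x + df k))//.
  by rewrite opprD addrA [x + k]addrC.
have [r r0 hr] := h e e0; apply/nbhs_ballP; exists r => //= k.
rewrite -ball_normE/= sub0r normrN => kr.
rewrite [_ k](_ : _ = G (k + x) - (G x + df k))//.
by have := hr k kr; rewrite /= opprD addrA [x + k]addrC.
Qed.

Lemma differentiable_fdiff (R : realType) (n m : nat) (G : 'cV[R]_n ->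
  'cV[R]_m) x :
  differentiable G x -> fdiff G x (jac G x).
Proof.
move=> /diff_locallyP[_ /littleo_epsP h] e /h[r r0 hr]; exists r => // k /hr.
by rewrite jacE.
Qed.

Lemma fdiff_differentiable (R : realType) (n m : nat) (G : 'cV[R]_n ->
  'cV[R]_m) x J :
  fdiff G x J -> differentiable G x /\ jac G x = J.
Proof.
move=> h.
have dE : 'd G x = mulmx J :> ('cV[R]_n -> 'cV[R]_m).
  by apply: (@diff_unique _ _ _ G (mulmx J) x) => //;
    [exact: linear_mx_continuous|exact/littleo_epsP].
split; first by apply/diff_locallyP; rewrite dE; split;
  [exact: linear_mx_continuous|exact/littleo_epsP].
by apply/matrixP => i j; rewrite mxE dE -colE mxE.
Qed.

Lemma fdiffN (R : realType) (n m : nat) (G : 'cV[R]_n -> 'cV[R]_m) p J :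
  fdiff G p J -> fdiff (fun x => - G x) p (- J).
Proof.
move=> h e e0; have [r r0 hr] := h e e0; exists r => // k /hr.
rewrite (_ : - G (p + k) - - G p - - J *m k = - (G (p + k) - G p - J *m k))
  ?normrN//.
by rewrite mulNmx !opprD.
Qed.

(** [mean_value] for [G] and for [- G] bounds every coordinate from both sides, which is all that
    the max norm asks for. *)
Lemma mean_value_norm (R : realType) (n m : nat) (G : 'cV[R]_n ->
  'cV[R]_m) (K r : R) (z a h : 'cV[R]_n)
   (c : 'cV[R]_m) e rho :
  (forall x y, `|x - z| < r -> `|y - z| < r -> `|G x - G y| <= K * `|x - y|) ->
  0 < rho -> 0 <= e ->
  (forall y s, 0 <= s <= 1 -> `|y - a| < rho -> `|y + s *: h - z| < r / 2) ->
  (forall y s J, 0 < s < 1 -> `|y - a| < rho -> fdiff G (y + s *: h) J ->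
    `|J *m h - c| <= e) ->
  `|G (a + h) - G a - c| <= e.
Proof.
move=> Glip rho0 e0 hin H; apply/cV_norm_leP => // i; rewrite !mxE ler_norml;
  apply/andP; split.
  have : (- G (a + h)) i 0 - (- G a) i 0 <= e - c i 0.
    apply: (mean_value (G := fun x => - G x) (K := K) (z :=
      z) _ rho0 hin) => [x y hx hy|y s J s01 ya hJ].
      by rewrite -opprD normrN; exact: Glip.
    have := fdiffN hJ; rewrite (_ : (fun x => - - G x) = G);
      last by apply/funext => x; rewrite opprK.
    move=> /(H _ _ _ s01 ya) /(cV_norm_leP _ e0) /(_ i).
    by rewrite mulNmx !mxE ler_norml => /andP[h1 h2]; lra.
  rewrite !mxE; lra.
have : G (a + h) i 0 - G a i 0 <= e + c i 0.
  apply: (mean_value (K := K) (z := z) _ rho0 hin) =>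
    // y s J s01 ya /(H _ _ _ s01 ya) /(cV_norm_leP _ e0) /(_ i).
  by rewrite !mxE ler_norml => /andP[h1 h2]; lra.
lra.
Qed.

Lemma fdiff_lip_bound (R : realType) (n m : nat) (G : 'cV[R]_n ->
  'cV[R]_m) (K r : R) p J (w : 'cV[R]_n) :
  0 < r -> (forall x y, `|x - p| < r -> `|y - p| < r ->
    `|G x - G y| <= K * `|x - y|) ->
  fdiff G p J -> `|J *m w| <= K * `|w|.
Proof.
move=> r0 Glip hJ; apply/ler_addgt0Pr => e e0.
have w0 : 0 < `|w| + 1 by rewrite ltr_wpDl.
have [d d0 hd] := hJ _ (divr_gt0 e0 w0).
pose t := Num.min d r / 2 / (`|w| + 1).
have m0 : 0 < Num.min d r by rewrite lt_min d0.
have t0 : 0 < t by rewrite !divr_gt0.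
have tw : `|t *: w| < Num.min d r.
  rewrite normrZ gtr0_norm// (_ : t * `|w| = Num.min d r / 2 * (`|w| / (`|w| +
    1))); last by rewrite /t; ring.
  apply: (@le_lt_trans _ _ (Num.min d r / 2)); last
    by rewrite ltr_pdivrMr// ltr_pMr// ltr1n.
  apply: ler_piMr; first by rewrite divr_ge0// ltW.
  by rewrite ler_pdivrMr// mul1r lerDl.
move: tw; rewrite lt_min => /andP[tw tr].
have h1 := hd _ tw.
have h2 := Glip (t *: w + p) p; rewrite addrK subrr normr0 in h2.
have {}h2 := h2 tr r0.
have : t * `|J *m w| <= t * (K * `|w| + e).
  rewrite -{1}(gtr0_norm t0) -normrZ scalemxAr.
  rewrite (_ : J *m _ = (G (t *: w + p) - G p) - (G (p + t *: w) - G p - J *m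
    (t *: w))); last first.
    by rewrite [p + _]addrC opprB [RHS]addrC subrK.
  apply: le_trans (ler_normB _ _) _; apply: le_trans (lerD h2 h1) _.
  rewrite normrZ gtr0_norm// mulrDr [t * (K * _)]mulrCA lerD2l.
  by rewrite mulrCA ler_pM2l// mulrAC ler_pdivrMr// ler_pM2l// lerDl.
by rewrite ler_pM2l.
Qed.

(* Near [z] itself nothing is known about the derivatives of [G], so the mean
   value estimate is applied on the segment from [z + sg *: h] to [z + h], and
   the rest is absorbed by the Lipschitz bound. *)
Lemma ray_estimate (R : realType) (n m : nat) (G : 'cV[R]_n ->
  'cV[R]_m) (K r : R) (z h : 'cV[R]_n)
   (c : 'cV[R]_m) E :
  (forall x y, `|x - z| < r -> `|y - z| < r -> `|G x - G y| <= K * `|x - y|) ->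
  0 <= E -> `|h| < r / 4 ->
  (forall sg, 0 < sg < 1 -> exists2 rho, 0 < rho & forall y s J,
    sg <= s <= 1 -> `|y - z| < rho ->
       fdiff G (y + s *: h) J -> `|J *m h - c| <= E) ->
  `|G (z + h) - G z - c| <= E.
Proof.
move=> Glip E0 hr H; apply/ler_addgt0Pr => e e0.
have r0 : 0 < r / 4 by apply: le_lt_trans hr.
(* Dropping the piece from [z] to [z + sg *: h] costs [sg * (|K| * |h| + |c|)], at most [e] for the
   [sg] below. The summand [e] makes [q] positive and [sg] less than 1. *)
pose q := `|K| * `|h| + `|c| + e.
have q0 : 0 < q by rewrite ltr_wpDl// addr_ge0// mulr_ge0.
pose sg := e / (2 * q).
have sg0 : 0 < sg by rewrite divr_gt0// mulr_gt0.
have sg1 : sg < 1.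
  rewrite ltr_pdivrMr ?mulr_gt0// mul1r /q; have :
    0 <= `|K| * `|h| by rewrite mulr_ge0.
  have := normr_ge0 c; lra.
have sgq : sg * q <= e.
  by rewrite /sg invfM mulrA divfK ?gt_eqF// ler_pdivrMr// ler_pMr// ler1n.
have [|rho rho0 hrho] := H sg; first by rewrite sg0.
have rm : 0 < Num.min rho (r / 4) by rewrite lt_min rho0.
have sE s : 0 <= s <= 1 -> sg <= sg + s * (1 - sg) <= 1.
  move=> /andP[s0 s1]; have : 0 <= s * (1 - sg)
    by rewrite mulr_ge0// subr_ge0 ltW.
  have : 0 <= (1 - s) * (1 - sg) by rewrite mulr_ge0 ?subr_ge0// ltW.
  move=> h1 h2; apply/andP; split; lra.
have yE y s : y + s *: ((1 - sg) *: h) = (y - sg *: h) + (sg + s * (1 - sg)) *: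
  h.
  by rewrite [in RHS]scalerDl scalerA addrA subrK.
have M : `|G ((z + sg *: h) + (1 - sg) *: h) - G (z + sg *: h) - (1 - sg) *: c|
  <= (1 - sg) * E.
  apply: (mean_value_norm (K := K) (r := r) (z := z) (rho :=
    Num.min rho (r / 4))) => //.
  - by rewrite mulr_ge0// subr_ge0 ltW.
  - move=> y s s01; rewrite lt_min => /andP[_ ya].
    rewrite yE (_ : _ - z = (y - (z + sg *: h)) + (sg + s * (1 - sg)) *: h);
      last first.
      rewrite opprD addrA -!addrA; congr (_ + _). by rewrite [RHS]addrCA;
        congr (_ + _); rewrite addrC.
    apply: le_lt_trans (ler_normD _ _) _.
    rewrite normrZ; have /andP[h1 h2] := sE _ s01.
    have : `|sg + s * (1 - sg)| * `|h| <= `|h|.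
      by rewrite ler_piMl// ger0_norm// (le_trans _ h1)// ltW.
    move: ya; set u := `|y - _|; move: hr; set v := `|h|; set w := _ * v; lra.
  - move=> y s J /andP[s0 s1]; rewrite lt_min => /andP[ya _]; rewrite yE => hJ.
    have s01 : 0 <= s <= 1 by rewrite (ltW s0) (ltW s1).
    rewrite -scalemxAr -scalerBr normrZ gtr0_norm ?subr_gt0// ler_pM2l
      ?subr_gt0//.
    apply: (hrho _ _ _ (sE _ s01) _ hJ).
    by rewrite (_ : _ - z = y - (z + sg *: h)) // opprD addrA addrAC.
have zE : z + sg *: h + (1 - sg) *: h = z + h by rewrite -addrA -scalerDl
  subrKC scale1r.
rewrite zE in M.
have L : `|G (z + sg *: h) - G z| <= sg * (`|K| * `|h|).
  have := Glip (z + sg *: h) z; rewrite [z + _]addrC addrK subrr normr0.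
  have sh : `|sg *: h| < r.
    rewrite normrZ gtr0_norm//; apply: le_lt_trans (_ : _ <= `|h|) _;
      first by rewrite ler_piMl// ltW.
    by move: hr; lra.
  have r00 : 0 < r by move: r0; lra.
  move=> /(_ sh r00) /le_trans; apply; rewrite normrZ gtr0_norm// mulrCA
    ler_pM2l//.
  by rewrite ler_wpM2r// ler_norm.
rewrite (_ : _ - c = (G (z + h) - G (z + sg *: h) - (1 - sg) *: c) + (G (z + sg
  *: h) - G z) - sg *: c); last first.
  rewrite scalerBl scale1r opprB; apply/colP => i; rewrite !mxE; ring.
apply: le_trans (ler_normB _ _) _; rewrite normrZ gtr0_norm//.
apply: le_trans (lerD (ler_normD _ _) (lexx _)) _.
apply: le_trans (lerD (lerD M L) (lexx _)) _.
have h1 : (1 - sg) * E <= E by rewrite ler_piMl// lerBlDr lerDl ltW.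
have h2 : sg * (`|K| * `|h|) + sg * `|c| <= sg * q.
  by rewrite -mulrDr ler_pM2l// /q lerDl ltW.
lra.
Qed.

(** * Limiting Jacobians and first-order estimates for semismooth maps *)

Lemma mx_cvg_distP (R : realType) (m n : nat) (u : nat ->
  'M[R]_(m, n)) (l : 'M[R]_(m, n)) :
  u @ \oo --> l <-> forall e, 0 < e -> \forall k \near \oo, `|u k - l| < e.
Proof.
split => [/(@cvgrPdist_lt _ _ _ (\oo)) h e /h|h];
  first by apply: filterS => k; rewrite distrC.
apply/(@cvgrPdist_lt _ _ _ (\oo)) => e /h; by apply: filterS => k;
  rewrite distrC.
Qed.

(** Removes sequences from the later arguments: a sequence is recovered by choosing a point at each
    scale [1 / (k + 1)]. *)
Lemma BsubdiffP (R : realType) (n m : nat) (G : 'cV[R]_n ->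
  'cV[R]_m) x (H : 'M[R]_(m, n)) :
  Bsubdiff G x H <-> forall e, 0 < e -> exists y J, [/\ `|y - x| < e,
    fdiff G y J & `|J - H| < e].
Proof.
split => [[u [/mx_cvg_distP ux du /mx_cvg_distP uH]] e e0|h].
  have [k [h1 h2]] := filter_ex (filterI (ux _ e0) (uH _ e0)).
  by exists (u k), (jac G (u k)); split => //; exact: differentiable_fdiff.
have /choice[u hu] : forall k : nat, exists y, exists J,
  [/\ `|y - x| < k.+1%:R^-1, fdiff G y J & `|J - H| < k.+1%:R^-1].
  by move=> k; apply: h; exact: inv_nat_gt0.
have small e : 0 < e -> \forall k \near \oo, k.+1%:R^-1 < e :> R.
  move=> e0; have [N hN] := ex_inv_nat e0; exists N => // k /= Nk.
  by apply: le_lt_trans hN; rewrite lef_pV2 ?posrE// ler_nat ltnS.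
exists u; split => [|k|].
- apply/mx_cvg_distP => e /small; apply: filterS => k ke;
  have [J [h1 _ _]] := hu k; exact: lt_trans h1 ke.
- by have [J [_ /fdiff_differentiable[]]] := hu k.
- apply/mx_cvg_distP => e /small; apply: filterS => k ke;
  have [J [_ /fdiff_differentiable[_ ->] h1]] := hu k; exact: lt_trans h1 ke.
Qed.

Lemma Bsubdiff_clarke (R : realType) (n m : nat) (G : 'cV[R]_n ->
  'cV[R]_m) x H :
  Bsubdiff G x H -> clarke G x H.
Proof.
move=> h; exists 1%N, (fun=> 1), (fun=> H); split => //;
  first by rewrite big_ord1.
by rewrite big_ord1 scale1r.
Qed.

Lemma fdiff_clarke (R : realType) (n m : nat) (G : 'cV[R]_n -> 'cV[R]_m) x J :
  fdiff G x J -> clarke G x J.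
Proof.
move=> h; apply: Bsubdiff_clarke; apply/BsubdiffP => e e0; exists x, J.
by rewrite !subrr !normr0.
Qed.

Lemma sphere_compact (R : realType) (n : nat) : compact [set x :
  'cV[R]_n | `|x| = 1].
Proof.
apply: (@mx_compact _ _ _ _ 1) => [x -> //|].
apply: (@closed_comp _ _ (fun x : 'cV[R]_n => `|x|) [set z | z = 1]) =>
  [x _|]; last exact: closed_eq.
exact: norm_continuous.
Qed.

(** The limit [l] of the products [V h'] is shown to be the directional derivative as well, with
    radii common to all [h] near [h0]; the covering argument on the sphere relies on this. A
    Jacobian [J] at [z + (s * t) *: (h + eta)] satisfies [J (h + eta)] close to [l] by
    semismoothness, and [J eta] is small by the Lipschitz bound. *)
Lemma semismooth_direction (R : realType) (n m : nat) (G : 'cV[R]_n ->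
  'cV[R]_m) z (h0 : 'cV[R]_n) :
  semismooth_at G z -> exists l : 'cV[R]_m, forall e, 0 < e ->
    exists2 d, 0 < d &
   forall t (h : 'cV[R]_n), 0 < t < d -> `|h - h0| < d ->
    `|G (z + t *: h) - G z - t *: l| <= e * t /\
    forall V, clarke G (z + t *: h) V -> `|V *m h - l| <= e.
Proof.
move=> [[r [K [r0 Glip]]] /(_ h0) [l hl]]; exists l => e e0.
have e2 := divr_gt0 e0 (ltr0Sn R 1).
have [d [d0 hd]] := hl _ e2.
have K1 : 0 < `|K| + 1 by rewrite ltr_wpDl.
have q0 : 0 < `|h0| + d + 1 by rewrite ltr_wpDl// addr_ge0// ltW.
(* The tolerance for [eta]: [d / 2] keeps [h + eta] within [d] of [h0], and the other bound gives
   [|J eta| <= e / 2]. *)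
pose rh := Num.min (d / 2) (e / 2 / (`|K| + 1)).
have rh0 : 0 < rh by rewrite lt_min !divr_gt0.
(* The second bound forces [|t *: h| < r / 8], well inside the ball where [G] is Lipschitz. *)
pose D := Num.min (d / 2) (r / 8 / (`|h0| + d + 1)).
have D0 : 0 < D by rewrite lt_min !divr_gt0.
exists D => // t h /andP[t0]; rewrite lt_min => /andP[td tr].
rewrite lt_min => /andP[hd' _].
have dd : d / 2 < d by rewrite ltr_pdivrMr// ltr_pMr// ltr1n.
split; last first.
  move=> V hV; apply: ltW; apply: (@lt_le_trans _ _ (e / 2));
    last by rewrite ler_pdivrMr// ler_pMr// ler1n.
  apply: (hd t h V) => //; [exact: lt_trans td dd|exact: lt_trans hd' dd].
have hn : `|h| <= `|h0| + d.
  rewrite -[h](subrK h0); apply: le_trans (ler_normD _ _) _.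
  by rewrite addrC lerD2l; apply: ltW; exact: lt_trans dd.
have thr : `|t *: h| < r / 8.
  rewrite normrZ gtr0_norm//; move: tr; rewrite ltr_pdivlMr// => tr.
  apply: le_lt_trans tr; rewrite ler_pM2l//; apply: le_trans hn _;
    by rewrite lerDl.
apply: (ray_estimate (K := K) (r := r)) => //.
- by rewrite mulr_ge0// ltW.
- by apply: lt_le_trans thr _; rewrite ler_pM2l// lef_pV2 ?posrE// ler_nat.
move=> sg /andP[sg0 sg1].
(* Since [s >= sg], the first bound makes [eta], which is [y - z] divided by [s * t], at most [rh]
   in norm. *)
exists (Num.min (t * sg * rh) (r / 8)); first by rewrite lt_min !mulr_gt0.
move=> y s J /andP[s0 s1]; rewrite lt_min => /andP[yz yr] hJ.
have st0 : 0 < s * t by rewrite mulr_gt0//; apply: lt_le_trans s0.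
have st1 : s * t <= t by rewrite ler_piMl// ltW.
pose eta := (s * t)^-1 *: (y - z).
have etaE : (s * t) *: eta = y - z by rewrite scalerA divff ?scale1r// gt_eqF.
have eta1 : `|eta| <= rh.
  rewrite /eta normrZ normfV gtr0_norm// mulrC ler_pdivrMr//.
  apply: le_trans (ltW yz) _; rewrite mulrC ler_pM2l// mulrC;
    rewrite ler_pM2r//.
have pE : y + s *: (t *: h) = z + (s * t) *: (h + eta).
  by rewrite scalerDr etaE; apply/colP => i; rewrite !mxE; ring.
have hJ' := hJ; rewrite pE in hJ'.
have h1 : `|J *m (h + eta) - l| < e / 2.
  apply: (hd (s * t)) => //; last exact: fdiff_clarke.
    by apply: le_lt_trans st1 _; exact: lt_trans td dd.
  rewrite addrAC; apply: le_lt_trans (ler_normD _ _) _; rewrite [d]splitr.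
  apply: ltr_leD => //; apply: le_trans eta1 _; by rewrite ge_min lexx.
have h2 : `|J *m eta| <= `|K| * `|eta|.
  have pr : `|y + s *: (t *: h) - z| < r / 2.
    rewrite addrAC; apply: le_lt_trans (ler_normD _ _) _.
    have : `|s *: (t *: h)| <= `|t *: h|.
      by rewrite [leLHS]normrZ ler_piMl// ger0_norm//; apply: ltW;
        apply: lt_le_trans s0.
    move: thr; set u := `|t *: h|; set v := `|s *: _|; move: yr;
      set w := `|y - z|; lra.
  have r2 : 0 < r / 2 by rewrite divr_gt0.
  apply: (fdiff_lip_bound (G := G) (p := y + s *: (t *: h)) (r := r / 2)) =>
    // x x' hx hx'.
  have hh w : `|w - (y + s *: (t *: h))| < r / 2 -> `|w - z| < r.
    move=> hw; rewrite -[w - z](subrKA (y + s *: (t *: h))) [r]splitr;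
      apply: le_lt_trans (ler_normD _ _) _; exact: ltrD.
  apply: le_trans (Glip _ _ (hh _ hx) (hh _ hx')) _;
    by rewrite ler_wpM2r// ler_norm.
rewrite -scalemxAr -scalerBr normrZ gtr0_norm// mulrC ler_pM2r//.
rewrite (_ : J *m h - l = (J *m (h + eta) - l) - J *m eta); last first.
  by rewrite mulmxDr addrAC addrK.
apply: le_trans (ler_normB _ _) _; rewrite [e]splitr; apply: lerD;
  first exact: ltW.
apply: le_trans h2 _; apply: (@le_trans _ _ ((`|K| + 1) * rh)).
  by apply: ler_pM => //; rewrite lerDl.
by rewrite mulrC -ler_pdivlMr// ge_min lexx orbT.
Qed.

Lemma semismooth_small_o (R : realType) (n m : nat) (G : 'cV[R]_n ->
  'cV[R]_m) z e :
  semismooth_at G z -> 0 < e -> exists2 d, 0 < d & forall (h : 'cV[R]_n) V,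
    `|h| < d ->
    clarke G (z + h) V -> `|V *m h - (G (z + h) - G z)| <= e * `|h|.
Proof.
move=> hG e0; have e2 := divr_gt0 e0 (ltr0Sn R 1).
have := (compact_near_coveringP _).1 (@sphere_compact R n).
pose P (d : R) (h : 'cV[R]_n) := forall t, 0 < t < d ->
  forall V, clarke G (z + t *: h) V -> `|V *m (t *: h) - (G (z + t *: h) - G
    z)| <= e * t.
move=> /(_ R (0^'+) P) H.
have : \forall d \near 0^'+, [set x : 'cV[R]_n | `|x| = 1] `<=` P d.
  apply: H => h0 _.
  have [l hl] := semismooth_direction h0 hG.
  have [d d0 hd] := hl _ e2.
  exists (ball h0 d, [set d' | d' < d]) => /=.
    split; first exact: nbhsx_ballx.
    exact: nbhs_right_lt.
  move=> [h d'] /= [hb dd'] t /andP[t0 td'] V hV.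
  rewrite mx_norm_ball /ball_/= distrC in hb.
  have [|h1 /(_ V hV) h2] := hd t h _ hb; first by rewrite t0 (lt_trans td').
  rewrite -scalemxAr (_ : _ - _ = t *: (V *m h - l) - (G (z + t *: h) - G z - t
    *: l)); last first.
    by rewrite scalerBr; apply/colP => i; move: (V *m h) => w; rewrite !mxE;
      ring.
  apply: le_trans (ler_normB _ _) _; rewrite [e]splitr mulrDl normrZ
    gtr0_norm//.
  by apply: lerD => //; rewrite mulrC ler_wpM2r// ltW.
move=> /(filterI (nbhs_right_gt (0:R))) /filter_ex[d [d0 hd]].
exists d => // h V hh hV.
have [h0|h0] := eqVneq h 0.
  by rewrite h0 addr0 mulmx0 !subrr !normr0 mulr0.
have n0 : 0 < `|h| by rewrite normr_gt0.
have := hd (`|h|^-1 *: h) _ `|h|.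
rewrite scalerA divff ?scale1r ?gt_eqF// n0 hh; apply => //=.
by rewrite normrZ normfV normr_id mulVf// gt_eqF.
Qed.

Lemma dirderiv_epsP (R : realType) (n m : nat) (G : 'cV[R]_n ->
  'cV[R]_m) z h l :
  dirderiv G z h l <-> forall e, 0 < e -> exists2 d, 0 < d & forall t,
    0 < t < d ->
    `|G (z + t *: h) - G z - t *: l| <= e * t.
Proof.
have E t : 0 < t -> `|l - t^-1 *: (G (z + t *: h) - G z)| * t = `|G (z + t *:
  h) - G z - t *: l|.
  move=> t0; rewrite mulrC -{1}(gtr0_norm t0) -normrZ scalerBr scalerA divff
    ?scale1r ?gt_eqF//.
  by rewrite distrC.
split => [/(@cvgrPdist_le _ _ _ (0^'+)) hl e e0|hl].
  have := hl e e0; rewrite near_withinE => /nbhs_ballP[d /= d0 hd].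
  exists d => // t /andP[t0 td]; rewrite -E// ler_pM2r//; apply: hd => //.
  by rewrite -ball_normE /ball_/= sub0r normrN gtr0_norm.
apply/(@cvgrPdist_le _ _ _ (0^'+)) => e /hl[d d0 hd].
near=> t; have t0 : 0 < t by near: t; exact: nbhs_right_gt.
rewrite -(ler_pM2r t0) E//; apply: hd; rewrite t0/=; near: t;
  exact: nbhs_right_lt.
Unshelve. all: by end_near. Qed.

Lemma dirderiv_lip (R : realType) (n m : nat) (G : 'cV[R]_n ->
  'cV[R]_m) (K r : R) z h h' l l' :
  0 < r -> (forall x y, `|x - z| < r -> `|y - z| < r ->
    `|G x - G y| <= K * `|x - y|) ->
  dirderiv G z h l -> dirderiv G z h' l' -> `|l - l'| <= K * `|h - h'|.
Proof.
move=> r0 Glip /dirderiv_epsP hl /dirderiv_epsP hl'; apply/ler_addgt0Pr => e e0.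
have e2 := divr_gt0 e0 (ltr0Sn R 1).
have [d d0 hd] := hl _ e2; have [d' d0' hd'] := hl' _ e2.
pose q := `|h| + `|h'| + 1.
have q0 : 0 < q by rewrite ltr_wpDl// addr_ge0.
pose M := Num.min (Num.min d d') (r / q).
have M0 : 0 < M by rewrite !lt_min d0 d0' divr_gt0.
pose t := M / 2.
have t0 : 0 < t by rewrite divr_gt0.
have : t < M by rewrite ltr_pdivrMr// ltr_pMr// ltr1n.
rewrite !lt_min => /andP[/andP[td td'] tr].
rewrite ltr_pdivlMr// in tr.
have h1 := hd t; rewrite t0 td in h1; have {}h1 := h1 isT.
have h2 := hd' t; rewrite t0 td' in h2; have {}h2 := h2 isT.
have b w : `|w| <= q -> `|z + t *: w - z| < r.
  move=> wq; rewrite addrC addKr normrZ gtr0_norm//; apply: le_lt_trans tr;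
    by rewrite ler_pM2l.
have h3 : `|G (z + t *: h) - G (z + t *: h')| <= t * (K * `|h - h'|).
  apply: le_trans (Glip _ _ (b _ _) (b _ _)) _.
  - by rewrite /q; have := normr_ge0 h'; lra.
  - by rewrite /q; have := normr_ge0 h; lra.
  rewrite (_ : z + t *: h - (z + t *: h') = t *: (h - h')); last first.
    by rewrite opprD addrACA subrr add0r scalerBr.
  by rewrite normrZ gtr0_norm// mulrCA.
rewrite -(ler_pM2l t0) -{1}(gtr0_norm t0) -normrZ.
rewrite (_ : t *: (l - l') = (G (z + t *: h) - G (z + t *: h')) - (G (z + t *:
  h) - G z - t *: l) + (G (z + t *: h') - G z - t *: l')); last first.
  rewrite scalerBr; apply/colP => i; move: (G _) (G _) (G _) => a b' c;
    rewrite !mxE; ring.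
apply: le_trans (ler_normD _ _) _.
apply: le_trans (lerD (ler_normB _ _) (lexx _)) _.
apply: le_trans (lerD (lerD h3 h1) h2) _.
rewrite -addrA -mulrDl -splitr mulrDr [e * t]mulrC//.
Qed.

Lemma dirderivZ (R : realType) (n m : nat) (G : 'cV[R]_n -> 'cV[R]_m) z h l s :
  0 < s -> dirderiv G z h l -> dirderiv G z (s *: h) (s *: l).
Proof.
move=> s0 /dirderiv_epsP hl; apply/dirderiv_epsP => e e0.
have [d d0 hd] := hl _ (divr_gt0 e0 s0).
exists (d / s) => [|t /andP[t0]]; first exact: divr_gt0.
rewrite ltr_pdivlMr// => ts; have := hd (t * s).
rewrite mulr_gt0// ts => /(_ isT); rewrite !scalerA => /le_trans; apply.
by rewrite mulrCA divfK// ?gt_eqF// mulrC.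
Qed.

Lemma semismooth_dirderiv (R : realType) (n m : nat) (G : 'cV[R]_n ->
  'cV[R]_m) z h :
  semismooth_at G z -> exists l, dirderiv G z h l.
Proof.
move=> /(semismooth_direction h)[l hl]; exists l;
  apply/dirderiv_epsP => e /hl[d d0 hd].
by exists d => // t td; have [] := hd t h td; rewrite ?subrr ?normr0.
Qed.

(** The definition compares [V h] with the directional derivative [D h], whereas Newton's method
    needs the increment. The increment is compared with [D h] by [ray_estimate]: at [z + w] with
    [w = s h + eta], [J w] is close to [D w] by the order condition, and [D w] to [s D h] since [D]
    is Lipschitz and positively homogeneous. *)
Lemma semismooth_order_estimate (R : realType) (n m : nat) alpha (G :
  'cV[R]_n -> 'cV[R]_m) z :
  0 < alpha -> alpha <= 1 -> semismooth_order_at alpha G z ->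
  exists c d, [/\ 0 <= c, 0 < d & forall (h : 'cV[R]_n) V, `|h| < d ->
    clarke G (z + h) V -> `|V *m h - (G (z + h) - G z)| <= c * `|h| `^ (1 +
      alpha)].
Proof.
move=> a0 a1 [hG [c [d [d0 hd]]]].
have [[r [K [r0 Glip]]] _] := hG.
have [D hD] := choice (fun h => semismooth_dirderiv h hG).
(* One [|c|] comes from [V h - D h] and [4 * |c| + 1] from the increment: [|w| <= 2 * s * |h|]
   brings in [2 ^ (1 + alpha) <= 4], and the 1 absorbs the terms in [eta]. *)
exists (5 * `|c| + 1), (Num.min (r / 4) (d / 2)); split.
- by rewrite addr_ge0// mulr_ge0.
- by rewrite lt_min !divr_gt0.
move=> h V; rewrite lt_min => /andP[hr hd2] hV.
have [h0|h0] := eqVneq h 0.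
  by rewrite h0 addr0 mulmx0 !subrr normr0 mulr_ge0 ?powR_ge0// addr_ge0//
    mulr_ge0.
have n0 : 0 < `|h| by rewrite normr_gt0.
set p := `|h| `^ (1 + alpha).
have p0 : 0 < p by rewrite powR_gt0.
have dd : `|h| < d by apply: lt_trans hd2 _; rewrite ltr_pdivrMr// ltr_pMr//
  ltr1n.
have h1 : `|V *m h - D h| <= `|c| * p.
  apply: le_trans (hd h V (D h) dd hV (hD h)) _;
    by rewrite ler_wpM2r ?ler_norm// ltW.
suff h2 : `|G (z + h) - G z - D h| <= (4 * `|c| + 1) * p.
  rewrite (_ : V *m h - _ = (V *m h - D h) - (G (z + h) - G z - D h));
    last first.
    by apply/colP => i; move: (V *m h) => v; rewrite !mxE; ring.
  apply: le_trans (ler_normB _ _) _; apply: le_trans (lerD h1 h2) _.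
  rewrite -mulrDl ler_wpM2r//; [exact: ltW|lra].
apply: (ray_estimate Glip) => //; first by rewrite mulr_ge0 ?ltW// addr_ge0//
  mulr_ge0.
move=> sg /andP[sg0 sg1].
pose k := 2 * `|K| + 1.
have k0 : 0 < k by rewrite ltr_wpDl// mulr_ge0.
(* The three bounds give, in turn, [|w| <= 2 * s * |h|], [2 * |K| * |eta| <= s * p], and [z + w] in
   the ball where [G] is Lipschitz. *)
exists (Num.min (sg * `|h|) (Num.min (sg * p / k) (r / 4))).
  by rewrite !lt_min !mulr_gt0//= invr_gt0// invr_gt0.
move=> y s J /andP[s0 s1]; rewrite !lt_min => /and3P[y1 y2 y3] hJ.
have sp : 0 < s by apply: lt_le_trans s0.
set eta := y - z in y1 y2 y3.
pose w := s *: h + eta.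
have pE : y + s *: h = z + w by rewrite /w /eta; apply/colP => i;
  rewrite !mxE; ring.
rewrite pE in hJ.
have wn : `|w| <= s * (2 * `|h|).
  apply: le_trans (ler_normD _ _) _; rewrite normrZ gtr0_norm// mulrDl mul1r
    mulrDr lerD2l.
  by apply: le_trans (ltW y1) _; rewrite ler_pM2r.
have wd : `|w| < d.
  apply: le_lt_trans wn _; apply: (@le_lt_trans _ _ (2 * `|h|)).
    by rewrite ler_piMl// mulr_ge0.
  by rewrite mulrC -ltr_pdivlMr.
have wr : `|w| < r / 2.
  apply: le_lt_trans (ler_normD _ _) _; rewrite normrZ gtr0_norm//.
  have : s * `|h| <= `|h| by rewrite ler_piMl.
  move: y3 hr; set u := `|eta|; set v := `|h|; set x := s * v; lra.
have H1 : `|J *m w - D w| <= `|c| * (s * (4 * p)).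
  apply: le_trans (hd w J (D w) wd (fdiff_clarke hJ) (hD w)) _.
  apply: (@le_trans _ _ (`|c| * `|w| `^ (1 + alpha))).
    by rewrite ler_wpM2r ?ler_norm// powR_ge0.
  rewrite ler_wpM2l//.
  apply: (@le_trans _ _ ((s * (2 * `|h|)) `^ (1 + alpha))).
    have x0 : 0 <= s * (2 * `|h|) by rewrite !mulr_ge0// ltW.
    by apply: ge0_ler_powR; rewrite ?nnegrE//; lra.
  have s00 := ltW sp.
  have h20 : 0 <= 2 * `|h| by rewrite mulr_ge0.
  rewrite powRM// powRM//; apply: ler_pM; rewrite ?mulr_ge0 ?powR_ge0//.
    (* For [0 < s <= 1] the power of [s] is at most [s]; this one factor is what gets cancelled at
       the end. *)
    by apply: ge1r_powR; [rewrite sp|rewrite lerDl ltW].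
  rewrite -/p; apply: ler_wpM2r; first exact: ltW.
  rewrite (_ : 4 = 2 `^ 2%:R); last by rewrite powR_mulrn// expr2; lra.
  by apply: ler_powR; [rewrite ler1n|lra].
have H2 : `|D w - s *: D h| <= `|K| * `|eta|.
  have := dirderiv_lip r0 Glip (hD w) (dirderivZ sp (hD h)).
  rewrite (_ : w - s *: h = eta); last by rewrite /w addrAC subrr add0r.
  move=> /le_trans; apply; by rewrite ler_wpM2r// ler_norm.
have H3 : `|J *m eta| <= `|K| * `|eta|.
  have r2 : 0 < r / 2 by rewrite divr_gt0.
  apply: (fdiff_lip_bound (G := G) (p := z + w) (r := r / 2)) => // x x' hx hx'.
  have hh u : `|u - (z + w)| < r / 2 -> `|u - z| < r.
    move=> hw; rewrite (_ : u - z = (u - (z + w)) + w);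
      last by apply/colP => i; move: (w) => w'; rewrite !mxE; ring.
    rewrite [r]splitr; apply: le_lt_trans (ler_normD _ _) _; exact: ltrD.
  apply: le_trans (Glip _ _ (hh _ hx) (hh _ hx')) _;
    by rewrite ler_wpM2r// ler_norm.
have H4 : 2 * (`|K| * `|eta|) <= s * p.
  have : `|eta| * k <= sg * p by rewrite -ler_pdivlMr// ltW.
  have : sg * p <= s * p by rewrite ler_pM2r.
  have := normr_ge0 eta; rewrite /k => q1 q2 q3.
  apply: le_trans (_ : _ <= `|eta| * (2 * `|K| + 1)) _;
    last by apply: le_trans q3 q2.
  lra.
have : s * `|J *m h - D h| <= s * ((4 * `|c| + 1) * p).
  rewrite -{1}(gtr0_norm sp) -normrZ scalerBr scalemxAr.
  rewrite (_ : J *m (s *: h) - s *: D h = (J *m w - D w) + (D w - s *: D h) - J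
    *m eta); last first.
    by rewrite addrA subrK /w mulmxDr addrAC addrK.
  apply: le_trans (ler_normB _ _) _.
  apply: le_trans (lerD (ler_normD _ _) (lexx _)) _.
  apply: le_trans (lerD (lerD H1 H2) H3) _.
  rewrite -addrA; apply: (@le_trans _ _ (`|c| * (s * (4 * p)) + s * p)).
    rewrite lerD2l; apply: le_trans H4; lra.
  rewrite le_eqVlt; apply/orP; left; apply/eqP; ring.
by rewrite ler_pM2l.
Qed.

(** * Compactness and semicontinuity of the Clarke subdifferential *)

(** [clarke G x] is the union over [p] of [convcomb (Bsubdiff G x) p]. The number of terms is
    exposed so that it can be bounded. *)
Definition convcomb (R : realType) (m n : nat) (B : set 'M[R]_(m,
  n)) (p : nat) : set 'M[R]_(m, n) :=
  [set H | exists (w : 'I_p -> R) (Hs : 'I_p -> 'M[R]_(m, n)),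
      [/\ (forall j, 0 <= w j), \sum_j w j = 1,
          (forall j, B (Hs j)) & H = \sum_j w j *: Hs j]].

Lemma convcomb_pad (R : realType) (m n : nat) (B : set 'M[R]_(m, n)) p H :
  convcomb B p H -> convcomb B p.+1 H.
Proof.
(* Zero terms are impossible, as the weights sum to 1. Otherwise an existing vertex is repeated with
   weight 0. *)
case: p => [|p] [w [Hs [w0 w1 hB ->]]].
  by move: w1; rewrite big_ord0 => /eqP; rewrite eq_sym oner_eq0.
exists (fun j => if unlift ord0 j is Some k then w k else 0),
  (fun j => if unlift ord0 j is Some k then Hs k else Hs ord0); split.
- by move=> j; case: unlift.
- by rewrite big_ord_recl unlift_none add0r -w1; apply: eq_bigr => j _;
  rewrite liftK.
- by move=> j; case: unlift.
- by rewrite [RHS]big_ord_recl unlift_none scale0r add0r;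
  apply: eq_bigr => j _; rewrite liftK.
Qed.

(* A linear dependency among the rows [(1, Hs j)] lets one move the weights
   until one of them vanishes. *)
Lemma convcomb_drop (R : realType) (m n : nat) (B : set 'M[R]_(m, n)) p H :
  (1 + m * n < p.+1)%N -> convcomb B p.+1 H -> convcomb B p H.
Proof.
move=> hp [w [Hs [w0 w1 hB hH]]].
pose Mx : 'M[R]_(p.+1, 1 + m * n) := \matrix_(j < p.+1) row_mx 1%:M (mxvec (Hs
  j)).
have [mu mu0 muM] : exists2 mu : 'rV[R]_p.+1, mu != 0 & mu *m Mx = 0.
  have : kermx Mx != 0.
    rewrite kermx_eq0 /row_free; apply: contraTneq hp => <-.
    by rewrite -leqNgt rank_leq_col.
  case/rowV0Pn => mu muk mu0; exists mu => //; exact/sub_kermxP.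
have muE : \sum_j mu 0 j = 0 /\ \sum_j mu 0 j *: Hs j = 0.
  have E : mu *m Mx = row_mx (\sum_j mu 0 j)%:M (mxvec (\sum_j mu 0 j *: Hs j)).
    rewrite mulmx_sum_row [in RHS]linear_sum -scalemx1 scaler_suml.
    rewrite (eq_bigr (fun j => row_mx (mu 0 j *: 1%:M)
      (mu 0 j *: mxvec (Hs j)))); last first.
      by move=> j _; rewrite rowK scale_row_mx.
    have S : forall (I : Type) (r : seq I) (f : I -> 'M[R]_1) (g : I ->
      'rV[R]_(m * n)),
      \sum_(i <- r) row_mx (f i) (g i) = row_mx (\sum_(i <- r) f i)
        (\sum_(i <- r) g i).
      move=> I r f g; elim: r => [|a r IH]; first by rewrite !big_nil row_mx0.
      by rewrite !big_cons IH add_row_mx.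
    rewrite S; congr row_mx.
    by apply: eq_bigr => j _; rewrite linearZ.
  move: muM; rewrite E -(row_mx0 _ 1 1 (m * n)) => /eq_row_mx[h1 h2]; split.
    by have := congr1 (fun A : 'M[R]_1 => A 0 0) h1; rewrite !mxE eqxx mulr1n.
  by apply: (can_inj mxvecK); rewrite h2 linear0.
have [j1 j1p] : exists j, 0 < mu 0 j.
  apply: contrapT => hn; move/eqP: mu0; apply; apply/rowP => j; rewrite mxE.
  have neg i : 0 <= - mu 0 i.
    by rewrite oppr_ge0 leNgt; apply/negP => h; apply: hn; exists i.
  have : \sum_j - mu 0 j = 0 by rewrite sumrN muE.1 oppr0.
  move/eqP; rewrite psumr_eq0; last by move=> i _; exact: neg.
  by move/allP => /(_ j (mem_index_enum _)) /=; rewrite oppr_eq0 => /eqP.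
(* The smallest ratio is the largest step along [- mu] that keeps all weights nonnegative, and it
   annihilates the weight of [j0]. *)
pose j0 := [arg min_(j < j1 | 0 < mu 0 j) (w j / mu 0 j)]%O.
have [j0p j0min] : 0 < mu 0 j0 /\ forall j, 0 < mu 0 j ->
  w j0 / mu 0 j0 <= w j / mu 0 j.
  by rewrite /j0; case: Order.TotalTheory.arg_minP.
pose t := w j0 / mu 0 j0.
have t0 : 0 <= t by rewrite divr_ge0// ltW.
pose w' j := w j - t * mu 0 j.
have w'j0 : w' j0 = 0 by rewrite /w' /t divfK ?subrr// gt_eqF.
have sw' : \sum_j w' j = 1 by rewrite sumrB w1 -mulr_sumr muE.1 mulr0 subr0.
have sH : H = \sum_j w' j *: Hs j.
  rewrite hH /w'; under [RHS]eq_bigr do rewrite scalerBl -scalerA.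
  by rewrite sumrB -scaler_sumr muE.2 scaler0 subr0.
exists (fun j => w' (lift j0 j)), (fun j => Hs (lift j0 j)); split => //.
- move=> j; rewrite /w' subr_ge0; have [h|h] := ltP 0 (mu 0 (lift j0 j)).
    by rewrite -ler_pdivlMr//; exact: j0min.
  by apply: le_trans (w0 _); rewrite mulr_ge0_le0.
- by rewrite -sw' [RHS](bigD1_ord j0)//= w'j0 add0r.
- by rewrite sH [LHS](bigD1_ord j0)//= w'j0 scale0r add0r.
Qed.

Lemma convcomb_caratheodory (R : realType) (m n : nat) (B : set 'M[R]_(m,
  n)) p H :
  convcomb B p H -> convcomb B (1 + m * n) H.
Proof.
have [hp|hp] := leqP p (1 + m * n).
  move=> h; rewrite -(subnK hp); elim: (_ - _)%N => [//|k]; exact: convcomb_pad.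
rewrite -(subnK (ltnW hp)); elim: (p - _)%N => [//|k IH] h; apply: IH;
  apply: convcomb_drop h.
by rewrite addSn ltnS leq_addl.
Qed.

Section compact_hull.
Context (R : realType) (m n q : nat).
Local Notation par := 'M[R]_(q, 1 + m * n).
(* A row [(w j, Hs j)] encodes one term of a convex combination. *)
Definition weight (P : par) (j : 'I_q) : R := P j (lshift (m * n) 0).
Definition vertex (P : par) (j : 'I_q) : 'M[R]_(m,
  n) := vec_mx (rsubmx (row j P)).

Lemma weight_continuous j : continuous (fun P => weight P j).
Proof.
move=> x; apply/(@cvgrPdist_lt _ R^o _ (nbhs x)) => e e0; near=> y.
have : `|(x - y) j (lshift (m * n) 0)| < e.
  apply: le_lt_trans (mx_norm_coord _ _ _) _; near: y;
    exact: (@cvgr_dist_lt _ _ _ _ _ id x).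
by rewrite !mxE.
Unshelve. all: by end_near. Qed.

Lemma vertex_continuous j : continuous (fun P => vertex P j).
Proof.
pose f : {linear par -> 'M[R]_(m, n)} := vec_mx \o (rsubmx \o (row j :
  par -> 'rV[R]_(1 + m * n))).
exact: (@linear_mx_continuous _ _ _ _ f).
Qed.

Lemma weight_sum_continuous : continuous (fun P : par => \sum_j weight P j).
Proof.
apply: continuous_big => [|j _ x]; first exact: add_continuous.
exact: (@weight_continuous j x).
Qed.

Lemma combination_continuous : continuous (fun P : par =>
  \sum_j weight P j *: vertex P j).
Proof.
apply: continuous_big => [|j _ x]; first exact: add_continuous.
have := @cvgZ _ _ _ (nbhs x) _ (fun P => weight P j) (fun P =>
  vertex P j) _ _ (@weight_continuous j x) (@vertex_continuous j x).
exact.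
Qed.

End compact_hull.

Lemma unitmx_lower_bound (R : realType) (n : nat) (H : 'M[R]_n) :
  H \in unitmx ->
  exists2 k, 0 < k & forall v : 'cV[R]_n, k * `|v| <= `|H *m v|.
Proof.
move=> uH; pose q := n%:R * `|invmx H| + 1.
have q0 : 0 < q by rewrite ltr_wpDl// mulr_ge0.
exists q^-1 => [|v]; first by rewrite invr_gt0.
rewrite mulrC ler_pdivrMr// -[in leLHS](mulKmx uH v).
apply: le_trans (mulmx_norm_le _ _) _; rewrite [leRHS]mulrC ler_wpM2r//.
by rewrite lerDl.
Qed.

Lemma lower_bound_near (R : realType) (m n : nat) (H H' : 'M[R]_(m, n)) k e :
  (forall v : 'cV[R]_n, k * `|v| <= `|H *m v|) -> `|H' - H| <= e ->
    n%:R * e <= k / 2 ->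
  forall v : 'cV[R]_n, k / 2 * `|v| <= `|H' *m v|.
Proof.
move=> hk he ek v.
have h1 : `|(H' - H) *m v| <= k / 2 * `|v|.
  apply: le_trans (mulmx_norm_le _ _) _; rewrite ler_wpM2r//.
  apply: le_trans ek; by rewrite ler_wpM2l.
have h2 := hk v.
have : `|H *m v| <= `|H' *m v| + `|(H' - H) *m v|.
  rewrite (_ : H *m v = H' *m v - (H' - H) *m v) ?ler_normB//.
  by rewrite mulmxBl opprB addrC subrK.
lra.
Qed.

(** With the number of terms fixed by Caratheodory, the hull is the image of one compact set [T] of
    weights and vertices. Around each point of [T], half of its own lower bound persists, and
    compactness yields a common constant. *)
Lemma convex_hull_lower_bound (R : realType) (n : nat) (B : set 'M[R]_n) M :
  (forall H, B H -> `|H| <= M) -> closed B -> (forall p H, convcomb B p H ->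
    H \in unitmx) ->
  exists2 k, 0 < k & forall p H, convcomb B p H ->
    forall v : 'cV[R]_n, k * `|v| <= `|H *m v|.
Proof.
move=> BM cB BU.
pose q := (1 + n * n)%N.
pose T : set 'M[R]_(q, 1 + n * n) := [set P | [/\ forall j, 0 <= weight P j,
  \sum_j weight P j = 1 & forall j, B (vertex P j)]].
have cT : compact T.
  apply: (@mx_compact _ _ _ _ (`|M| + 1)).
    move=> P [w0 w1 hB]; apply/mx_norm_leP => [|i j]; first by rewrite addr_ge0.
    rewrite -[j]splitK; case: (fintype.split j) => k /=.
      rewrite ord1 (_ : P i _ = weight P i)//.
      have : weight P i <= 1 by rewrite -w1 (bigD1 i)//= lerDl; apply: sumr_ge0.
      by rewrite ger0_norm// => h; apply: le_trans h _; rewrite lerDr.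
    have -> : P i (rshift 1 k) = mxvec (vertex P i) 0 k
      by rewrite /vertex vec_mxK !mxE.
    case/mxvec_indexP: k => a b; rewrite mxvecE.
    apply: le_trans (mx_norm_coord _ _ _) _; apply: le_trans (BM _ (hB i)) _.
    by apply: ler_wpDr => //; exact: ler_norm.
  rewrite (_ : T = (\bigcap_(j in [set: 'I_q]) ((fun P =>
    weight P j) @^-1` [set z | 0 <= z])) `&`
     ((fun P => \sum_j weight P j) @^-1` [set 1]) `&` (\bigcap_(j in [set:
       'I_q]) ((fun P => vertex P j) @^-1` B))).
    apply: closedI; first apply: closedI.
    - apply: closed_bigI => j _; apply: closed_comp; last exact: closed_ge.
      by move=> P _; exact: weight_continuous.
    - apply: (@closed_comp _ _ (fun P : 'M[R]_(q,
      1 + n * n) => \sum_j weight P j) [set z | z = 1]); last exact: closed_eq.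
      by move=> P _; exact: weight_sum_continuous.
    - apply: closed_bigI => j _; apply: closed_comp => //.
      by move=> P _; exact: vertex_continuous.
  apply/seteqP; split => [P [h1 h2 h3]|P [[h1 h2] h3]].
    by split; [split; [move=> j _; exact: h1|exact: h2]|move=> j _; exact: h3].
  by split; [move=> j; exact: (h1 j Logic.I)|exact: h2|move=> j;
    exact: (h3 j Logic.I)].
pose C (P : 'M[R]_(q, 1 + n * n)) := \sum_j weight P j *: vertex P j.
have := (compact_near_coveringP _).1 cT.
move=> /(_ R (0^'+) (fun k P => forall v : 'cV[R]_n,
  k * `|v| <= `|C P *m v|)) HN.
have {}HN : \forall k \near 0^'+, T `<=` (fun P => forall v : 'cV[R]_n,
  k * `|v| <= `|C P *m v|).
  apply: HN => P [w0 w1 hB].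
  have uC : C P \in unitmx by apply: (BU q); exists (weight P), (vertex P).
  have [k k0 hk] := unitmx_lower_bound uC.
  have n0 : (0 : R) < n%:R + 1 by rewrite ltr_wpDl.
  pose e := k / 2 / (n%:R + 1).
  have e0 : 0 < e by rewrite !divr_gt0.
  have ek : n%:R * e <= k / 2.
    by rewrite /e mulrA ler_pdivrMr// mulrC ler_pM2l ?divr_gt0// lerDl.
  exists ([set P' | `|C P' - C P| <= e], [set k' | k' <= k / 2]) => /=.
    split; last by apply: nbhs_right_le; rewrite divr_gt0.
    have /(@cvgrPdist_le _ _ _ (nbhs P)) := @combination_continuous R n n q P.
    by move=> /(_ e e0); apply: filterS => P'; rewrite distrC.
  move=> [P' k'] /= [h1 h2] v; have := lower_bound_near hk h1 ek v.
  by apply: le_trans; rewrite ler_wpM2r.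
have [k [k0 hk]] := filter_ex (filterI (nbhs_right_gt (0:R)) HN).
exists k => // p H /convcomb_caratheodory[w [Hs [w0 w1 hB ->]]] v.
pose P : 'M[R]_(q, 1 + n * n) := \matrix_(j < q) row_mx (w j)%:M (mxvec (Hs j)).
have Pw j : weight P j = w j by rewrite /weight /P mxE row_mxEl mxE eqxx mulr1n.
have PH j : vertex P j = Hs j by rewrite /vertex /P rowK row_mxKr mxvecK.
have TP : T P.
  split => [j||j]; rewrite ?Pw ?PH//.
  by under eq_bigr do rewrite Pw.
have := hk _ TP v; rewrite /C; under eq_bigr do rewrite Pw PH; exact.
Qed.

Lemma Bsubdiff_closed (R : realType) (n m : nat) (G : 'cV[R]_n ->
  'cV[R]_m) x : closed (Bsubdiff G x).
Proof.
move=> H cH; apply/BsubdiffP => e e0; have e2 := divr_gt0 e0 (ltr0Sn R 1).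
have [H' [/BsubdiffP/(_ _ e2)[y [J [h1 h2 h3]]]]] := cH _ (nbhsx_ballx H _ e2).
rewrite mx_norm_ball /ball_/= distrC => h4.
have ee : e / 2 < e by rewrite ltr_pdivrMr// ltr_pMr// ltr1n.
exists y, J; split => //; first exact: lt_trans ee.
rewrite (_ : J - H = (J - H') + (H' - H)); last by rewrite addrA subrK.
by rewrite [e]splitr; apply: le_lt_trans (ler_normD _ _) _; exact: ltrD.
Qed.

(** * Upper semicontinuity at a point near which the Jacobians are bounded *)

Section usc.
Context (R : realType) (n m : nat) (G : 'cV[R]_n ->
  'cV[R]_m) (x : 'cV[R]_n) (M r : R).
Hypothesis r0 : 0 < r.
Hypothesis JM : forall y J, `|y - x| < r -> fdiff G y J -> `|J| <= M.

Lemma Bsubdiff_bounded H : Bsubdiff G x H -> `|H| <= M.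
Proof.
move=> /BsubdiffP h; apply/ler_addgt0Pr => e e0.
have [|y [J [h1 h2 h3]]] := h (Num.min e r); first by rewrite lt_min e0.
move: h1 h3; rewrite !lt_min => /andP[_ yr] /andP[Je _].
have := JM yr h2.
rewrite distrC in Je; have := ler_normD (H - J) J; rewrite subrK.
move: Je; set a := `|H - J|; set b := `|H|; set c := `|J|; lra.
Qed.

(** The compact ball of candidate matrices is covered: a limiting Jacobian serves as the
    approximation for its neighbors, while a matrix that is not one has a neighborhood free of
    Jacobians taken near [x]. *)
Lemma fdiff_usc eta : 0 < eta -> exists2 d, 0 < d & forall y J,
  `|y - x| < d -> fdiff G y J ->
  exists2 H, Bsubdiff G x H & `|J - H| <= eta.
Proof.
move=> eta0.
have cK : compact [set H : 'M[R]_(m, n) | `|H| <= M].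
  apply: (@mx_compact _ _ _ _ M) => //.
  apply: (@closed_comp _ _ (fun x : 'M[R]_(m, n) =>
    `|x|) [set z | z <= M]) => [H _|]; last exact: closed_le.
  exact: norm_continuous.
have := (compact_near_coveringP _).1 cK.
pose P (d : R) (J : 'M[R]_(m, n)) := forall y, `|y - x| < d ->
  fdiff G y J -> exists2 H, Bsubdiff G x H & `|J - H| <= eta.
move=> /(_ R (0^'+) P) HN.
have {}HN : \forall d \near 0^'+, [set H : 'M[R]_(m, n) | `|H| <= M] `<=` P d.
  apply: HN => H0 _.
  have [BH|nB] := pselect (Bsubdiff G x H0).
    exists (ball H0 eta, setT); first by split;
      [exact: nbhsx_ballx|exact: filterT].
    move=> [J d] /= [hJ _] y _ _; exists H0 => //.
    by move: hJ; rewrite mx_norm_ball /ball_/= distrC => /ltW.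
  have [e [e0 he]] : exists e, 0 < e /\ forall y J, `|y - x| < e ->
    fdiff G y J -> `|J - H0| < e -> False.
    apply: contrapT => hn; apply: nB; apply/BsubdiffP => e e0.
    apply: contrapT => hn'; apply: hn; exists e; split => // y J h1 h2 h3;
      apply: hn'; by exists y, J.
  exists (ball H0 e, [set d | d < e]); first by split;
    [exact: nbhsx_ballx|exact: nbhs_right_lt].
  move=> [J d] /= [hJ de] y yd hy; exfalso; apply: (he y J) => //;
    first exact: lt_trans de.
  by move: hJ; rewrite mx_norm_ball /ball_/= distrC.
have [d [d0 hd]] := filter_ex (filterI (nbhs_right_gt (0:R)) HN).
exists (Num.min d r) => [|y J]; first by rewrite lt_min d0.
rewrite lt_min => /andP[yd yr] hJ; apply: (hd J _ y) => //; exact: JM hJ.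
Qed.

(** Each vertex is approximated separately and the weights are kept, so the error does not grow. *)
Lemma clarke_usc eta : 0 < eta -> exists2 d, 0 < d & forall y H,
  `|y - x| < d -> clarke G y H ->
  exists2 H', clarke G x H' & `|H - H'| <= eta.
Proof.
move=> eta0; have eta2 := divr_gt0 eta0 (ltr0Sn R 1).
have [d d0 hd] := fdiff_usc eta2.
have d2 : d / 2 < d by rewrite ltr_pdivrMr// ltr_pMr// ltr1n.
(* The other [d / 2] is for the distance from [y] to the point of differentiability that
   approximates a vertex. *)
exists (d / 2) => [|y H yd [p [w [Hs [w0 w1 hB ->]]]]];
  first by rewrite divr_gt0.
have /choice[Hs' hs'] : forall j, exists H', Bsubdiff G x H' /\ `|Hs j - H'| <=
  eta.
  move=> j; have /BsubdiffP/(_ (Num.min (eta / 2) (d / 2))) := hB j.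
  rewrite lt_min eta2 divr_gt0// => /(_ isT)[y' [J]];
    rewrite !lt_min => -[/andP[_ y1] hJ /andP[h1 _]].
  have [|H' BH' hH'] := hd y' J _ hJ.
    rewrite (_ : y' - x = (y' - y) + (y - x)); last by rewrite addrA subrK.
    by rewrite [d]splitr; apply: le_lt_trans (ler_normD _ _) _; exact: ltrD.
  exists H'; split => //.
  rewrite (_ : Hs j - H' = (J - H') - (J - Hs j));
    last by rewrite opprB [RHS]addrC addrA subrK.
  by apply: le_trans (ler_normB _ _) _; rewrite [eta]splitr;
    apply: lerD => //; exact: ltW.
exists (\sum_j w j *: Hs' j).
  by exists p, w, Hs'; split => // j; have [] := hs' j.
rewrite -sumrB; apply: le_trans (ler_norm_sum _ _ _) _.
rewrite -[eta]mul1r -w1 mulr_suml; apply: ler_sum => j _.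
rewrite -scalerBr normrZ ger0_norm// ler_wpM2l//; by have [] := hs' j.
Qed.

End usc.

(** The bound [k] on the hull at [x] survives as [k / 2] for matrices within [e] of it, and upper
    semicontinuity puts all nearby subdifferentials there. *)
Lemma clarke_lower_bound (R : realType) (n : nat) (G : 'cV[R]_n ->
  'cV[R]_n) x M r :
  0 < r -> (forall y J, `|y - x| < r -> fdiff G y J -> `|J| <= M) ->
  (forall H, clarke G x H -> H \in unitmx) ->
  exists2 k, 0 < k & exists2 d, 0 < d & forall y H, `|y - x| < d ->
    clarke G y H ->
    forall v : 'cV[R]_n, k * `|v| <= `|H *m v|.
Proof.
move=> r0 JM hU.
have [|k k0 hk] := @convex_hull_lower_bound R n (Bsubdiff G x) M
  (Bsubdiff_bounded r0 JM) (@Bsubdiff_closed _ _ _ G x).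
  by move=> p H [w [Hs hH]]; apply: hU; exists p, w, Hs.
have n0 : (0 : R) < n%:R + 1 by rewrite ltr_wpDl.
pose e := k / 2 / (n%:R + 1).
have e0 : 0 < e by rewrite !divr_gt0.
have ek : n%:R * e <= k / 2 by rewrite /e mulrA ler_pdivrMr// mulrC ler_pM2l
  ?divr_gt0// lerDl.
have [d d0 hd] := clarke_usc r0 JM e0.
exists (k / 2); first by rewrite divr_gt0.
exists d => // y H yd /(hd _ _ yd)[H' [p [w [Hs hH]]] HH'] v.
apply: lower_bound_near HH' ek v; apply: (hk p); by exists w, Hs.
Qed.

(** * Convergence of Newton's method *)

Lemma lower_bound_unitmx (R : realType) (n : nat) (H : 'M[R]_n) : (forall v :
  'cV[R]_n, H *m v = 0 -> v = 0) -> H \in unitmx.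
Proof.
move=> h; rewrite -unitmx_tr -row_free_unit -kermx_eq0;
  apply/rowV0P => v /sub_kermxP vH.
by apply: trmx_inj; rewrite trmx0; apply: h; rewrite -[H]trmxK -trmx_mul vH
  trmx0.
Qed.

Section newton.
Context (R : realType) (n : nat) (F : 'cV[R]_n ->
  'cV[R]_n) (xs : 'cV[R]_n) (k d : R).
Hypotheses (k0 : 0 < k) (d0 : 0 < d).
Hypothesis Hlow : forall y H, `|y - xs| < d -> clarke F y H ->
  forall v : 'cV[R]_n, k * `|v| <= `|H *m v|.

Lemma newton_unit y H : `|y - xs| < d -> clarke F y H -> H \in unitmx.
Proof.
move=> yd hH; apply: lower_bound_unitmx => v Hv; apply/eqP; rewrite -normr_le0.
by have := Hlow yd hH v; rewrite Hv normr0 pmulr_rle0.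
Qed.

(** [H] maps the new error to [H (y - xs) - F y], and the lower bound for [H] is divided out. *)
Lemma newton_step y H : `|y - xs| < d -> clarke F y H ->
  `|y - invmx H *m F y - xs| <= k^-1 * `|H *m (y - xs) - F y|.
Proof.
move=> yd hH; have uH := newton_unit yd hH.
rewrite mulrC ler_pdivlMr// mulrC; apply: le_trans (Hlow yd hH _) _.
by rewrite addrAC mulmxBr mulKVmx.
Qed.

Hypothesis Hsmall : forall e, 0 < e -> exists2 d', 0 < d' & forall y H,
  `|y - xs| < d' -> clarke F y H ->
   `|H *m (y - xs) - F y| <= e * `|y - xs|.

Lemma newton_contraction e : 0 < e -> exists2 d', 0 < d' & forall y H,
  `|y - xs| < d' -> clarke F y H ->
  H \in unitmx /\ `|y - invmx H *m F y - xs| <= e * `|y - xs|.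
Proof.
move=> e0; have [d' d'0 hd'] := Hsmall (mulr_gt0 k0 e0).
exists (Num.min d d') => [|y H]; first by rewrite lt_min d0.
rewrite lt_min => /andP[y1 y2] hH; split; first exact: newton_unit hH.
apply: le_trans (newton_step y1 hH) _; rewrite mulrC ler_pdivrMr//.
by apply: le_trans (hd' _ _ y2 hH) _; rewrite -[leLHS]mulrA [leLHS]mulrC.
Qed.

Lemma newton_local : exists2 d1, 0 < d1 & forall x Hs, `|x 0%N - xs| < d1 ->
  newton_run F x Hs ->
  [/\ forall i, `|x i - xs| < d, forall i, Hs i \in unitmx & x @ \oo --> xs].
Proof.
have h2 : (0 : R) < 2^-1 by rewrite invr_gt0.
have [d' d'0 hd'] := newton_contraction h2.
exists (Num.min d d') => [|x Hs x0 hx]; first by rewrite lt_min d0.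
have B i : `|x i - xs| <= 2^-1 ^+ i * `|x 0%N - xs|.
  elim: i => [|i IH]; first by rewrite expr0 mul1r.
  have [hC ->] := hx i.
  have xi : `|x i - xs| < d'.
    apply: le_lt_trans IH _; move: x0; rewrite lt_min => /andP[_ x0].
    apply: le_lt_trans _ x0; rewrite ler_piMl// exprn_ile1//.
    by rewrite invf_le1// ler1n.
  have [_ h] := hd' _ _ xi hC; apply: le_trans h _.
  by rewrite exprS -mulrA ler_pM2l.
have Bd i : `|x i - xs| < Num.min d d'.
  apply: le_lt_trans (B i) _; apply: le_lt_trans _ x0.
  by rewrite ler_piMl// exprn_ile1// invf_le1// ler1n.
split.
- by move=> i; have := Bd i; rewrite lt_min => /andP[].
- move=> i; have [hC _] := hx i; have := Bd i; rewrite lt_min => /andP[_ xd].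
  by have [] := hd' _ _ xd hC.
apply/mx_cvg_distP => e e0.
have : (fun i => 2^-1 ^+ i * `|x 0%N - xs|) @ \oo --> (0 * `|x 0%N - xs| : R).
  apply: cvgM; last exact: cvg_cst.
  by apply: cvg_expr; rewrite gtr0_norm// invf_lt1// ltr1n.
rewrite mul0r => /(@cvgrPdist_lt _ _ _ (\oo)) /(_ e e0); apply: filterS => i.
rewrite sub0r normrN ger0_norm; last by rewrite mulr_ge0// exprn_ge0// ltW.
exact: le_lt_trans (B i).
Qed.

Lemma newton_superlinear x Hs : newton_run F x Hs -> x @ \oo --> xs ->
  forall e : R, 0 < e -> \forall i \near \oo, `|x i.+1 - xs| <= e * `|x i - xs|.
Proof.
move=> hx /mx_cvg_distP xc e e0; have [d' d'0 hd'] := newton_contraction e0.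
apply: filterS (xc _ d'0) => i xi; have [hC ->] := hx i;
  by have [] := hd' _ _ xi hC.
Qed.

Lemma newton_order x Hs alpha c d' : 0 < d' ->
  (forall y H, `|y - xs| < d' -> clarke F y H -> `|H *m (y - xs) - F y| <= c *
    `|y - xs| `^ (1 + alpha)) ->
  newton_run F x Hs -> x @ \oo --> xs ->
  exists c : R, \forall i \near \oo, `|x i.+1 - xs| <= c * `|x i - xs| `^ (1 +
    alpha).
Proof.
move=> d'0 hc hx /mx_cvg_distP xc; exists (k^-1 * c).
have m0 : 0 < Num.min d d' by rewrite lt_min d0.
apply: filterS (xc _ m0) => i; rewrite lt_min => /andP[x1 x2];
  have [hC ->] := hx i.
apply: le_trans (newton_step x1 hC) _; rewrite -mulrA; apply: ler_wpM2l;
  first by rewrite invr_ge0 ltW.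
exact: hc.
Qed.

End newton.

(** * The block system *)

Lemma blk_idx (L N : nat) (i : 'I_N) (r : 'I_L) : blk (idx i r) = i.
Proof. by apply: val_inj; rewrite /= mulnC divnMDl ?(leq_ltn_trans _ (ltn_ord
  r))// divn_small ?addn0. Qed.

Lemma loc_idx (L N : nat) (i : 'I_N) (r : 'I_L) : loc (idx i r) = r.
Proof. by apply: val_inj; rewrite /= mulnC modnMDl modn_small. Qed.

Lemma idx_blk_loc (L N : nat) (k : 'I_(L * N)) : idx (blk k) (loc k) = k.
Proof. by apply: val_inj; rewrite /= mulnC -divn_eq. Qed.

Lemma sum_blk (V : nmodType) (L N : nat) (f : 'I_(L * N) ->
  V) : \sum_k f k = \sum_i \sum_r f (idx i r).
Proof.
rewrite pair_bigA/= (reindex (fun p : 'I_N * 'I_L => idx p.1 p.2))//.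
exists (fun k => (blk k, loc k)) => [[i r] _|k _];
  by rewrite /= ?blk_idx ?loc_idx ?idx_blk_loc.
Qed.

(** A linear equation satisfied by all Jacobians survives limits and convex combinations. It
    transfers the affine rows and the block structure to the Clarke subdifferential. *)
Lemma mul_coord_closed (R : realType) (n m : nat) (G : 'cV[R]_n ->
  'cV[R]_m) x H (h : 'cV[R]_n) k c :
  (forall y J, fdiff G y J -> (J *m h) k 0 = c) -> clarke G x H ->
    (H *m h) k 0 = c.
Proof.
move=> hJ [p [w [Hs [w0 w1 hB ->]]]].
have E j : (Hs j *m h) k 0 = c.
  apply/eqP; rewrite -subr_eq0 -normr_le0; apply/ler_addgt0Pr => e e0;
    rewrite add0r.
  have q0 : 0 < n%:R * `|h| + 1 by rewrite ltr_wpDl// mulr_ge0.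
  have /BsubdiffP/(_ _ (divr_gt0 e0 q0))[y [J [_ hy hd]]] := hB j.
  rewrite -(hJ y J hy) (_ : _ - _ = ((Hs j - J) *m h) k 0);
    last by rewrite mulmxBl !mxE.
  apply: le_trans (mx_norm_coord _ _ _) _; apply: le_trans (mulmx_norm_le _ _)
    _.
  rewrite distrC; move: hd; rewrite ltr_pdivlMr// => hd;
    apply: le_trans (ltW hd).
  by rewrite mulrAC mulrC ler_wpM2l// lerDl.
rewrite mulmx_suml summxE -[c]mul1r -w1 mulr_suml; apply: eq_bigr => j _.
by rewrite -scalemxAl mxE E.
Qed.

Lemma fdiff_affine_coord (R : realType) (n m : nat) (G : 'cV[R]_n ->
  'cV[R]_m) x J (h : 'cV[R]_n) k c :
  (forall t, G (x + t *: h) k 0 = G x k 0 + t * c) -> fdiff G x J ->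
    (J *m h) k 0 = c.
Proof.
move=> hc hJ.
have hJ' : fdiff G (x + 0 *: h) J by rewrite scale0r addr0.
have s1 := fdiff_slope k hJ'.
apply: slope_unique s1 _ => e e0; exists 1 => // t _.
rewrite add0r !hc mul0r addr0.
have -> : G x k 0 + t * c - G x k 0 - t * c = 0 by ring.
by rewrite normr0 mulr_ge0// ltW.
Qed.

Section system.
Context (R : realType) (dM L N : nat).
Local Notation n := (dM + L * N + L * N)%N.
(* [block_arg i x] is the argument (b_i, c_i) of S_i at x = (a, b, c), and
   [block_row i] extracts the rows of F that hold S_i. *)
Definition block_arg (i : 'I_N) (x : 'cV[R]_n) :
  'cV[R]_(L + L) := col_mx (subvec (dsubmx (usubmx x)) i) (subvec (dsubmx x) i).
Definition block_row (i : 'I_N) (v : 'cV[R]_n) :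
  'cV[R]_L := \col_r v (rshift (dM + L * N) (idx i r)) 0.
Definition block_vec (i : 'I_N) (v : 'cV[R]_L) :
  'cV[R]_(L * N) := \col_k (if blk k == i then v (loc k) 0 else 0).
Definition block_emb (i : 'I_N) (w : 'cV[R]_(L + L)) :
  'cV[R]_n := col_mx (col_mx 0 (block_vec i (usubmx w)))
  (block_vec i (dsubmx w)).
Definition block_jac (i : 'I_N) (H : 'M[R]_n) : 'M[R]_(L,
  L + L) := row_mx (Xblk H i) (Yblk H i).

Lemma block_argD i x y : block_arg i (x + y) = block_arg i x + block_arg i y.
Proof. by rewrite /block_arg add_col_mx; congr col_mx; apply/colP => r;
  rewrite !mxE. Qed.

Lemma block_argZ i t x : block_arg i (t *: x) = t *: block_arg i x.
Proof. by rewrite /block_arg scale_col_mx; congr col_mx; apply/colP => r;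
  rewrite !mxE. Qed.

Lemma block_argB i x y : block_arg i (x - y) = block_arg i x - block_arg i y.
Proof. by rewrite block_argD -scaleN1r block_argZ scaleN1r. Qed.

Lemma block_rowB i x y : block_row i (x - y) = block_row i x - block_row i y.
Proof. by apply/colP => r; rewrite !mxE. Qed.

Lemma col_mx_norm_le (p q : nat) (u : 'cV[R]_p) (v : 'cV[R]_q) e :
  `|u| <= e -> `|v| <= e -> `|col_mx u v| <= e.
Proof.
move=> ue ve; have e0 : 0 <= e by apply: le_trans ue.
apply/cV_norm_leP => // i; rewrite mxE; case: fintype.splitP => j _.
  by apply: le_trans ue; exact: mx_norm_coord.
by apply: le_trans ve; exact: mx_norm_coord.
Qed.

Lemma subvec_norm (b : 'cV[R]_(L * N)) i : `|subvec b i| <= `|b|.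
Proof. by apply/cV_norm_leP => // r; rewrite mxE; exact: mx_norm_coord. Qed.

Lemma usubmx_norm (p q : nat) (x : 'cV[R]_(p + q)) : `|usubmx x| <= `|x|.
Proof. by apply/cV_norm_leP => // r; rewrite mxE; exact: mx_norm_coord. Qed.

Lemma dsubmx_norm (p q : nat) (x : 'cV[R]_(p + q)) : `|dsubmx x| <= `|x|.
Proof. by apply/cV_norm_leP => // r; rewrite mxE; exact: mx_norm_coord. Qed.

Lemma block_arg_norm i x : `|block_arg i x| <= `|x|.
Proof.
apply: col_mx_norm_le; apply: le_trans (subvec_norm _ _) _;
  last exact: dsubmx_norm.
by apply: le_trans (dsubmx_norm _) _; exact: usubmx_norm.
Qed.

Lemma block_vec_norm i v : `|block_vec i v| <= `|v|.
Proof.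
apply/cV_norm_leP => // k; rewrite mxE; case: ifP => _; last by rewrite normr0.
exact: mx_norm_coord.
Qed.

Lemma block_emb_norm i w : `|block_emb i w| <= `|w|.
Proof.
apply: col_mx_norm_le; first apply: col_mx_norm_le; first by rewrite normr0.
  by apply: le_trans (block_vec_norm _ _) _; exact: usubmx_norm.
by apply: le_trans (block_vec_norm _ _) _; exact: dsubmx_norm.
Qed.

Lemma block_row_norm i v : `|block_row i v| <= `|v|.
Proof. by apply/cV_norm_leP => // r; rewrite mxE; exact: mx_norm_coord. Qed.

Lemma subvec_block_vec i v : subvec (block_vec i v) i = v.
Proof. by apply/colP => r; rewrite !mxE blk_idx eqxx loc_idx. Qed.

Lemma block_arg_emb i w : block_arg i (block_emb i w) = w.
Proof. by rewrite /block_arg /block_emb !(col_mxKu,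
  col_mxKd) !subvec_block_vec vsubmxK. Qed.

Lemma sum_block_vec (f : 'I_(L * N) -> R) i v : \sum_k f k * block_vec i v k 0
  = \sum_r f (idx i r) * v r 0.
Proof.
rewrite sum_blk (bigD1 i)//= [X in _ + X]big1 ?addr0.
  by apply: eq_bigr => r _; rewrite mxE blk_idx eqxx loc_idx.
move=> j ji; apply: big1 => r _; by rewrite mxE blk_idx (negbTE ji) mulr0.
Qed.

Lemma block_row_emb i (H : 'M[R]_n) w : block_row i (H *m block_emb i w) =
  block_jac i H *m w.
Proof.
apply/colP => r; rewrite mxE mxE big_split_ord/= big_split_ord/=.
rewrite big1 ?add0r => [|j _]; last by rewrite /block_emb !col_mxEu mxE mulr0.
rewrite [RHS]mxE big_split_ord/=; congr (_ + _).
  under eq_bigr do rewrite /block_emb col_mxEu col_mxEd.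
  by rewrite sum_block_vec; apply: eq_bigr => s _; rewrite row_mxEl !mxE.
under eq_bigr do rewrite /block_emb col_mxEd.
by rewrite sum_block_vec; apply: eq_bigr => s _; rewrite row_mxEr !mxE.
Qed.

End system.

(** * Subdifferential and first-order estimates of the block system *)

Section Fsystem.
Context (R : realType) (dM L N : nat).
Local Notation n := (dM + L * N + L * N)%N.
Variables (A : 'M[R]_dM) (B : 'M[R]_(dM, L * N)) (C : 'M[R]_(L * N))
  (Dv : 'I_N -> R) (l : 'cV[R]_dM) (S : 'I_N -> 'cV[R]_(L + L) -> 'cV[R]_L).
Local Notation F := (Fsys A B C Dv l S).
Definition scaling_mx : 'M[R]_(L * N) := diag_mx (\row_k Dv (blk k)).
Definition affine_mx : 'M[R]_(dM + L * N, n) := row_mx (block_mx A B B^T C)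
  (col_mx 0 scaling_mx).

Lemma affine_mxE (x : 'cV[R]_n) : affine_mx *m x = col_mx (A *m usubmx (usubmx
  x) + B *m dsubmx (usubmx x))
  (B^T *m usubmx (usubmx x) + C *m dsubmx (usubmx x) + scaling_mx *m dsubmx x).
Proof.
rewrite /affine_mx -[x in LHS]vsubmxK mul_row_col -[usubmx x in LHS]vsubmxK
  mul_block_col mul_col_mx mul0mx.
by rewrite add_col_mx addr0.
Qed.

Lemma usubmx_Fsys x : usubmx (F x) = affine_mx *m x + col_mx l 0.
Proof. by rewrite /Fsys /= col_mxKu affine_mxE add_col_mx addr0. Qed.

Lemma block_row_Fsys i x : block_row i (F x) = S i (block_arg i x).
Proof. by apply/colP => r; rewrite mxE /Fsys col_mxEd mxE blk_idx loc_idx. Qed.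

Lemma Fsys_splitP (x y : 'cV[R]_n) e : `|usubmx (x - y)| <= e ->
  (forall i, `|block_row i x - block_row i y| <= e) -> `|x - y| <= e.
Proof.
move=> h1 h2; rewrite -[x - y]vsubmxK; apply: col_mx_norm_le => //.
have e0 : 0 <= e by apply: le_trans h1.
apply/cV_norm_leP => // k; have := h2 (blk k) => /(cV_norm_leP _ e0)/(_ (loc
  k)).
by rewrite !mxE idx_blk_loc.
Qed.

(** [S i] is recovered from [F] by moving [x] only along [block_emb]. Through this, subdifferentials
    of [F] project into those of the [S i], where semismoothness is assumed. *)
Lemma fdiff_block i x J : fdiff F x J -> fdiff (S i) (block_arg i x)
  (block_jac i J).
Proof.
move=> hJ e e0; have [r r0 hr] := hJ e e0; exists r => // w wr.
have := hr (block_emb dM i w) (le_lt_trans (block_emb_norm dM i w) wr).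
have -> : block_arg i x + w = block_arg i (x + block_emb dM i w)
  by rewrite block_argD block_arg_emb.
rewrite -block_row_emb -!block_row_Fsys -!block_rowB => h.
apply: le_trans (block_row_norm _ _) _; apply: le_trans h _.
by rewrite ler_pM2l//; exact: block_emb_norm.
Qed.

Lemma block_jac_norm i (H : 'M[R]_n) : `|block_jac i H| <= `|H|.
Proof.
apply/mx_norm_leP => // r j; rewrite mxE; case: fintype.splitP => k _;
  rewrite mxE; exact: mx_norm_coord.
Qed.

Lemma block_jacB i (H H' : 'M[R]_n) : block_jac i (H - H') = block_jac i H -
  block_jac i H'.
Proof.
rewrite /block_jac -[- row_mx _ _]scaleN1r scale_row_mx add_row_mx.
by congr row_mx; apply/matrixP => r s; rewrite !mxE mulN1r.
Qed.

Lemma block_jac_sum i p (w : 'I_p -> R) (Hs : 'I_p -> 'M[R]_n) :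
  block_jac i (\sum_j w j *: Hs j) = \sum_j w j *: block_jac i (Hs j).
Proof.
apply/matrixP => r s; rewrite summxE /block_jac mxE.
case E: (fintype.split s) => [k|k]; rewrite mxE summxE; apply: eq_bigr => j _;
  rewrite mxE [in RHS]mxE [in RHS]mxE E [in RHS]mxE //.
Qed.

Lemma Bsubdiff_block i x H : Bsubdiff F x H -> Bsubdiff (S i) (block_arg i x)
  (block_jac i H).
Proof.
move=> /BsubdiffP h; apply/BsubdiffP => e /h[y [J [h1 h2 h3]]].
exists (block_arg i y), (block_jac i J); split; [|exact: fdiff_block|].
  by rewrite -block_argB; apply: le_lt_trans h1; exact: block_arg_norm.
by rewrite -block_jacB; apply: le_lt_trans h3; exact: block_jac_norm.
Qed.

Lemma clarke_block i x H : clarke F x H -> clarke (S i) (block_arg i x)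
  (block_jac i H).
Proof.
move=> [p [w [Hs [w0 w1 hB ->]]]]; exists p, w, (fun j => block_jac i (Hs j));
  split => //.
  by move=> j; exact: Bsubdiff_block.
exact: block_jac_sum.
Qed.

Lemma fdiff_top x J (h : 'cV[R]_n) k : fdiff F x J ->
  (J *m h) (lshift (L * N) k) 0 = (affine_mx *m h) k 0.
Proof.
apply: fdiff_affine_coord => t.
have E y : F y (lshift (L * N) k) 0 = usubmx (F y) k 0 by rewrite [RHS]mxE.
by rewrite !E !usubmx_Fsys mulmxDr -scalemxAr; move: (affine_mx *m x)
  (affine_mx *m h) => u v; rewrite !mxE; ring.
Qed.

Lemma clarke_top x H (h : 'cV[R]_n) : clarke F x H ->
  usubmx (H *m h) = affine_mx *m h.
Proof.
move=> hH; apply/colP => k; rewrite mxE.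
by apply: (mul_coord_closed _ hH) => y J; exact: fdiff_top.
Qed.

(** Subtracting [block_emb] of [block_arg i h] from [h] leaves a direction that does not move the
    argument of [S i]. The rows of block [i] are constant along it, hence annihilated by every
    Jacobian and so by [H]. *)
Lemma clarke_bottom x H (h : 'cV[R]_n) i : clarke F x H ->
  block_row i (H *m h) = block_jac i H *m block_arg i h.
Proof.
move=> hH; rewrite -block_row_emb; apply/eqP; rewrite -subr_eq0 -block_rowB
  -mulmxBr; apply/eqP/colP => r.
rewrite [in LHS]mxE [RHS]mxE; apply: (mul_coord_closed _ hH) => y J;
  apply: fdiff_affine_coord => t.
have E z : F z (rshift (dM + L * N) (idx i r)) 0 = block_row i (F z) r 0
  by rewrite [RHS]mxE.
by rewrite !E !block_row_Fsys block_argD block_argZ block_argB block_arg_emb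
  subrr scaler0 addr0 mulr0 addr0.
Qed.

(** The affine rows are linearized without error, so in the max norm only the blocks count. *)
Lemma Fsys_residual x y H e : clarke F y H -> 0 <= e ->
  (forall i, `|block_jac i H *m block_arg i (y - x) - (S i (block_arg i y) - S
    i (block_arg i x))| <= e) ->
  `|H *m (y - x) - (F y - F x)| <= e.
Proof.
move=> hH e0 hW; apply: Fsys_splitP => [|i].
  have uB (u v : 'cV[R]_n) : usubmx (u - v) = usubmx u - usubmx v
    by rewrite linearB.
  rewrite !uB (clarke_top _ hH) !usubmx_Fsys.
  have -> : affine_mx *m y + col_mx l 0 - (affine_mx *m x + col_mx l 0) =
    affine_mx *m (y - x).
    by rewrite opprD addrACA subrr addr0 mulmxBr.
  rewrite subrr normr0.
  exact: e0.
by rewrite (clarke_bottom _ _ hH) block_rowB !block_row_Fsys.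
Qed.

Lemma Fsys_small_o x e : (forall i, semismooth_at (S i) (block_arg i x)) ->
  0 < e -> exists2 d, 0 < d &
  forall y H, `|y - x| < d -> clarke F y H -> `|H *m (y - x) - (F y - F x)| <=
    e * `|y - x|.
Proof.
move=> hS e0.
have /choice[r hr] : forall i, exists d, 0 < d /\ forall h V, `|h| < d ->
    clarke (S i) (block_arg i x + h) V -> `|V *m h - (S i (block_arg i x + h) -
      S i (block_arg i x))| <= e * `|h|.
  by move=> i; have [d d0 hd] := semismooth_small_o (hS i) e0; exists d.
have [d d0 hd] := fin_lower_bound_gt0 (fun i => (hr i).1).
exists d => // y H yd hH; apply: Fsys_residual => //;
  first by rewrite mulr_ge0// ltW.
move=> i; have Zh := block_arg_norm i (y - x).
have := (hr i).2 (block_arg i (y - x)) (block_jac i H).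
rewrite block_argB subrKC -block_argB => /(_ (lt_le_trans (le_lt_trans Zh yd)
  (hd i)) (clarke_block i hH)) /le_trans; apply.
by rewrite ler_pM2l.
Qed.

Lemma Fsys_order alpha x : 0 < alpha -> alpha <= 1 ->
  (forall i, semismooth_order_at alpha (S i) (block_arg i x)) ->
  exists c d, 0 < d /\
  forall y H, `|y - x| < d -> clarke F y H -> `|H *m (y - x) - (F y - F x)| <=
    c * `|y - x| `^ (1 + alpha).
Proof.
move=> a0 a1 hS.
have /choice[r hr] : forall i, exists cd : R * R, [/\ 0 <= cd.1,
  0 < cd.2 & forall h V, `|h| < cd.2 ->
    clarke (S i) (block_arg i x + h) V -> `|V *m h - (S i (block_arg i x + h) -
      S i (block_arg i x))| <= cd.1 * `|h| `^ (1 + alpha)].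
  by move=> i; have [c [d hcd]] := semismooth_order_estimate a0 a1 (hS i);
    exists (c, d).
have r2 i : 0 < (r i).2 by have [] := hr i.
have r1 i : 0 <= (r i).1 by have [] := hr i.
have [d d0 hd] := fin_lower_bound_gt0 r2.
exists (\sum_i (r i).1), d; split => // y H yd hH.
have c0 : 0 <= \sum_i (r i).1 by apply: sumr_ge0.
apply: Fsys_residual => //; first by rewrite mulr_ge0// powR_ge0.
move=> i; have Zh := block_arg_norm i (y - x).
have [_ _ /(_ (block_arg i (y - x)) (block_jac i H))] := hr i.
rewrite block_argB subrKC -block_argB => /(_ (lt_le_trans (le_lt_trans Zh yd)
  (hd i)) (clarke_block i hH)) /le_trans; apply.
apply: ler_pM; rewrite ?powR_ge0//.
  by rewrite (bigD1 i)//= lerDl; apply: sumr_ge0.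
by apply: ge0_ler_powR; rewrite ?nnegrE//; lra.
Qed.

(** Supplies the bound required for upper semicontinuity. Columns of [J] are images of unit vectors:
    the affine rows are bounded through [affine_mx], the others through the Lipschitz constants of
    the [S i]. *)
Lemma Fsys_jac_bounded x : (forall i, loc_lipschitz (S i) (block_arg i x)) ->
  exists M r, 0 < r /\ forall y J, `|y - x| < r -> fdiff F y J -> `|J| <= M.
Proof.
move=> hS.
have /choice[r hr] : forall i, exists rk : R * R, 0 < rk.1 /\ forall y z,
  `|y - block_arg i x| < rk.1 -> `|z - block_arg i x| < rk.1 ->
    `|S i y - S i z| <= rk.2 * `|y - z|.
  by move=> i; have [r [k [r0 hk]]] := hS i; exists (r, k).
have [d d0 hd] := fin_lower_bound_gt0 (fun i => (hr i).1).
pose M := dM%:R + (L * N)%:R + (L * N)%:R * `|affine_mx| + \sum_i `|(r i).2|.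
have T0 : 0 <= n%:R * `|affine_mx| by rewrite mulr_ge0.
have s0 : 0 <= \sum_i `|(r i).2| by apply: sumr_ge0.
exists (n%:R * `|affine_mx| + \sum_i `|(r i).2|), (d / 2); split;
  first by rewrite divr_gt0.
move=> y J yd hJ; apply/mx_norm_leP => [|a b]; first by rewrite addr_ge0.
have hC := fdiff_clarke hJ.
have dn : `|delta_mx b 0 : 'cV[R]_n| <= 1.
  by apply/cV_norm_leP => // k; rewrite mxE; case: (_ && _);
    rewrite ?normr1 ?normr0.
have -> : J a b = (J *m (delta_mx b 0 : 'cV[R]_n)) a 0 by rewrite -colE mxE.
apply: le_trans (mx_norm_coord _ _ _) _.
rewrite -[J *m _]subr0; apply: Fsys_splitP => [|i].
  rewrite subr0 (clarke_top _ hC); apply: le_trans (mulmx_norm_le _ _) _.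
  by apply: ler_wpDr => //; rewrite ler_piMr.
have -> : block_row i (0 : 'cV[R]_n) = 0 by apply/colP => k; rewrite !mxE.
rewrite subr0 (clarke_bottom _ _ hC); apply: ler_wpDl => //.
have b1 : `|block_jac i J *m block_arg i (delta_mx b 0)| <= `|(r i).2| *
  `|block_arg i (delta_mx b 0 : 'cV[R]_n)|.
  have d2 : 0 < d / 2 by rewrite divr_gt0.
  apply: (fdiff_lip_bound (G := S i) (p := block_arg i y) (r := d / 2)) => //;
    last exact: fdiff_block.
  move=> u v hu hv.
  have hh w : `|w - block_arg i y| < d / 2 -> `|w - block_arg i x| < (r i).1.
    move=> hw; apply: lt_le_trans (hd i).
    rewrite (_ : w - _ = (w - block_arg i y) + block_arg i (y - x));
      last by rewrite block_argB addrA subrK.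
    rewrite [d]splitr; apply: le_lt_trans (ler_normD _ _) _; apply: ltrD => //.
    by apply: le_lt_trans yd; exact: block_arg_norm.
  apply: le_trans ((hr i).2 _ _ (hh _ hu) (hh _ hv)) _;
    by rewrite ler_wpM2r// ler_norm.
apply: le_trans b1 _; apply: (@le_trans _ _ `|(r i).2|).
  by rewrite ler_piMr//; apply: le_trans dn; exact: block_arg_norm.
by rewrite (bigD1 i)//= lerDl; apply: sumr_ge0.
Qed.

End Fsystem.

(** * Eigencomplementary pairs *)

Section dot.
Context (R : realType) (L : nat).
Implicit Types (u v : 'cV[R]_L).
Definition dot u v : R := (u^T *m v) 0 0.

Lemma dotE u v : dot u v = \sum_i u i 0 * v i 0.
Proof. by rewrite /dot mxE; apply: eq_bigr => i _; rewrite mxE. Qed.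

Lemma dotuu_ge0 u : 0 <= dot u u.
Proof. by rewrite dotE; apply: sumr_ge0 => i _; rewrite -expr2 sqr_ge0. Qed.

Lemma dotuu_eq0 u : dot u u = 0 -> u = 0.
Proof.
rewrite dotE => /eqP; rewrite psumr_eq0 => [|i _];
  last by rewrite -expr2 sqr_ge0.
move=> /allP h; apply/colP => i; have := h i (mem_index_enum _).
by rewrite /= -expr2 sqrf_eq0 mxE => /eqP.
Qed.

Lemma dotZr k u v : dot u (k *: v) = k * dot u v.
Proof. by rewrite /dot -scalemxAr mxE. Qed.

Lemma dotZl k u v : dot (k *: u) v = k * dot u v.
Proof. by rewrite /dot linearZ -scalemxAl mxE. Qed.

Lemma dot_sym_mx (X : 'M[R]_L) u v : X^T = X -> dot u (X *m v) = dot (X *m u) v.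
Proof. by move=> sX; rewrite /dot trmx_mul sX mulmxA. Qed.

Lemma eigen_orthogonal (X : 'M[R]_L) a b u v : X^T = X -> X *m u = a *: u ->
  X *m v = b *: v ->
  a != b -> dot u v = 0.
Proof.
move=> sX Xu Xv ab; have := dot_sym_mx u v sX; rewrite Xu Xv dotZl dotZr =>
  /eqP.
by rewrite -subr_eq0 -mulrBl mulf_eq0 subr_eq0 eq_sym (negbTE ab) => /eqP.
Qed.

(** The common eigenbasis [P] need not be orthonormal. Its Gram matrix, however, only links indices
    with equal [xi] and equal [mu], because eigenvectors of a symmetric matrix for different
    eigenvalues are orthogonal. This is enough to rewrite [dot b c] as a squared norm. *)
Lemma eigencomplementary_dot_ge0 (X Y : 'M[R]_L) b c :
  eigencomplementary X Y -> X *m b + Y *m c = 0 -> 0 <= dot b c.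
Proof.
move=> [[sX sY] nX pY [P [uP /choice[xi /choice[mu hP]]]] hs] hbc.
have colP0 j : col j P != 0.
  apply/eqP => h; have : invmx P *m col j P = delta_mx j 0
    by rewrite colE mulKmx.
  rewrite h mulmx0 => /colP/(_ j); rewrite !mxE !eqxx /= => /eqP.
  by rewrite eq_sym oner_eq0.
have dp j : 0 < dot (col j P) (col j P).
  by rewrite lt_neqAle dotuu_ge0 andbT eq_sym; apply: contraNneq (colP0 j) =>
    /dotuu_eq0 ->.
have xi0 j : xi j <= 0.
  have := nX (col j P); rewrite -mulmxA (hP j).1 -/(dot _ _) dotZr.
  by rewrite pmulr_lle0.
have mu0 j : 0 <= mu j.
  have := pY (col j P); rewrite -mulmxA (hP j).2 -/(dot _ _) dotZr.
  by rewrite pmulr_lge0.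
(* Equality would force [xi j = mu j = 0], so both matrices are singular and the kernel of [Y] is
   the sum of the negative eigenspaces of [X]. The column [j] of [P] would lie there and also in the
   kernel of [X], hence be orthogonal to itself. *)
have gap j : 0 < mu j - xi j.
  rewrite lt_neqAle subr_ge0 (le_trans (xi0 j) (mu0 j)) andbT eq_sym.
  apply/eqP => e0.
  have xz : xi j = 0 by apply/eqP; rewrite eq_le xi0 /=; have := mu0 j;
    move: e0; lra.
  have mz : mu j = 0 by move: e0; rewrite xz subr0.
  have Xp : X *m col j P = 0 by rewrite (hP j).1 xz scale0r.
  have Yp : Y *m col j P = 0 by rewrite (hP j).2 mz scale0r.
  have sing (Z : 'M[R]_L) : Z *m col j P = 0 -> singular Z.
    move=> Zp; apply/negP => uZ; move/eqP: (colP0 j); apply.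
    by rewrite -[col j P](mulKmx uZ) Zp mulmx0.
  have : eigsp Y 0 (col j P) by rewrite /eigsp/= Yp scale0r.
  rewrite -hs; last by split; exact: sing.
  move=> [p [z [w [z0 hw e]]]].
  have : dot (col j P) (col j P) = 0.
    rewrite {2}e /dot mulmx_sumr summxE; apply: big1 => k _;
      rewrite -/(dot _ _).
    apply: (eigen_orthogonal (a := 0) sX _ (hw k)); first by rewrite Xp scale0r.
    by rewrite gt_eqF.
  by move=> e'; have := dp j; rewrite e' ltxx.
pose be := invmx P *m b; pose ga := invmx P *m c.
have bE : b = P *m be by rewrite mulKVmx.
have cE : c = P *m ga by rewrite mulKVmx.
clearbody be ga.
have XP : X *m P = P *m diag_mx (\row_j xi j).
  by apply/matrixP => i j; have := (hP j).1 => /colP/(_ i);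
    rewrite mul_mx_diag !mxE mulrC => <-; apply: eq_bigr => k _; rewrite mxE.
have YP : Y *m P = P *m diag_mx (\row_j mu j).
  by apply/matrixP => i j; have := (hP j).2 => /colP/(_ i);
    rewrite mul_mx_diag !mxE mulrC => <-; apply: eq_bigr => k _; rewrite mxE.
have rel j : xi j * be j 0 + mu j * ga j 0 = 0.
  have : diag_mx (\row_j xi j) *m be + diag_mx (\row_j mu j) *m ga = 0.
    apply: (can_inj (mulKmx uP)); rewrite mulmx0 mulmxDr !mulmxA -XP -YP
      -!mulmxA -bE -cE.
    exact: hbc.
  by move=> /colP/(_ j); rewrite !mul_diag_mx !mxE.
(* By [rel], the pair [(be j, ga j)] is a multiple of [(mu j, - xi j)]; adding the two coordinates
   identifies the factor. *)
pose om j := (be j 0 + ga j 0) / (mu j - xi j).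
have beE j : be j 0 = mu j * om j.
  rewrite /om; have := rel j; have := gap j; move: (be j 0) (ga j 0) (mu j)
    (xi j) => x y m z g e.
  rewrite mulrA; apply/eqP; rewrite eq_sym; rewrite -(inj_eq (mulIf (lt0r_neq0
    g))) divfK ?lt0r_neq0//; apply/eqP.
  have -> : m * (x + y) = m * x + m * y by ring.
  have -> : m * y = - (z * x) by move: e; lra.
  ring.
have gaE j : ga j 0 = - xi j * om j.
  rewrite /om; have := rel j; have := gap j; move: (be j 0) (ga j 0) (mu j)
    (xi j) => x y m z g e.
  rewrite mulrA; apply/eqP; rewrite eq_sym; rewrite -(inj_eq (mulIf (lt0r_neq0
    g))) divfK ?lt0r_neq0//; apply/eqP.
  have -> : - z * (x + y) = - (z * x) - z * y by ring.
  have -> : z * x = - (m * y) by move: e; lra.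
  ring.
have dotP (x y : 'cV[R]_L) : dot (P *m x) (P *m y) = \sum_j \sum_k x j 0 * y k
  0 * dot (col j P) (col k P).
  have sc (z : 'cV[R]_L) : P *m z = \sum_j z j 0 *: col j P.
    by apply/colP => i; rewrite mxE summxE; apply: eq_bigr => j _;
      rewrite !mxE mulrC.
  rewrite !sc /dot [trmx _]linear_sum/= mulmx_suml summxE.
  apply: eq_bigr => j _; rewrite mulmx_sumr summxE; apply: eq_bigr => k _.
  by rewrite -/(dot _ _) dotZl dotZr mulrA.
pose rho j := Num.sqrt (mu j * - xi j).
(* Where the Gram entry of [j] and [k] is nonzero, [mu j * - xi k] equals [rho j * rho k], since the
   eigenvalues at [j] and [k] agree. *)
have -> : dot b c = dot (P *m \col_j (rho j * om j))
  (P *m \col_j (rho j * om j)); last exact: dotuu_ge0.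
rewrite bE cE !dotP; apply: eq_bigr => j _; apply: eq_bigr => k _;
  rewrite !mxE beE gaE.
have [G0|G0] := eqVneq (dot (col j P) (col k P)) 0; first by rewrite G0 !mulr0.
have xe : xi j = xi k.
  apply/eqP; apply: contraNT G0 => h; apply/eqP;
    exact: (eigen_orthogonal sX (hP j).1 (hP k).1 h).
have me : mu j = mu k.
  apply/eqP; apply: contraNT G0 => h; apply/eqP;
    exact: (eigen_orthogonal sY (hP j).2 (hP k).2 h).
have re : rho j = rho k by rewrite /rho xe me.
congr (_ * _); rewrite re.
have : rho k * rho k = mu k * - xi k.
  by rewrite -expr2 sqr_sqrtr// mulr_ge0// oppr_ge0.
rewrite me => e; rewrite [RHS](_ : _ = rho k * rho k * om j * om k);
  last by ring.
rewrite e; ring.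
Qed.

End dot.

Lemma Fsys_clarke_unitmx (R : realType) (dM L N : nat) (A : 'M[R]_dM) (B :
  'M[R]_(dM, L * N)) (C : 'M[R]_(L * N))
  (Dv : 'I_N -> R) (l : 'cV[R]_dM) (S : 'I_N -> 'cV[R]_(L + L) ->
    'cV[R]_L) x H :
  posdef (block_mx A B B^T C) -> (forall i, 0 < Dv i) ->
    clarke (Fsys A B C Dv l S) x H ->
  (forall i, eigencomplementary (Xblk H i) (Yblk H i)) -> H \in unitmx.
Proof.
move=> [_ hM] hD hH hE; apply: lower_bound_unitmx => v Hv.
have top := clarke_top v hH; rewrite Hv linear0 in top.
have bot i : 0 <= dot (subvec (dsubmx (usubmx v)) i) (subvec (dsubmx v) i).
  apply: eigencomplementary_dot_ge0 (hE i) _.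
  have := clarke_bottom v i hH; rewrite Hv /block_jac /block_arg mul_row_col =>
    <-.
  by apply/colP => r; rewrite !mxE.
set ab := usubmx v in bot *; set c := dsubmx v in bot *.
have topE : block_mx A B B^T C *m ab = - col_mx 0 (scaling_mx L Dv *m c).
  have De : col_mx (0 : 'M[R]_(dM, L * N)) (scaling_mx L Dv) *m c = col_mx 0
    (scaling_mx L Dv *m c).
    by rewrite mul_col_mx mul0mx.
  apply/eqP; rewrite -addr_eq0; apply/eqP; rewrite [RHS]top /affine_mx -[v in
    RHS]vsubmxK mul_row_col -De.
  by [].
have q : (ab^T *m block_mx A B B^T C *m ab) 0 0 = - \sum_i Dv i * dot (subvec
  (dsubmx ab) i) (subvec c i).
  rewrite -mulmxA topE mulmxN mxE; congr (- _).
  rewrite -[ab in LHS]vsubmxK tr_col_mx mul_row_col mulmx0 add0r mxE sum_blk.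
  apply: eq_bigr => i _; rewrite dotE mulr_sumr; apply: eq_bigr => r _.
  by rewrite /scaling_mx mul_diag_mx !mxE blk_idx mulrCA.
have ab0 : ab = 0.
  apply/eqP; apply: contraT => /hM; rewrite q oppr_gt0 ltNge sumr_ge0// => i _.
  by rewrite mulr_ge0// ltW.
(* With the first two components zero, the middle rows reduce to D c = 0, and the diagonal of D is
   positive. *)
have c0 : c = 0.
  move: topE; rewrite ab0 mulmx0 => /eqP; rewrite eq_sym oppr_eq0 => /eqP.
  rewrite -(col_mx0 _ dM (L * N) 1) => /eq_col_mx[_ h].
  apply/colP => k; move/colP/(_ k): h; rewrite /scaling_mx mul_diag_mx !mxE =>
    /eqP.
  by rewrite mulf_eq0 gt_eqF//= => /eqP.
by rewrite -[v]vsubmxK -/ab -/c ab0 c0 col_mx0.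
Qed.

Theorem theorem3p2 (R : realType) (d L M N : nat)
  (hd : (d == 2)%N || (d == 3)%N) (hL : (0 < L)%N) (hM : (0 < M)%N) (hN : (0 < N)%N)
  (A : 'M[R]_(d * M)) (B : 'M[R]_(d * M, L * N)) (C : 'M[R]_(L * N))
  (Dv : 'I_N -> R) (l : 'cV[R]_(d * M))
  (S : 'I_N -> 'cV[R]_(L + L) -> 'cV[R]_L)
  (xstar : 'cV[R]_(d * M + L * N + L * N))
  (hA : posdef A) (hC : posdef C) (hABC : posdef (block_mx A B B^T C))
  (hD : forall i, 0 < Dv i)
  (hS : forall i z, semismooth_at (S i) z)
  (hsol : Fsys A B C Dv l S xstar = 0)
  (hEC : forall H, clarke (Fsys A B C Dv l S) xstar H ->
           forall i, eigencomplementary (Xblk H i) (Yblk H i)) :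
  (exists U, nbhs xstar U /\
     forall x Hs, x 0%N \in U -> newton_run (Fsys A B C Dv l S) x Hs ->
       [/\ forall k, Hs k \in unitmx,
           x @ \oo --> xstar &
           forall eps : R, 0 < eps ->
             \forall k \near \oo, `|x k.+1 - xstar| <= eps * `|x k - xstar| ])
  /\
  (forall alpha : R, 0 < alpha -> alpha <= 1 ->
     (forall i z, semismooth_order_at alpha (S i) z) ->
     exists U, nbhs xstar U /\
       forall x Hs, x 0%N \in U -> newton_run (Fsys A B C Dv l S) x Hs ->
         [/\ forall k, Hs k \in unitmx,
             x @ \oo --> xstar &
             exists c : R,
               \forall k \near \oo, `|x k.+1 - xstar| <= c * `|x k - xstar| `^ (1 + alpha) ]).
Proof.
set F := Fsys A B C Dv l S.
have hunit H : clarke F xstar H -> H \in unitmx.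
  by move=> hH; apply: (Fsys_clarke_unitmx hABC hD hH); exact: hEC.
have [J [r [r0 hJ]]] := Fsys_jac_bounded A B C Dv l (fun i =>
  (hS i (block_arg i xstar)).1).
have [k k0 [e e0 hlow]] := clarke_lower_bound r0 hJ hunit.
have hsmall eps : 0 < eps -> exists2 d', 0 < d' & forall y H,
  `|y - xstar| < d' -> clarke F y H ->
    `|H *m (y - xstar) - F y| <= eps * `|y - xstar|.
  move=> eps0; have [d' d'0 h] := Fsys_small_o A B C Dv l (fun i =>
    hS i (block_arg i xstar)) eps0.
  by exists d' => // y H yd /(h y H yd); rewrite hsol subr0.
have [d1 d10 hloc] := newton_local k0 e0 hlow hsmall.
have start (x : nat -> 'cV[R]_(d * M + L * N + L * N)) :
  x 0%N \in (ball xstar d1 : set 'cV[R]_(d * M + L * N + L * N)) ->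
  `|x 0%N - xstar| < d1.
  by rewrite inE mx_norm_ball /ball_/= distrC.
(* Both claims use the same ball: a higher order of semismoothness improves only the asymptotic
   rate. *)
split=> [|alpha a0 a1 hSa]; exists (ball xstar d1); (split;
  first exact: nbhsx_ballx) => x Hs /start x0 hx.
  have [_ hU hx'] := hloc x Hs x0 hx; split => //.
  exact: newton_superlinear hlow hsmall _ _ hx hx'.
have [_ hU hx'] := hloc x Hs x0 hx; split => //.
have [c [d' [d'0 hc]]] := Fsys_order A B C Dv l a0 a1 (fun i =>
  hSa i (block_arg i xstar)).
apply: (newton_order k0 e0 hlow d'0 _ hx hx') => y H yd hH.
by have := hc y H yd hH; rewrite hsol subr0; exact.
Qed.
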